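(* Let $n\ge 1$ and let $\Omega\subset\mathbb{R}^{n+1}$ be a uniform domain (also known as a 1-sided NTA domain) whose boundary $\partial\Omega$ is uniformly rectifiable ($n$-dimensional UR). Then $\Omega$ is a chord-arc domain.
   Context: Notation: $H^n$ is $n$-dimensional Hausdorff measure; $\delta(X)=\operatorname{dist}(X,\partial\Omega)$; $B(x,r)$ is the open Euclidean ball in $\mathbb{R}^{n+1}$; a domain is a connected open set. Ahlfors-David regular (ADR): a closed set $E\subset\mathbb{R}^{n+1}$ is ($n$-dimensional) ADR if there is a constant $C$ such that $C^{-1}r^n\le H^n(E\cap B(x,r))\le Cr^n$ for all $x\in E$ and all $r\in(0,R_0)$, where $R_0$ is the diameter of $E$ (possibly infinite). Uniformly rectifiable (UR): a closed set $E\subset\mathbb{R}^{n+1}$ is ($n$-dimensional) UR if it is ADR and there is a constant $C$ such that for every ball $B=B(x_0,r)$ with $x_0\in E$, $r\le\operatorname{diam}(E)$, $$\iint_B|\nabla^2\mathcal{S}1(X)|^2\operatorname{dist}(X,E)\,dX\le Cr^n,$$ where $\mathcal{S}f(X)=\int_E\mathcal{E}(X-y)f(y)\,dH^n(y)$ is the harmonic single layer potential and $\mathcal{E}(X)=c_n|X|^{1-n}$ is the fundamental solution of the Laplacian in $\mathbb{R}^{n+1}$ (a logarithmic potential when $n+1=2$); $\nabla^2\mathcal S1(X)$ is understood as $\int_E(\nabla^2\mathcal E)(X-y)\,dH^n(y)$ for $X\notin E$. Equivalently (David-Semmes), $E$ is ADR and satisfies the bilateral weak geometric lemma: for each $\varepsilon>0$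 there is $C_1>0$ such that for all $x\in E$, $r>0$, the set $\{(y,t): y\in E,\ t>0,\ b\beta_E(y,t)\ge\varepsilon\}\cap(B(x,r)\times(0,r))$ has measure at most $C_1r^n$ with respect to $dH^n|_E\,\frac{dt}{t}$, where $b\beta_E(y,t)=\inf_P t^{-1}\big(\sup_{z\in E\cap B(y,t)}\operatorname{dist}(z,P)+\sup_{z\in P\cap B(y,t)}\operatorname{dist}(z,E)\big)$, the infimum being over all $n$-dimensional hyperplanes $P$. Corkscrew condition: an open set $\Omega$ satisfies it if there is a constant $c>0$ such that for every $x\in\partial\Omega$ and $0<r<\operatorname{diam}(\partial\Omega)$ there is a ball $B(X_\Delta,cr)\subset B(x,r)\cap\Omega$. Harnack Chain condition: there is a constant $C$ (and a finite number $C(\Lambda)$ for each $\Lambda\ge1$) such that for every $\rho>0$, $\Lambda\ge1$, and $X,X'\in\Omega$ with $\delta(X),\delta(X')\ge\rho$ and $|X-X'|<\Lambda\rho$, there are open balls $B_1,\dots,B_N\subset\Omega$, $N\le C(\Lambda)$, with $X\in B_1$, $X'\in B_N$, $B_k\cap B_{k+1}\ne\emptyset$, and $C^{-1}\operatorname{diam}(B_k)\le\operatorname{dist}(B_k,\partial\Omega)\le C\operatorname{diam}(B_k)$. Uniform (1-sided NTA) domain: a domain satisfying both the Corkscrew and Harnack Chain conditions. NTA domain: a 1-sided NTA domain $\Omega$ such that, in addition, $\Omega_{\rm ext}:=\mathbb{R}^{n+1}\setminus\overline{\Omega}$ satisfies the Corkscrew condition, that is, there is $c>0$ such that for every $x\in\partial\Omega$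 and $0<r<\operatorname{diam}(\partial\Omega)$ there is a ball of radius $cr$ contained in $B(x,r)\cap\Omega_{\rm ext}$. Chord-arc domain: an NTA domain with ADR boundary. *)

(* Defs.v *)
From HB Require Import structures.
From mathcomp Require Import all_boot all_order all_algebra.
From mathcomp Require Import all_classical all_reals all_analysis.
Set Implicit Arguments.
Unset Strict Implicit.
Unset Printing Implicit Defensive.
Import Order.TTheory GRing.Theory Num.Theory.
Import numFieldNormedType.Exports.
Local Open Scope classical_set_scope.
Local Open Scope ring_scope.

(* The norm that MathComp-Analysis puts on ['rV[R]_d] is the sup norm.  It is
   used below only through the topology and the differential structure, where
   the choice of norm is irrelevant; every metric notion uses [enorm]. *)
Section euclidean.
Context {R : realType} {d : nat}.
Local Notation V := 'rV[R]_d.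
Implicit Types (x y : V) (A B : set V).

Definition enorm x : R := Num.sqrt (\sum_(i < d) x 0 i ^+ 2).

Definition eball x (r : R) : set V := [set y | enorm (y - x) < r].

(* [+oo] when A is empty *)
Definition point_dist x A : \bar R := ereal_inf [set (enorm (x - y))%:E | y in A].

Definition set_dist A B : \bar R := ereal_inf [set point_dist x B | x in A].

(* [-oo] when A is empty *)
Definition ediam A : \bar R :=
  ereal_sup [set (enorm (p.1 - p.2))%:E | p in A `*` A].

Definition boundary A : set V := closure A `\` interior A.

End euclidean.

(* Volume of the unit ball of R^d:
   omega_0 = 1, omega_1 = 2, omega_(d+2) = 2 pi / (d+2) * omega_d. *)
Fixpoint ball_volume (R : realType) (d : nat) : R :=
  match d with
  | 0 => 1
  | 1 => 2
  | d'.+2 => 2 * pi / d%:R * ball_volume R d'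
  end.

Section hausdorff.
Context (R : realType) (d n : nat).
Local Notation V := 'rV[R]_d.
Implicit Types (A U : set V) (F : (set V)^nat) (delta : R).
Local Open Scope ereal_scope.

(* Case split on the empty set because [ediam set0 = -oo]. *)
Definition hausdorff_gauge U : \bar R :=
  if U == set0 then 0
  else (ball_volume R n)%:E * (ediam U * (2^-1)%:E) ^+ n.

Definition hausdorff_cover delta A : set (set V)^nat :=
  [set F | A `<=` \bigcup_k F k /\ forall k, ediam (F k) <= delta%:E].

Definition hausdorff_content delta A : \bar R :=
  ereal_inf [set \sum_(k <oo) hausdorff_gauge (F k) | F in hausdorff_cover delta A].

Definition hausdorff A : \bar R :=
  ereal_sup [set hausdorff_content delta A | delta in [set delta | (0 < delta)%R]].

Lemma ediam_ge0 U : U !=set0 -> 0 <= ediam U.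
Proof.
move=> [x Ux]; apply: ereal_sup_ubound; exists (x, x) => //=.
rewrite subrr /enorm big1 ?sqrtr0// => i _.
by rewrite mxE expr0n.
Qed.

Lemma ball_volume_ge0 k : (0 <= ball_volume R k)%R.
Proof.
suff : (0 <= ball_volume R k)%R /\ (0 <= ball_volume R k.+1)%R by case.
elim: k => [|k [IH1 IH2]]; first by split => /=.
split => //.
by rewrite [ball_volume _ _]/= mulr_ge0// divr_ge0// mulr_ge0// pi_ge0.
Qed.

Lemma hausdorff_gauge_ge0 U : 0 <= hausdorff_gauge U.
Proof.
rewrite /hausdorff_gauge; case: ifPn => // U0.
rewrite mule_ge0 ?lee_fin ?ball_volume_ge0// expe_ge0// mule_ge0 ?lee_fin//.
by apply: ediam_ge0; apply/set0P.
Qed.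

(* Giving infinite weight to the sets of diameter > delta turns
   [hausdorff_content] into an instance of the library's [mu_ext]. *)
Let weight delta (U : set V) : \bar R :=
  if U == set0 then 0 else
  if ediam U <= delta%:E then hausdorff_gauge U else +oo.

Let weight0 delta : weight delta set0 = 0.
Proof. by rewrite /weight eqxx. Qed.

Let weight_ge0 delta U : 0 <= weight delta U.
Proof. by rewrite /weight; do 2 case: ifP => // _; exact: hausdorff_gauge_ge0. Qed.

Let hausdorff_contentE delta A :
  hausdorff_content delta A =
  @mu_ext _ (g_sigma_algebraType (@setT (set V))) R (weight delta) A.
Proof.
apply/eqP; rewrite eq_le; apply/andP; split.
  apply: le_ereal_inf_tmp => _ [F [mF AF] <-].
  have [allF|/existsNP[k Fk]] := pselect
      (forall k, F k = set0 \/ ediam (F k) <= delta%:E).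
    apply: ereal_inf_lbound; exists F.
      split=> // k; have [->|//] := allF k.
      by rewrite /ediam setX0 image_set0 ereal_sup0 leNye.
    apply: eq_eseriesr => k _; rewrite /weight /hausdorff_gauge.
    case: ifPn => // F0; have [E|->//] := allF k.
    by rewrite E eqxx in F0.
  rewrite (@nneseries_pinfty _ _ xpredT k) ?leey//.
  move/not_orP: Fk => [/eqP/negbTE F0 /negP/negbTE Fd].
  by rewrite /weight F0 Fd.
apply: le_ereal_inf_tmp => _ [F [AF dF] <-]; apply: ereal_inf_lbound.
exists F; first by split=> [k|]; [exact: sub_sigma_algebra|].
apply: eq_eseriesr => k _; rewrite /weight dF /hausdorff_gauge.
by case: (F k == set0).
Qed.

Let hausdorff0 : hausdorff set0 = 0.
Proof.
rewrite /hausdorff [X in ereal_sup X](_ : _ = [set 0]) ?ereal_sup1//.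
apply/seteqP; split=> [_ [e e0 <-]|_ ->].
  by rewrite /= hausdorff_contentE mu_ext0.
by exists 1%R => //=; rewrite hausdorff_contentE mu_ext0.
Qed.

Let hausdorff_ge0 A : 0 <= hausdorff A.
Proof.
apply: (@le_trans _ _ (hausdorff_content 1 A)); last first.
  by apply: ereal_sup_ubound; exists 1%R => /=.
by rewrite hausdorff_contentE; exact: mu_ext_ge0.
Qed.

Let le_hausdorff : {homo hausdorff : A B / A `<=` B >-> A <= B}.
Proof.
move=> A B AB; apply: ge_ereal_sup => _ [e e0 <-].
apply: (@le_trans _ _ (hausdorff_content e B)); last first.
  by apply: ereal_sup_ubound; exists e.
by rewrite !hausdorff_contentE; exact: le_mu_ext.
Qed.

Let hausdorff_sigma_subadditive : sigma_subadditive hausdorff.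
Proof.
move=> F; apply: ge_ereal_sup => _ [e e0 <-].
rewrite hausdorff_contentE.
apply: (le_trans (@mu_ext_sigma_subadditive _
  (g_sigma_algebraType (@setT (set V))) R (weight e) (weight_ge0 e) F)).
apply: lee_nneseries => k _; first by move=> *; exact: (@mu_ext_ge0 _
  (g_sigma_algebraType (@setT (set V))) R (weight e) (weight_ge0 e)).
by rewrite -hausdorff_contentE; apply: ereal_sup_ubound; exists e.
Qed.

HB.instance Definition _ := isOuterMeasure.Build R V hausdorff
  hausdorff0 hausdorff_ge0 le_hausdorff hausdorff_sigma_subadditive.

End hausdorff.

Arguments hausdorff {R d} n A.

Section tuple_measure.
Context {d} {T : measurableType d} {R : realType}.
Local Open Scope ereal_scope.

Section cons.
Variables (n : nat) (mu : {sigma_finite_measure set T -> \bar R})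
  (nu : {sigma_finite_measure set (n.-tuple T) -> \bar R}).

Definition tcons (p : T * n.-tuple T) : n.+1.-tuple T := [tuple of p.1 :: p.2].

Definition cons_measure : set (n.+1.-tuple T) -> \bar R :=
  pushforward (mu \x nu) tcons.

Lemma measurable_tcons : measurable_fun [set: T * n.-tuple T] tcons.
Proof. exact: measurable_cons. Qed.

Let cons_measure0 : cons_measure set0 = 0.
Proof. by rewrite /cons_measure /pushforward preimage_set0 measure0. Qed.

Let cons_measure_ge0 A : 0 <= cons_measure A.
Proof. by rewrite /cons_measure /pushforward measure_ge0. Qed.

Let cons_measure_sigma_additive : semi_sigma_additive cons_measure.
Proof. apply: measure_semi_sigma_additive; exact: measurable_tcons. Qed.

HB.instance Definition _ := isMeasure.Build _ _ _ cons_measure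
  cons_measure0 cons_measure_ge0 cons_measure_sigma_additive.

Let cons_measure_sigma_finite : sigma_finite setT cons_measure.
Proof.
have /sigma_finiteP[F [TF ndF Foo]] := sigma_finiteT mu.
have /sigma_finiteP[G [TG ndG Goo]] := sigma_finiteT nu.
pose g (t : n.+1.-tuple T) : T * n.-tuple T := (thead t, [tuple of behead t]).
have mg : measurable_fun [set: n.+1.-tuple T] g.
  by apply/measurable_fun_pairP; split;
    [exact: measurable_tnth|exact: measurable_behead].
have gK p : g (tcons p) = p.
  by case: p => x t; rewrite /g /tcons theadE; congr pair; exact: val_inj.
exists (fun k => g @^-1` (F k `*` G k)) => [|k].
  apply/seteqP; split=> // t _.
  have [i _ Fi] : (\bigcup_k F k) (g t).1 by rewrite -TF.
  have [j _ Gj] : (\bigcup_k G k) (g t).2 by rewrite -TG.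
  exists (maxn i j) => //; split.
  - by have /subsetPset := ndF _ _ (leq_maxl i j); exact.
  - by have /subsetPset := ndG _ _ (leq_maxr i j); exact.
have [mF Fk] := Foo k; have [mG Gk] := Goo k; split.
  by rewrite -[X in measurable X]setTI; apply: mg => //; exact: measurableX.
rewrite /cons_measure /pushforward [X in (_ \x _) X](_ : _ = F k `*` G k).
  by rewrite product_measure1E// lte_mul_pinfty// ge0_fin_numE.
by rewrite predeqE => p; rewrite /preimage /mkset gK.
Qed.

HB.instance Definition _ := Measure_isSigmaFinite.Build _ _ _ cons_measure
  cons_measure_sigma_finite.

End cons.

(* The n-fold product measure, through T^(n+1) = T * T^n. *)
Fixpoint tuple_measure (mu : {sigma_finite_measure set T -> \bar R}) (n : nat) :
    {sigma_finite_measure set (n.-tuple T) -> \bar R} :=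
  if n is n'.+1 then cons_measure mu (tuple_measure mu n') else \d_([tuple]).

End tuple_measure.

Section euclidean_measures.
Context {R : realType}.
Local Open Scope ereal_scope.

(* Lebesgue measure of R^d, carried by d-tuples of reals (which the library
   equips with the product sigma-algebra); [vec_of_tuple] transports it. *)
Definition lebesgue_tuple (d : nat) :
    {sigma_finite_measure set (d.-tuple (measurableTypeR R)) -> \bar R} :=
  tuple_measure (@lebesgue_measure R) d.

Definition vec_of_tuple d (t : d.-tuple (measurableTypeR R)) : 'rV[R]_d :=
  \row_i tnth t i.

Definition integral_dX d (A : set 'rV[R]_d) (f : 'rV[R]_d -> \bar R) :
    \bar R :=
  \int[lebesgue_tuple d]_(t in @vec_of_tuple d @^-1` A) f (vec_of_tuple t).

Definition hausdorff_outer d n : {outer_measure set 'rV[R]_d -> \bar R} :=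
  @hausdorff R d n.

Definition hausdorff_measure d n :
    {measure set (caratheodory_type (hausdorff_outer d n)) -> \bar R} :=
  (hausdorff_outer d n : set (caratheodory_type (hausdorff_outer d n)) -> \bar R).

End euclidean_measures.

Section uniform_rectifiability.
Context {R : realType}.

Definition ADR d n (E : set 'rV[R]_d) : Prop :=
  closed E /\
  exists2 C : R, 0 < C &
    forall x r, E x -> 0 < r -> (r%:E < ediam E)%E ->
      ((C^-1 * r ^+ n)%:E <= hausdorff n (E `&` eball x r))%E /\
      (hausdorff n (E `&` eball x r) <= (C * r ^+ n)%:E)%E.

(* Normalized by Laplacian = Dirac mass at 0; (n+1) * ball_volume (n+1) is the
   area of the unit sphere of R^(n+1).  Meaningful for 1 <= n. *)
Definition fundamental_solution n (X : 'rV[R]_n.+1) : R :=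
  if n == 1%N then ln (enorm X) / (2 * pi)
  else - (n.-1%:R * (n.+1%:R * ball_volume R n.+1))^-1 * enorm X ^- n.-1.

Definition hessian m (f : 'rV[R]_m.+1 -> R) (X : 'rV[R]_m.+1) : 'M[R]_m.+1 :=
  \matrix_(i, j) 'D_(delta_mx 0 i) ('D_(delta_mx 0 j) f) X.

(* Hessian of the single layer potential of the function 1, for X outside E. *)
Definition hessian_single_layer1 n (E : set 'rV[R]_n.+1) (X : 'rV[R]_n.+1) :
    'M[R]_n.+1 :=
  \matrix_(i, j) \int[hausdorff_measure n.+1 n]_(y in E)
    hessian (@fundamental_solution n) (X - (y : 'rV[R]_n.+1)) i j.

Definition frobenius_sq p q (M : 'M[R]_(p, q)) : R :=
  \sum_(i < p) \sum_(j < q) M i j ^+ 2.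

(* The integrand vanishes on E because of the factor dist(X, E), so the junk
   value of [hessian_single_layer1] there is harmless. *)
Definition UR n (E : set 'rV[R]_n.+1) : Prop :=
  ADR n E /\
  exists C : R, forall x0 r, E x0 -> 0 < r -> (r%:E <= ediam E)%E ->
    (integral_dX (eball x0 r) (fun X =>
       (frobenius_sq (hessian_single_layer1 E X))%:E * point_dist X E)
     <= (C * r ^+ n)%:E)%E.

End uniform_rectifiability.

Section domains.
Context {R : realType} {d : nat}.
Local Notation V := 'rV[R]_d.
Implicit Types Omega U : set V.

Definition domain Omega : Prop := open Omega /\ connected Omega.

(* Every surface ball of the boundary of Omega has a corkscrew ball in U. *)
Definition corkscrew_in Omega U : Prop :=
  exists2 c : R, 0 < c &
    forall x r, boundary Omega x -> 0 < r -> (r%:E < ediam (boundary Omega))%E ->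
      exists X, eball X (c * r) `<=` eball x r `&` U.

Definition corkscrew Omega : Prop := corkscrew_in Omega Omega.

Definition exterior Omega : set V := ~` closure Omega.

(* Balls B_0, ..., B_(N-1) with centers [c] and radii [s]. *)
Definition harnack_chain Omega (C : R) (X X' : V) (N : nat)
    (c : nat -> V) (s : nat -> R) : Prop :=
  let B k := eball (c k) (s k) in
  [/\ (0 < N)%N, B 0%N X, B N.-1 X',
      forall k, (k.+1 < N)%N -> B k `&` B k.+1 !=set0 &
      forall k, (k < N)%N ->
        [/\ 0 < s k, B k `<=` Omega,
            (C^-1%:E * ediam (B k) <= set_dist (B k) (boundary Omega))%E &
            (set_dist (B k) (boundary Omega) <= C%:E * ediam (B k))%E]].

Definition harnack_chain_condition Omega : Prop :=
  exists2 C : R, 0 < C & exists bound : R -> nat,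
    forall rho Lambda (X X' : V),
      0 < rho -> 1 <= Lambda -> Omega X -> Omega X' ->
      (rho%:E <= point_dist X (boundary Omega))%E ->
      (rho%:E <= point_dist X' (boundary Omega))%E ->
      enorm (X - X') < Lambda * rho ->
      exists N c s, (N <= bound Lambda)%N /\ harnack_chain Omega C X X' N c s.

Definition uniform_domain Omega : Prop :=
  [/\ domain Omega, corkscrew Omega & harnack_chain_condition Omega].

Definition NTA_domain Omega : Prop :=
  uniform_domain Omega /\ corkscrew_in Omega (exterior Omega).

End domains.

Definition chord_arc_domain (R : realType) n (Omega : set 'rV[R]_n.+1) : Prop :=
  NTA_domain Omega /\ ADR n (boundary Omega).

(* Main.v *)
Require Import Defs.
From mathcomp Require Import all_boot all_order all_algebra.
From mathcomp Require Import all_classical all_reals all_analysis.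
From mathcomp Require Import measurable_realfun ring lra.
Import Order.TTheory GRing.Theory Num.Theory.
Import numFieldNormedType.Exports.
Set Implicit Arguments.
Unset Strict Implicit.
Unset Printing Implicit Defensive.
Local Open Scope classical_set_scope.
Local Open Scope ring_scope.

(** Only the exterior corkscrew condition has to be proved.  Let [E] be the boundary of
    [Omega] and let u be the single layer potential of the measure H^n on [E].

    The Carleson condition on the Hessian of u and a packing argument ([good_scale])
    provide, inside every surface ball of radius r, a centre [y] on [E] and a radius
    [t] comparable to r such that the Hessian of u is as small as one likes, compared
    to 1/t, at all points of the ball B(y, K t) at distance at least t/K from [E].  If
    one of these points is not in [Omega], the ball of radius t/K about it lies in the
    exterior of [Omega] ([exterior_ball]), and this is the exterior corkscrew ball.

    Suppose that all of them lie in [Omega].  Then Harnack chains of bounded length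
    join a fixed corkscrew point Xs to every point of B(y, t) that is not too close to
    [E], whichever side of [E] it seems to lie on, and the chains stay in the region
    where the Hessian is small.  After subtraction of its first-order expansion at Xs,
    the potential is thus almost zero at all these points
    ([harnack_chain_potential]).  Since every point of [E] has interior corkscrew
    points nearby, a modulus of continuity of the potential
    ([layer_potential_compare]) makes it almost zero on the whole of B(y, t).  But the
    Laplacian of u is the measure H^n on [E], whose mass in B(y, t/8) is at least
    a multiple of t^n, so that u cannot be almost affine there
    ([layer_potential_oscillation]).  [flat_hessian_complement] puts this contradiction
    together.

    To stay clear of the singularity, u is replaced near [E] by the potential with
    kernel [kernel_profile n (lifted_norm h X)], that is, by its values at height [h]
    over the hyperplane in one more dimension, where the profile is subharmonic as a
    function of the horizontal variable.  Subharmonicity is used through second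
    differences ([regularized_kernel_second_difference]) and the maximum principle
    through [discrete_maximum_principle].  The integrals against H^n exist because
    Borel sets are measurable ([closed_caratheodory_hausdorff], by Caratheodory's
    criterion), because the upper regularity of [E] holds for all centres and radii
    ([ADR_upper]), and because the mass of balls controls integrals of powers of the
    distance ([abs_integral_le_far], [abs_integral_le_near]). *)

(** * The radial kernel *)

Section radial_kernel.
Context {R : realType}.
Implicit Types (a b q s : R) (m n : nat).

Lemma mean_value_segment (f df : R -> R) a b : a <= b ->
  (forall x : R, a <= x -> x <= b -> is_derive x 1 f (df x)) ->
  exists c, [/\ a <= c, c <= b & f b - f a = df c * (b - a)].
Proof.
move=> ab fd.
have fd' x : x \in `[a, b]%R -> is_derive x 1 f (df x).
  by rewrite in_itv/= => /andP[]; exact: fd.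
have cf : {within `[a, b], continuous f}.
  by apply: derivable_within_continuous => x /fd' [].
have fd'' x : x \in `]a, b[%R -> is_derive x 1 f (df x).
  by move=> /subset_itv_oo_cc; exact: fd'.
have [c cab e] := MVT_segment ab fd'' cf.
by move: cab; rewrite in_itv/= => /andP[ac cb]; exists c; split => //.
Qed.

Lemma between_mean_value (f df : R -> R) a b :
  (forall x : R, 0 < x -> is_derive x 1 f (df x)) -> 0 < a -> 0 < b ->
  exists c, [/\ Num.min a b <= c, c <= Num.max a b & f b - f a = df c * (b - a)].
Proof.
move=> fd; wlog ab : a b / a <= b.
  move=> H a0 b0; case/orP: (le_total a b) => [ab|ba]; first exact: H.
  have [c [c1 c2 e]] := H _ _ ba b0 a0.
  exists c; rewrite minC maxC; split => //.
  by rewrite -(opprB (f a)) e; ring.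
move=> a0 b0; rewrite min_l// max_r//; apply: mean_value_segment => // x ax _.
by apply: fd; exact: lt_le_trans ax.
Qed.

Lemma ler_exprV m a b : 0 < a -> a <= b -> b ^- m <= a ^- m.
Proof.
move=> a0 ab; have b0 := lt_le_trans a0 ab.
rewrite lef_pV2 ?posrE ?exprn_gt0//.
by apply: lerXn2r => //; rewrite nnegrE ltW.
Qed.

Lemma exprVD m n a : a ^- (m + n) = a ^- m * a ^- n.
Proof. by rewrite exprD invfM. Qed.

Lemma exprVD_cancel m n a : 0 < a -> a ^+ m * a ^- (m + n) = a ^- n.
Proof. by move=> a0; rewrite exprVD mulrA divff ?mul1r// expf_neq0 ?gt_eqF. Qed.

(** A primitive of [s ^- n]: up to a positive factor, the profile of the
    fundamental solution of the Laplacian in dimension [n.+1]. *)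
Definition kernel_profile n s : R :=
  if n == 1%N then ln s else - (n.-1%:R * s ^+ n.-1)^-1.
Local Notation phi := kernel_profile.

Lemma is_derive_kernel_profile n s : (1 <= n)%N -> 0 < s ->
  is_derive s 1 (phi n) (s ^- n).
Proof.
move=> n1 s0; rewrite /kernel_profile; case: eqVneq => [->|n2].
  by rewrite expr1; exact: is_derive1_ln.
case: n n1 n2 => // -[//|n] _ _; rewrite /=.
set f := fun s : R => n.+1%:R * s ^+ n.+1.
have f0 : f s != 0 by rewrite mulf_neq0// ?pnatr_eq0// expf_neq0// gt_eqF.
have df : is_derive s 1 f (n.+1%:R * (n.+1%:R * s ^+ n)).
  rewrite (_ : f = n.+1%:R *: (@GRing.exp R ^~ n.+1)); last by [].
  have -> : (fun s : R => s ^+ n.+1) = (@id R) ^+ n.+1.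
    by apply/funext => x; rewrite fctE.
  apply: is_derive_eq.
  rewrite /GRing.scale/=.
  by rewrite mulr1.
have dV := @is_deriveV R f s _ 1 f0 df.
have -> : (fun x : R => - (n.+1%:R * x ^+ n.+1)^-1) = - (fun x => (f x)^-1).
  by apply/funext.
apply: is_derive_eq.
rewrite /GRing.scale/= /f.
have sn : s ^+ n != 0 by rewrite expf_neq0// gt_eqF.
have n0 : n.+1%:R != 0 :> R by rewrite pnatr_eq0.
rewrite !exprS; field.
by rewrite sn gt_eqF//= nat1r.
Qed.

Let profile2 n q : R := phi n (Num.sqrt q).

Let is_derive_profile2 n q : (1 <= n)%N -> 0 < q ->
  is_derive q 1 (profile2 n) (2^-1 * Num.sqrt q ^- n.+1).
Proof.
move=> n1 q0; have s0 : 0 < Num.sqrt q by rewrite sqrtr_gt0.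
have := @is_derive1_comp R (phi n) Num.sqrt q _ _
  (is_derive_kernel_profile n1 s0) (is_derive1_sqrt q0) => D.
apply: (@is_derive_eq _ _ _ _ _ _ _ _ D).
rewrite exprS.
have sn : Num.sqrt q ^+ n != 0 by rewrite expf_neq0// gt_eqF.
by field; rewrite sn gt_eqF.
Qed.

Let is_derive_sqrtXV m q : 0 < q ->
  is_derive q 1 (fun q => Num.sqrt q ^- m) (- (m%:R / 2) * Num.sqrt q ^- m.+2).
Proof.
case: m => [|m] q0.
  rewrite mul0r oppr0 mul0r (_ : (fun _ => _) = cst (1 : R)); first exact: is_derive_cst.
  by apply/funext => x; rewrite expr0 invr1.
have -> : (fun q => Num.sqrt q ^- m.+1) = - (m.+1%:R \*: profile2 m.+2).
  apply/funext => x; rewrite !fctE/= /profile2 /phi/= /GRing.scale/=.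
  rewrite invfM mulrN opprK mulrA divff ?mul1r// pnatr_eq0//.
have := is_derive_profile2 (ltn0Sn m.+1) q0 => D.
apply: is_derive_eq.
by rewrite /GRing.scale/= mulrA mulNr.
Qed.

Lemma kernel_profile_increase_ge n a b : (1 <= n)%N -> 0 < a -> a <= b ->
  b ^- n * (b - a) <= phi n b - phi n a.
Proof.
move=> n1 a0 ab.
have [c [ac cb ->]] := @mean_value_segment (phi n) (fun s => s ^- n) a b ab
  (fun x ax _ => is_derive_kernel_profile n1 (lt_le_trans a0 ax)).
rewrite ler_wpM2r ?subr_ge0//; apply: ler_exprV => //.
exact: lt_le_trans ac.
Qed.

Lemma ler_kernel_profile n a b : (1 <= n)%N -> 0 < a -> a <= b -> phi n a <= phi n b.
Proof.
move=> n1 a0 ab; rewrite -subr_ge0; apply: le_trans (kernel_profile_increase_ge n1 a0 ab).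
by rewrite mulr_ge0 ?subr_ge0// invr_ge0 exprn_ge0// (le_trans _ ab)// ltW.
Qed.

(** Half-power modulus: it stays integrable against an [n]-dimensional measure
    after division by the distance, uniformly up to the singularity, and treats
    the logarithm and the powers alike. *)
Lemma kernel_profile_increase_le n a b : (1 <= n)%N -> 0 < a -> a <= b ->
  phi n b - phi n a <= 2 * Num.sqrt (b - a) * (Num.sqrt a * a ^- n).
Proof.
move=> n1 a0 ab.
pose K := Num.sqrt a * a ^- n.
have K0 : 0 <= K by rewrite mulr_ge0 ?sqrtr_ge0// invr_ge0 exprn_ge0// ltW.
pose f := (2 * K) \*: (@Num.sqrt R) - phi n.
have fd (x : R) : a <= x -> x <= b ->
    is_derive x 1 f ((2 * K) * (2 * Num.sqrt x)^-1 - x ^- n).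
  move=> ax _; have x0 := lt_le_trans a0 ax.
  have := is_derive_kernel_profile n1 x0 => D1.
  have := is_derive1_sqrt x0 => D2.
  exact: (is_deriveB (is_deriveZ (2 * K) D2) D1).
have [c [ac cb]] := mean_value_segment ab fd.
have c0 := lt_le_trans a0 ac.
move=> e; have {}e : 2 * K * Num.sqrt b - phi n b - (2 * K * Num.sqrt a - phi n a)
    = (2 * K * (2 * Num.sqrt c)^-1 - c ^- n) * (b - a) by [].
have df0 : 0 <= 2 * K * (2 * Num.sqrt c)^-1 - c ^- n.
  have sa : 0 < Num.sqrt a by rewrite sqrtr_gt0.
  have sc : 0 < Num.sqrt c by rewrite sqrtr_gt0.
  have -> : 2 * K * (2 * Num.sqrt c)^-1 = K / Num.sqrt c by field; rewrite gt_eqF.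
  rewrite subr_ge0 ler_pdivlMr// /K.
  have [-> ->] : a = Num.sqrt a ^+ 2 /\ c = Num.sqrt c ^+ 2.
    by rewrite !sqr_sqrtr ?ltW.
  rewrite !sqrtr_sqr !ger0_norm ?sqrtr_ge0// -!exprM.
  have m1 : (2 * n = 1 + (2 * n).-1)%N by case: n n1 {K K0 f fd e}.
  rewrite m1 mulrC -[X in X * _]expr1 exprVD_cancel// -[X in _ <= X * _]expr1.
  by rewrite exprVD_cancel//; apply: ler_exprV => //; rewrite ler_sqrt// ltW.
have {}e : phi n b - phi n a <= 2 * K * (Num.sqrt b - Num.sqrt a).
  have ab' : 0 <= b - a by rewrite subr_ge0.
  have := mulr_ge0 df0 ab'; rewrite -e; lra.
apply: le_trans e _.
rewrite [leRHS]mulrAC -/K; apply: ler_wpM2l; first by rewrite mulr_ge0.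
rewrite lerBlDr; have b0 := lt_le_trans a0 ab.
rewrite -ler_sqr ?nnegrE ?addr_ge0 ?sqrtr_ge0// sqrrD !sqr_sqrtr ?subr_ge0 ?(ltW a0) ?(ltW b0)//.
have := mulr_ge0 (sqrtr_ge0 (b - a)) (sqrtr_ge0 a); rewrite mulr2n; lra.
Qed.

Let sqrtXV_increment m q q' : 0 < q -> q / 4 <= q' ->
  `|Num.sqrt q' ^- m - Num.sqrt q ^- m| <=
  m%:R * 2 ^+ m.+1 * Num.sqrt q ^- m.+2 * `|q' - q|.
Proof.
move=> q0 qq'; have q'0 : 0 < q' by lra.
have [c [c1 c2 ->]] := between_mean_value (fun x => @is_derive_sqrtXV m x) q0 q'0.
have qc : q / 4 <= c by apply: le_trans c1; rewrite le_min qq' andbT; lra.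
have c0 : 0 < c by lra.
rewrite normrM ler_wpM2r// mulNr normrN ger0_norm; last first.
  by rewrite mulr_ge0 ?divr_ge0// invr_ge0 exprn_ge0// sqrtr_ge0.
have sq : 0 < Num.sqrt q by rewrite sqrtr_gt0.
have qc2 : Num.sqrt q / 2 <= Num.sqrt c.
  rewrite -ler_sqr ?nnegrE ?sqrtr_ge0 ?divr_ge0 ?sqrtr_ge0//.
  by rewrite expr_div_n !sqr_sqrtr ?(ltW q0) ?(ltW c0)//; lra.
have H : Num.sqrt c ^- m.+2 <= 2 ^+ m.+2 * Num.sqrt q ^- m.+2.
  have -> : 2 ^+ m.+2 * Num.sqrt q ^- m.+2 = (Num.sqrt q / 2) ^- m.+2.
    by rewrite exprMn exprVn [RHS]invfM invrK mulrC.
  by apply: ler_exprV => //; rewrite divr_gt0.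
apply: (@le_trans _ _ (m%:R / 2 * (2 ^+ m.+2 * Num.sqrt q ^- m.+2))).
  by rewrite ler_wpM2l// divr_ge0.
by rewrite [2 ^+ m.+2]exprS mulrA mulrA divfK.
Qed.

(** The expansion is made in the squared radius because the square of a Euclidean
    norm is a polynomial in the increment of the vector. *)
Lemma kernel_profile_taylor n a b : (1 <= n)%N -> 0 < a -> a / 2 <= b ->
  `|phi n b - phi n a - 2^-1 * a ^- n.+1 * (b ^+ 2 - a ^+ 2)| <=
  n.+1%:R * 2 ^+ n.+1 * a ^- n.+3 * (b ^+ 2 - a ^+ 2) ^+ 2.
Proof.
move=> n1 a0 ab; have b0 : 0 < b by lra.
have G x : 0 < x -> phi n x = profile2 n (x ^+ 2).
  by move=> x0; rewrite /profile2 sqrtr_sqr gtr0_norm.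
have sa : Num.sqrt (a ^+ 2) = a by rewrite sqrtr_sqr gtr0_norm.
have ab2 : a ^+ 2 / 4 <= b ^+ 2.
  have -> : a ^+ 2 / 4 = (a / 2) ^+ 2 by field.
  by rewrite ler_sqr ?nnegrE//; lra.
have a20 := exprn_gt0 2 a0; have b20 := exprn_gt0 2 b0.
rewrite !G//.
have [c [c1 c2 ->]] :=
  between_mean_value (fun x => @is_derive_profile2 n x n1) a20 b20.
rewrite -mulrBl -mulrBr.
rewrite !normrM -[X in _ <= _ * X]real_normK ?num_real//.
have qc : a ^+ 2 / 4 <= c by apply: le_trans c1; rewrite le_min ab2 andbT; lra.
have := sqrtXV_increment n.+1 a20 qc; rewrite sa => H.
have ca : `|c - a ^+ 2| <= `|b ^+ 2 - a ^+ 2|.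
  move: c1 c2; case/orP: (le_total (a ^+ 2) (b ^+ 2)) => h.
    rewrite min_l// max_r// => h1 h2.
    by rewrite !ger0_norm ?subr_ge0// lerB.
  rewrite min_r// max_l// => h1 h2.
  by rewrite !ler0_norm ?subr_le0// lerN2 lerB.
rewrite ger0_norm// expr2 mulrA ler_wpM2r//.
apply: (@le_trans _ _ (2^-1 * (n.+1%:R * 2 ^+ n.+2 * a ^- n.+3 * `|b ^+ 2 - a ^+ 2|))).
  rewrite ler_wpM2l//; apply: le_trans H _; rewrite ler_wpM2l//.
  by rewrite mulr_ge0 ?invr_ge0 ?(exprn_ge0 _ (ltW a0))// mulr_ge0.
by rewrite [2 ^+ n.+2]exprS -!mulrA [n.+1%:R * (2 * _)]mulrCA mulKf.
Qed.

Let is_derive_addl (f : R -> R) q b d :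
  is_derive (q + b) 1 f d -> is_derive b 1 (fun b => f (q + b)) d.
Proof.
move=> D; have -> : (fun b => f (q + b)) = f \o shift q.
  by apply/funext => x /=; rewrite addrC.
rewrite -[d]mulr1; apply: is_derive1_comp; rewrite /= 1?addrC//.
exact: is_derive_shift.
Qed.

Let is_derive_subl (f : R -> R) q b d :
  is_derive (q - b) 1 f d -> is_derive b 1 (fun b => f (q - b)) (- d).
Proof.
move=> D; have -> : (fun b => f (q - b)) = (f \o shift q) \o (-%R).
  by apply/funext => x /=; rewrite addrC.
rewrite -[- d]mulrN1; apply: is_derive1_comp.
rewrite -[d]mulr1; apply: is_derive1_comp; rewrite /= 1?addrC//.
exact: is_derive_shift.
Qed.

Let sqrtXV_second_difference m q y : 0 < q -> 0 <= y -> y <= q / 2 ->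
  Num.sqrt (q + y) ^- m + Num.sqrt (q - y) ^- m - 2 * Num.sqrt q ^- m <=
  m%:R * m.+2%:R * 2 ^+ m.+3 * Num.sqrt q ^- m.+4 * y ^+ 2.
Proof.
move=> q0 y0 yq.
have D (x : R) : 0 < x -> is_derive x 1 (fun q => Num.sqrt q ^- m)
   (- (m%:R / 2) * Num.sqrt x ^- m.+2) := fun x0 => is_derive_sqrtXV m x0.
have [|c1 [c1a c1b e1]] := @mean_value_segment _ _ q (q + y) _
   (fun x qx _ => D x (lt_le_trans q0 qx)); first by rewrite lerDl.
have qy0 : 0 < q - y by lra.
have [|c2 [c2a c2b e2]] := @mean_value_segment _ _ (q - y) q _
   (fun x qx _ => D x (lt_le_trans qy0 qx)); first by rewrite gerBl.
have -> : Num.sqrt (q + y) ^- m + Num.sqrt (q - y) ^- m - 2 * Num.sqrt q ^- m =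
    m%:R / 2 * y * (Num.sqrt c2 ^- m.+2 - Num.sqrt c1 ^- m.+2).
  transitivity ((Num.sqrt (q + y) ^- m - Num.sqrt q ^- m) -
    (Num.sqrt q ^- m - Num.sqrt (q - y) ^- m)); first by ring.
  by rewrite e1 e2; ring.
have c1q : q / 4 <= c1 by lra.
have c2q : q / 4 <= c2 by lra.
have := sqrtXV_increment m.+2 q0 c1q; have := sqrtXV_increment m.+2 q0 c2q.
have K0 : 0 <= m.+2%:R * 2 ^+ m.+3 * Num.sqrt q ^- m.+4.
  by rewrite mulr_ge0 ?invr_ge0 ?exprn_ge0 ?sqrtr_ge0// mulr_ge0.
have c1y : `|c1 - q| <= y by rewrite ger0_norm; lra.
have c2y : `|c2 - q| <= y by rewrite ler0_norm; lra.
set K := m.+2%:R * _ * _ in K0 * => h2 h1.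
have {}h1 := le_trans h1 (ler_wpM2l K0 c1y).
have {}h2 := le_trans h2 (ler_wpM2l K0 c2y).
have h : Num.sqrt c2 ^- m.+2 - Num.sqrt c1 ^- m.+2 <= 2 * (K * y).
  move: h1 h2; rewrite !ler_norml => /andP[h1 _] /andP[_ h2]; lra.
have my0 : 0 <= m%:R / 2 * y by rewrite mulr_ge0// divr_ge0.
apply: le_trans (ler_wpM2l my0 h) _.
rewrite le_eqVlt; apply/orP; left; apply/eqP.
by rewrite /K; move: (Num.sqrt q ^- m.+4) (2 ^+ m.+3) => P T; field.
Qed.

(** Only a lower bound is needed for subharmonicity.  The odd Taylor terms cancel in
    the symmetric difference, which leaves the negative second derivative in the
    squared radius and an error of fourth order. *)
Lemma kernel_profile_second_difference n q b : (1 <= n)%N -> 0 < q -> 0 <= b ->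
  b <= q / 2 ->
  - (n.+1%:R / 4) * (Num.sqrt q ^- n.+3 * b ^+ 2 +
    n.+3%:R * n.+4.+1%:R * 2 ^+ n.+4.+2 * Num.sqrt q ^- n.+4.+3 * b ^+ 4) <=
  phi n (Num.sqrt (q + b)) + phi n (Num.sqrt (q - b)) - 2 * phi n (Num.sqrt q).
Proof.
move=> n1 q0 b0 bq; pose P m x : R := Num.sqrt x ^- m; pose g2 := - (n.+1%:R / 4) * P n.+3 q.
pose r b := profile2 n (q + b) + profile2 n (q - b) - 2 * profile2 n q - g2 * b ^+ 2.
pose r1 b := 2^-1 * P n.+1 (q + b) - 2^-1 * P n.+1 (q - b) - 2 * g2 * b.
pose r2 b := - (n.+1%:R / 4) * (P n.+3 (q + b) + P n.+3 (q - b) - 2 * P n.+3 q).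
have Dr x : 0 <= x -> x <= b -> is_derive x 1 r (r1 x).
  move=> x0 xb.
  have q1 : 0 < q + x by lra.
  have q2 : 0 < q - x by lra.
  have D1 := is_derive_addl (is_derive_profile2 n1 q1).
  have D2 := is_derive_subl (is_derive_profile2 n1 q2).
  have D3 := is_deriveX 2 (@is_derive_id _ _ x 1).
  have D4 := is_deriveB (is_deriveB (is_deriveD D1 D2)
    (is_derive_cst (2 * profile2 n q) x 1)) (is_deriveZ g2 D3).
  have -> : r = (fun b => profile2 n (q + b)) + (fun b => profile2 n (q - b))
      - cst (2 * profile2 n q) - g2 \*: (@id R ^+ 2).
    by apply/funext => z; rewrite !fctE.
  apply: (is_derive_eq D4).
  by rewrite /r1 /P /GRing.scale/= expr1; ring.
have Dr1 x : 0 <= x -> x <= b -> is_derive x 1 r1 (r2 x).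
  move=> x0 xb.
  have q1 : 0 < q + x by lra.
  have q2 : 0 < q - x by lra.
  have D1 := is_deriveZ 2^-1 (is_derive_addl (is_derive_sqrtXV n.+1 q1)).
  have D2 := is_deriveZ 2^-1 (is_derive_subl (is_derive_sqrtXV n.+1 q2)).
  have D4 := is_deriveB (is_deriveB D1 D2) (is_deriveZ (2 * g2) (@is_derive_id _ _ x 1)).
  have -> : r1 = 2^-1 \*: (fun b => P n.+1 (q + b)) - 2^-1 \*: (fun b => P n.+1 (q - b))
      - (2 * g2) \*: (@id R).
    by apply/funext => z; rewrite !fctE.
  apply: (is_derive_eq D4).
  rewrite /r2 /g2 /P /GRing.scale/=; field.
  by rewrite !expf_neq0// gt_eqF// sqrtr_gt0.
have [x [x0 xb e]] := mean_value_segment b0 Dr.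
have [|y [y0 yx e1]] := @mean_value_segment r1 r2 0 x x0.
  by move=> z z0 zx; apply: Dr1 => //; exact: le_trans xb.
have r0 : r 0 = 0 by rewrite /r subr0 addr0; ring.
have r10 : r1 0 = 0 by rewrite /r1 subr0 addr0; ring.
move: e e1; rewrite r0 r10 !subr0 => e e1.
have yb := le_trans yx xb.
have h := sqrtXV_second_difference n.+3 q0 y0 (le_trans yb bq).
set K := n.+3%:R * _ * _ * _ in h *.
have K0 : 0 <= K.
  by rewrite mulr_ge0 ?invr_ge0 ?exprn_ge0 ?sqrtr_ge0// mulr_ge0 ?exprn_ge0// mulr_ge0.
have n0 : 0 <= n.+1%:R / 4 :> R by rewrite divr_ge0.
have yb2 : y ^+ 2 <= b ^+ 2 by rewrite ler_sqr ?nnegrE.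
have h2 : - (n.+1%:R / 4) * (K * b ^+ 2) <= r2 y.
  rewrite /r2 !mulNr lerN2 ler_wpM2l//; apply: le_trans h _.
  by rewrite ler_wpM2l.
have xb0 : 0 <= x * b by rewrite mulr_ge0.
have xb2 : x * b <= b ^+ 2 by rewrite expr2 ler_wpM2r.
have h3 : - (n.+1%:R / 4) * (K * b ^+ 4) <= r b.
  rewrite e e1 -[leRHS]mulrA; apply: le_trans (ler_wpM2r xb0 h2).
  rewrite !mulNr lerN2 -[leLHS]mulrA; apply: ler_wpM2l => //.
  rewrite -mulrA; apply: ler_wpM2l => //.
  by rewrite (exprD b 2 2) ler_wpM2l// exprn_ge0.
by move: h3; rewrite /r /g2 /P /profile2; lra.
Qed.

End radial_kernel.

(** * Euclidean norm and inner product *)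

Section euclidean_norm.
Context {R : realType} {d : nat}.
Implicit Types x y z : 'rV[R]_d.

Definition dotv x y : R := \sum_(i < d) x 0 i * y 0 i.

Lemma enorm_ge0 x : 0 <= enorm x.
Proof. exact: sqrtr_ge0. Qed.

Lemma sqr_enorm x : enorm x ^+ 2 = \sum_(i < d) x 0 i ^+ 2.
Proof. by rewrite sqr_sqrtr// sumr_ge0// => i _; rewrite sqr_ge0. Qed.

Lemma enorm_coord x i : `|x 0 i| <= enorm x.
Proof.
rewrite -ler_sqr ?nnegrE ?enorm_ge0// sqr_enorm real_normK ?num_real//.
by rewrite (bigD1 i)//= lerDl sumr_ge0// => j _; rewrite sqr_ge0.
Qed.

Lemma enorm_eq0 x : enorm x = 0 -> x = 0.
Proof.
move=> x0; apply/matrixP => i j; rewrite ord1 mxE; apply/eqP.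
by rewrite -normr_le0 -x0 enorm_coord.
Qed.

Lemma enorm0 : enorm (0 : 'rV[R]_d) = 0.
Proof. by rewrite /enorm big1 ?sqrtr0// => i _; rewrite mxE expr0n. Qed.

Lemma enormN x : enorm (- x) = enorm x.
Proof. by congr Num.sqrt; apply: eq_bigr => i _; rewrite mxE sqrrN. Qed.

Lemma enorm_distC x y : enorm (x - y) = enorm (y - x).
Proof. by rewrite -enormN opprB. Qed.

Lemma enormZ a x : enorm (a *: x) = `|a| * enorm x.
Proof.
rewrite /enorm (eq_bigr (fun i => a ^+ 2 * x 0 i ^+ 2)); last first.
  by move=> i _; rewrite mxE exprMn.
by rewrite -mulr_sumr sqrtrM ?sqr_ge0// sqrtr_sqr.
Qed.

Lemma sqr_enormD x y : enorm (x + y) ^+ 2 = enorm x ^+ 2 + 2 * dotv x y + enorm y ^+ 2.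
Proof.
rewrite !sqr_enorm /dotv mulr_sumr -!big_split/=; apply: eq_bigr => i _.
by rewrite mxE; ring.
Qed.

Lemma dotvZr a x y : dotv x (a *: y) = a * dotv x y.
Proof. by rewrite /dotv mulr_sumr; apply: eq_bigr => i _; rewrite mxE; ring. Qed.

Lemma dotvNr x y : dotv x (- y) = - dotv x y.
Proof. by rewrite -scaleN1r dotvZr mulN1r. Qed.

Lemma dotv_le x y : `|dotv x y| <= enorm x * enorm y.
Proof.
have h (a b : R) z1 z2 : enorm z1 = a -> enorm z2 = b -> a * b * dotv z1 z2 <= (a * b) * (a * b).
  move=> z1a z2b; have : 0 <= enorm (b *: z1 + - a *: z2) ^+ 2 by exact: sqr_ge0.
  rewrite sqr_enormD !enormZ z1a z2b normrN !exprMn !real_normK ?num_real//.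
  rewrite (_ : dotv _ _ = - (a * b * dotv z1 z2)); first by rewrite !expr2; lra.
  rewrite /dotv mulr_sumr -sumrN; apply: eq_bigr => i _; rewrite !mxE; ring.
have [x0|xn0] := eqVneq (enorm x) 0.
  by rewrite (enorm_eq0 x0) enorm0 mul0r /dotv big1 ?normr0// => i _; rewrite mxE mul0r.
have [y0|yn0] := eqVneq (enorm y) 0.
  by rewrite (enorm_eq0 y0) enorm0 mulr0 /dotv big1 ?normr0// => i _; rewrite mxE mulr0.
have xy0 : 0 < enorm x * enorm y by rewrite mulr_gt0 ?lt0r ?enorm_ge0 ?xn0 ?yn0.
have h1 := h _ _ x y erefl erefl.
have h2 := h _ _ x (- y) erefl erefl.
rewrite enormN dotvNr in h2.
rewrite ler_norml; apply/andP; split; rewrite -(ler_pM2l xy0);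
  by move: h1 h2; set p := enorm x * enorm y => h1 h2; lra.
Qed.

Lemma ler_enormD x y : enorm (x + y) <= enorm x + enorm y.
Proof.
rewrite -ler_sqr ?nnegrE ?enorm_ge0 ?addr_ge0 ?enorm_ge0// sqr_enormD.
by have := dotv_le x y; rewrite ler_norml sqrrD mulr2n => /andP[_ h]; lra.
Qed.

Lemma ler_enorm_dist x y z : enorm (x - z) <= enorm (x - y) + enorm (y - z).
Proof. by rewrite (_ : x - z = (x - y) + (y - z)) ?ler_enormD// addrA subrK. Qed.

Lemma ler_enorm_sum (I : finType) (F : I -> 'rV[R]_d) :
  enorm (\sum_i F i) <= \sum_i enorm (F i).
Proof.
elim/big_ind2 : _ => //; first by rewrite enorm0.
by move=> x a y b xa yb; apply: le_trans (ler_enormD _ _) _; rewrite lerD.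
Qed.

Lemma enorm_delta (i : 'I_d) : enorm (delta_mx 0 i : 'rV[R]_d) = 1.
Proof.
rewrite /enorm (bigD1 i)//= big1 ?addr0; last first.
  by move=> j ji; rewrite mxE eqxx/= (negbTE ji) expr0n.
by rewrite mxE !eqxx expr1n sqrtr1.
Qed.

Lemma dotv_delta x i : dotv x (delta_mx 0 i) = x 0 i.
Proof.
rewrite /dotv (bigD1 i)//= big1 ?addr0; first by rewrite mxE !eqxx mulr1.
by move=> j ji; rewrite mxE eqxx/= (negbTE ji) mulr0.
Qed.

Lemma enorm_le_coord x (a : R) : 0 <= a -> (forall i, `|x 0 i| <= a) ->
  enorm x <= d%:R * a.
Proof.
move=> a0 xa; have -> : x = \sum_i x 0 i *: delta_mx 0 i.
  by rewrite {1}[x]row_sum_delta.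
apply: le_trans (ler_enorm_sum _) _.
apply: (@le_trans _ _ (\sum_(i < d) a)).
  by apply: ler_sum => i _; rewrite enormZ enorm_delta mulr1.
by rewrite sumr_const card_ord mulr_natl.
Qed.

End euclidean_norm.

(** * Expansions of the kernel, its gradient and its Hessian *)

Section vector_kernel.
Context {R : realType} {d : nat}.
Local Notation V := 'rV[R]_d.
Local Notation phi := (@kernel_profile R).
Implicit Types (X Y D : V) (n m : nat).

(** Gradient and Hessian of [X |-> kernel_profile n (enorm X)]. *)
Definition kernel_grad n X : V := enorm X ^- n.+1 *: X.

Definition kernel_hess n X i j : R :=
  (i == j)%:R * enorm X ^- n.+1 - n.+1%:R * X 0 i * X 0 j * enorm X ^- n.+3.

(** Lifting the point by [h] in an extra dimension removes the singularity. *)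
Definition lifted_norm h X : R := Num.sqrt (enorm X ^+ 2 + h ^+ 2).

Lemma sqr_lifted_norm h X : lifted_norm h X ^+ 2 = enorm X ^+ 2 + h ^+ 2.
Proof. by rewrite sqr_sqrtr// addr_ge0 ?sqr_ge0. Qed.

Lemma lifted_norm_ge h X : enorm X <= lifted_norm h X.
Proof.
rewrite -ler_sqr ?nnegrE ?enorm_ge0 ?sqrtr_ge0// sqr_lifted_norm.
by rewrite lerDl sqr_ge0.
Qed.

Lemma lifted_norm_ge_height h X : h <= lifted_norm h X.
Proof.
have [h0|h0] := leP 0 h; last by rewrite (le_trans (ltW h0))// sqrtr_ge0.
rewrite -ler_sqr ?nnegrE ?sqrtr_ge0// sqr_lifted_norm.
by rewrite lerDr sqr_ge0.
Qed.

Lemma lifted_norm_le h X : 0 <= h -> lifted_norm h X <= enorm X + h.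
Proof.
move=> h0; have x0 := enorm_ge0 X.
rewrite -ler_sqr ?nnegrE ?addr_ge0 ?sqrtr_ge0// sqr_lifted_norm sqrrD mulr2n.
have := mulr_ge0 x0 h0; lra.
Qed.

Lemma lifted_norm0 X : lifted_norm 0 X = enorm X.
Proof.
by rewrite /lifted_norm expr0n addr0 sqrtr_sqr ger0_norm// enorm_ge0.
Qed.

Lemma kernel_grad_le n X i : `|kernel_grad n X 0 i| <= enorm X ^- n.
Proof.
rewrite mxE normrM ger0_norm ?invr_ge0 ?exprn_ge0 ?enorm_ge0//.
have [x0|xn0] := eqVneq (enorm X) 0.
  by rewrite {1}x0 expr0n invr0 mul0r invr_ge0 exprn_ge0 ?enorm_ge0.
have x0 : 0 < enorm X by rewrite lt0r xn0 enorm_ge0.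
rewrite exprSr invfM -mulrA ler_piMr ?invr_ge0 ?exprn_ge0 ?enorm_ge0//.
by rewrite ler_pdivrMl// mulr1 enorm_coord.
Qed.

Let sq_increment X D h : 0 <= h -> enorm D + h <= enorm X / 2 ->
  let e := enorm D + h in
  `|lifted_norm h (X + D) ^+ 2 - enorm X ^+ 2| <= 3 * enorm X * e /\
  `|lifted_norm h (X + D) ^+ 2 - enorm X ^+ 2 - 2 * dotv X D| <= e ^+ 2.
Proof.
move=> h0 /= Xe; have D0 := enorm_ge0 D; have X0 := enorm_ge0 X.
rewrite sqr_lifted_norm sqr_enormD.
have := dotv_le X D; rewrite !ler_norml => /andP[l1 l2].
have DD := mulr_ge0 D0 h0; have hh := mulr_ge0 h0 h0; have D2 := mulr_ge0 D0 D0.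
have XD := mulr_ge0 X0 D0; have Xh := mulr_ge0 X0 h0.
have eX : (enorm D + h) * (enorm D + h) <= enorm X / 2 * (enorm D + h).
  by rewrite ler_wpM2r// addr_ge0.
by rewrite !expr2 in eX *; split; apply/andP; split; lra.
Qed.

Let lifted_norm_half X D h : 0 <= h -> enorm D + h <= enorm X / 2 ->
  enorm X / 2 <= lifted_norm h (X + D).
Proof.
move=> h0 Xe; apply: le_trans (lifted_norm_ge h _).
have := ler_enormD (X + D) (- D); rewrite addrK enormN; lra.
Qed.

(** The lift counts as an increment of length [h]: it changes the squared norm by
    [h ^+ 2], an error of second order. *)
Lemma kernel_profile_expansion n : (1 <= n)%N -> exists2 C : R, 0 <= C &
  forall X D h, 0 < enorm X -> 0 <= h -> enorm D + h <= enorm X / 2 ->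
  `|phi n (lifted_norm h (X + D)) - phi n (enorm X) - dotv (kernel_grad n X) D|
    <= C * (enorm D + h) ^+ 2 * enorm X ^- n.+1.
Proof.
move=> n1; pose C0 : R := n.+1%:R * 2 ^+ n.+1.
have C00 : 0 <= C0 by rewrite mulr_ge0// exprn_ge0.
exists (9 * C0 + 1); first by lra.
move=> X D h X0 h0 Xe; set e := enorm D + h.
have [s1 s2] := sq_increment h0 Xe; rewrite -/e in s1 s2.
have t := kernel_profile_taylor n1 X0 (lifted_norm_half h0 Xe).
set T := lifted_norm h (X + D) in s1 s2 t *.
set P := enorm X ^- n.+1 in t *.
have P0 : 0 <= P by rewrite invr_ge0 exprn_ge0 ?enorm_ge0.
have -> : dotv (kernel_grad n X) D = P * dotv X D.
  by rewrite /dotv mulr_sumr; apply: eq_bigr => i _; rewrite mxE mulrA.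
have t1 : C0 * enorm X ^- n.+3 * (T ^+ 2 - enorm X ^+ 2) ^+ 2 <= 9 * C0 * e ^+ 2 * P.
  have : (T ^+ 2 - enorm X ^+ 2) ^+ 2 <= (3 * enorm X * e) ^+ 2.
    by rewrite -[leLHS]real_normK ?num_real// ler_sqr ?nnegrE// (le_trans _ s1).
  have Q0 : 0 <= C0 * enorm X ^- n.+3.
    by rewrite mulr_ge0// invr_ge0 exprn_ge0// enorm_ge0.
  move=> /(ler_wpM2l Q0) H; apply: le_trans H _.
  have -> : C0 * enorm X ^- n.+3 * (3 * enorm X * e) ^+ 2 =
      9 * C0 * e ^+ 2 * (enorm X ^+ 2 * enorm X ^- (2 + n.+1)) by ring.
  by rewrite exprVD_cancel.
have t2 : `|2^-1 * P * (T ^+ 2 - enorm X ^+ 2) - P * dotv X D| <= e ^+ 2 * P.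
  rewrite (_ : _ - _ = 2^-1 * P * (T ^+ 2 - enorm X ^+ 2 - 2 * dotv X D)); last by field.
  have hP : 0 <= 2^-1 * P by rewrite mulr_ge0.
  rewrite normrM (ger0_norm hP).
  apply: le_trans (ler_wpM2l hP s2) _.
  have : 0 <= P * e ^+ 2 by rewrite mulr_ge0 ?sqr_ge0.
  lra.
have -> : (9 * C0 + 1) * e ^+ 2 * P = 9 * C0 * e ^+ 2 * P + e ^+ 2 * P by ring.
have -> : phi n T - phi n (enorm X) - P * dotv X D =
    (phi n T - phi n (enorm X) - 2^-1 * P * (T ^+ 2 - enorm X ^+ 2)) +
    (2^-1 * P * (T ^+ 2 - enorm X ^+ 2) - P * dotv X D) by ring.
exact: le_trans (ler_normD _ _) (lerD (le_trans t t1) t2).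
Qed.

(** Up to the factor [- m], the power [s ^- m] is [kernel_profile m.+1 s], so that
    nothing new has to be differentiated. *)
Lemma enormXV_expansion m : (1 <= m)%N -> exists2 C : R, 0 <= C &
  forall X D, 0 < enorm X -> enorm D <= enorm X / 2 ->
  `|enorm (X + D) ^- m - enorm X ^- m + m%:R * enorm X ^- m.+2 * dotv X D|
    <= C * enorm D ^+ 2 * enorm X ^- m.+2.
Proof.
case: m => // m _; have [C C0 H] := @kernel_profile_expansion m.+2 isT.
exists (m.+1%:R * C) => [|X D X0 DX]; first by rewrite mulr_ge0.
have := H X D 0 X0 (lexx _); rewrite addr0 => /(_ DX).
rewrite lifted_norm0 /kernel_profile/=.
have -> : dotv (kernel_grad m.+2 X) D = enorm X ^- m.+3 * dotv X D.
  by rewrite /dotv mulr_sumr; apply: eq_bigr => i _; rewrite mxE mulrA.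
have m0 : 0 <= m.+1%:R :> R by [].
set E := (X in `|X|) => h.
have -> : enorm (X + D) ^- m.+1 - enorm X ^- m.+1 +
    m.+1%:R * enorm X ^- m.+3 * dotv X D = - (m.+1%:R * E).
  rewrite /E !invfM; have m1 : m.+1%:R != 0 :> R by rewrite pnatr_eq0.
  move: (enorm (X + D) ^- m.+1) (enorm X ^- m.+1) (enorm X ^- m.+3) (dotv X D).
  by move=> p q r t; field; rewrite nat1r gt_eqF.
have -> : m.+1%:R * C * enorm D ^+ 2 * enorm X ^- m.+3 =
    m.+1%:R * (C * enorm D ^+ 2 * enorm X ^- m.+3) by rewrite !mulrA.
by rewrite normrN normrM normr_nat ler_wpM2l.
Qed.

Lemma enormXV_increment m : (1 <= m)%N -> exists2 C : R, 0 <= C &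
  forall X D, 0 < enorm X -> enorm D <= enorm X / 2 ->
  `|enorm (X + D) ^- m - enorm X ^- m| <= C * enorm D * enorm X ^- m.+1.
Proof.
move=> m1; have [C C0 H] := enormXV_expansion m1.
exists (m%:R + C) => [|X D X0 DX]; first by rewrite addr_ge0.
have := H X D X0 DX; set P := enorm X ^- m.+2 => h.
have P0 : 0 <= P by rewrite invr_ge0 exprn_ge0 ?enorm_ge0.
have -> : enorm X ^- m.+1 = enorm X * P.
  by rewrite -[X in X * _]expr1 exprVD_cancel.
have D0 := enorm_ge0 D.
have mP : 0 <= m%:R * P by rewrite mulr_ge0.
have h2 : `|m%:R * P * dotv X D| <= m%:R * P * (enorm X * enorm D).
  by rewrite normrM (ger0_norm mP) ler_wpM2l// dotv_le.
have CPD : 0 <= C * P * enorm D by rewrite !mulr_ge0.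
have h3 := ler_wpM2l CPD DX.
have h4 : 0 <= C * P * enorm D * enorm X by rewrite mulr_ge0// ltW.
rewrite -[X in `|X|](addrK (m%:R * P * dotv X D)).
apply: le_trans (ler_normB _ _) _; apply: le_trans (lerD h h2) _.
rewrite expr2; lra.
Qed.

Lemma kernel_grad_expansion n : exists2 C : R, 0 <= C &
  forall X D i, 0 < enorm X -> enorm D <= enorm X / 2 ->
  `|kernel_grad n (X + D) 0 i - kernel_grad n X 0 i -
      \sum_j kernel_hess n X i j * D 0 j|
    <= C * enorm D ^+ 2 * enorm X ^- n.+2.
Proof.
have [C C0 H] := @enormXV_expansion n.+1 isT.
exists (2 * C + n.+1%:R) => [|X D i X0 DX]; first by rewrite addr_ge0 ?mulr_ge0.
have := H X D X0 DX; set P := enorm X ^- n.+3 => h.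
have P0 : 0 <= P by rewrite invr_ge0 exprn_ge0 ?enorm_ge0.
have -> : enorm X ^- n.+2 = enorm X * P.
  by rewrite -[X in X * _]expr1 exprVD_cancel.
have -> : \sum_j kernel_hess n X i j * D 0 j =
    enorm X ^- n.+1 * D 0 i - n.+1%:R * P * X 0 i * dotv X D.
  rewrite /dotv mulr_sumr [in LHS](eq_bigr (fun j => (i == j)%:R * (enorm X ^- n.+1 * D 0 j) -
      n.+1%:R * P * X 0 i * (X 0 j * D 0 j))); last first.
    by move=> j _; rewrite /kernel_hess -/P; ring.
  rewrite sumrB; congr (_ - _); rewrite (bigD1 i)//= eqxx mul1r big1 ?addr0// => j ji.
  by rewrite eq_sym (negbTE ji) mul0r.
rewrite !mxE.
set E := _ + n.+1%:R * P * dotv X D in h.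
have D0 := enorm_ge0 D.
rewrite (_ : _ - _ = (X 0 i + D 0 i) * E - n.+1%:R * P * dotv X D * D 0 i); last first.
  by rewrite /E; ring.
apply: le_trans (ler_normB _ _) _; rewrite !normrM.
have h1 : `|X 0 i + D 0 i| <= 2 * enorm X.
  apply: le_trans (ler_normD _ _) _.
  by have := enorm_coord X i; have := enorm_coord D i; lra.
have h2 : `|X 0 i + D 0 i| * `|E| <= 2 * enorm X * (C * enorm D ^+ 2 * P).
  by apply: ler_pM.
have h3 : `|dotv X D| * `|D 0 i| <= enorm X * enorm D * enorm D.
  by apply: ler_pM => //; [exact: dotv_le|exact: enorm_coord].
have nP0 : 0 <= n.+1%:R * P by rewrite mulr_ge0.
have := ler_wpM2l nP0 h3; rewrite (ger0_norm P0) normr_nat => h4.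
rewrite -!mulrA in h4 *; move: h2; rewrite expr2 => h2.
rewrite -!mulrA in h2; apply: le_trans (lerD h2 h4) _.
by rewrite le_eqVlt; apply/orP; left; apply/eqP; ring.
Qed.

Lemma kernel_hess_le n X i j : `|kernel_hess n X i j| <= n.+2%:R * enorm X ^- n.+1.
Proof.
have P0 m : 0 <= enorm X ^- m by rewrite invr_ge0 exprn_ge0 ?enorm_ge0.
apply: le_trans (ler_normB _ _) _.
rewrite (_ : n.+2%:R = 1 + n.+1%:R :> R) ?nat1r// mulrDl; apply: lerD.
  rewrite normrM [X in _ * X]ger0_norm// ler_wpM2r//.
  by case: (i == j); rewrite ?normr1 ?normr0.
rewrite -!mulrA normrM normr_nat ler_wpM2l//.
have [X0|X0] := eqVneq X 0; first by rewrite X0 mxE mul0r normr0 invr_ge0 exprn_ge0 ?enorm_ge0.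
have {}X0 : 0 < enorm X.
  by rewrite lt0r enorm_ge0 andbT; apply: contraNN X0 => /eqP/enorm_eq0/eqP.
rewrite mulrA normrM [X in _ * X]ger0_norm//.
rewrite -(@exprVD_cancel _ 2 n.+1 _ X0) ler_wpM2r// normrM expr2.
by apply: ler_pM => //; exact: enorm_coord.
Qed.

Lemma kernel_grad_increment n : exists2 C : R, 0 <= C &
  forall X D i, 0 < enorm X -> enorm D <= enorm X / 2 ->
  `|kernel_grad n (X + D) 0 i - kernel_grad n X 0 i| <= C * enorm D * enorm X ^- n.+1.
Proof.
have [C C0 H] := @kernel_grad_expansion n.
exists (C + d%:R * n.+2%:R) => [|X D i X0 DX]; first by rewrite addr_ge0 ?mulr_ge0.
have := H X D i X0 DX; set S := \sum_j _ => h.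
set P := enorm X ^- n.+1; have P0 : 0 <= P by rewrite invr_ge0 exprn_ge0 ?enorm_ge0.
have D0 := enorm_ge0 D.
have hS : `|S| <= d%:R * (n.+2%:R * P * enorm D).
  apply: le_trans (ler_norm_sum _ _ _) _.
  apply: (@le_trans _ _ (\sum_(j < d) n.+2%:R * P * enorm D)); last first.
    by rewrite sumr_const card_ord [leRHS]mulr_natl.
  by apply: ler_sum => j _; rewrite normrM ler_pM ?kernel_hess_le ?enorm_coord.
have hD : C * enorm D ^+ 2 * enorm X ^- n.+2 <= C * enorm D * P.
  rewrite /P -(@exprVD_cancel _ 1 n.+1 _ X0) expr1 expr2 !mulrA ler_wpM2r//.
    by rewrite invr_ge0 exprn_ge0 ?enorm_ge0.
  by rewrite ler_wpM2l ?mulr_ge0//; lra.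
rewrite -[X in `|X|](subrK S); apply: le_trans (ler_normD _ _) _.
apply: le_trans (lerD h hS) _; apply: le_trans (lerD hD (lexx _)) _.
by rewrite le_eqVlt; apply/orP; left; apply/eqP; ring.
Qed.

Lemma kernel_hess_increment n : exists2 C : R, 0 <= C &
  forall X D i j, 0 < enorm X -> enorm D <= enorm X / 2 ->
  `|kernel_hess n (X + D) i j - kernel_hess n X i j| <= C * enorm D * enorm X ^- n.+2.
Proof.
have [C1 C10 H1] := @enormXV_increment n.+1 isT.
have [C3 C30 H3] := @enormXV_increment n.+3 isT.
exists (C1 + n.+1%:R * (4 * C3 + 3)) => [|X D i j X0 DX].
  by rewrite addr_ge0// mulr_ge0// addr_ge0// mulr_ge0.
have h1 := H1 X D X0 DX; have h3 := H3 X D X0 DX.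
set P := enorm X ^- n.+4 in h3.
have P0 : 0 <= P by rewrite invr_ge0 exprn_ge0 ?enorm_ge0.
have D0 := enorm_ge0 D.
have P2 : enorm X ^- n.+2 = enorm X ^+ 2 * P by rewrite (@exprVD_cancel _ 2 n.+2).
have P3 : enorm X ^- n.+3 = enorm X * P.
  by rewrite -[X in X * P]expr1 (@exprVD_cancel _ 1 n.+3).
rewrite P2 in h1 *.
pose A := (X + D) 0 i * (X + D) 0 j; pose B := X 0 i * X 0 j.
have Xi := enorm_coord X i; have Xj := enorm_coord X j.
have Di := enorm_coord D i; have Dj := enorm_coord D j.
have XDi k : `|(X + D) 0 k| <= 2 * enorm X.
  by rewrite mxE (le_trans (ler_normD _ _))//; have := enorm_coord X k;
    have := enorm_coord D k; lra.
have hA : `|A| <= 4 * enorm X ^+ 2.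
  rewrite normrM (_ : 4 * _ = (2 * enorm X) * (2 * enorm X)); last by ring.
  by apply: ler_pM.
have hAB : `|A - B| <= 3 * enorm X * enorm D.
  rewrite (_ : A - B = (X + D) 0 i * D 0 j + D 0 i * X 0 j); last first.
    by rewrite /A /B !mxE; ring.
  apply: le_trans (ler_normD _ _) _; rewrite !normrM.
  have l1 : `|(X + D) 0 i| * `|D 0 j| <= 2 * enorm X * enorm D by apply: ler_pM.
  have l2 : `|D 0 i| * `|X 0 j| <= enorm D * enorm X by apply: ler_pM.
  by apply: le_trans (lerD l1 l2) _; rewrite [enorm D * _]mulrC; lra.
rewrite /kernel_hess (_ : _ - _ = (i == j)%:R * (enorm (X + D) ^- n.+1 - enorm X ^- n.+1)
  - n.+1%:R * (A * (enorm (X + D) ^- n.+3 - enorm X ^- n.+3) + (A - B) * enorm X ^- n.+3));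
  last by rewrite /A /B; ring.
apply: le_trans (ler_normB _ _) _.
have -> : (C1 + n.+1%:R * (4 * C3 + 3)) * enorm D * (enorm X ^+ 2 * P) =
  C1 * enorm D * (enorm X ^+ 2 * P) +
  n.+1%:R * (4 * enorm X ^+ 2 * (C3 * enorm D * P) +
    3 * enorm X * enorm D * (enorm X * P)) by rewrite expr2; ring.
apply: lerD.
  rewrite normrM; apply: le_trans h1; rewrite ler_piMl//.
  by case: (i == j); rewrite ?normr1 ?normr0.
rewrite normrM normr_nat ler_wpM2l//.
apply: le_trans (ler_normD _ _) _; apply: lerD; rewrite normrM.
  by apply: ler_pM.
rewrite P3 [`|_ * P|]ger0_norm ?mulr_ge0 ?enorm_ge0//.
by rewrite ler_wpM2r// mulr_ge0// enorm_ge0.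
Qed.

End vector_kernel.

(** * The regularized kernel *)

Section regularized_kernel.
Context {R : realType} {d : nat}.
Local Notation V := 'rV[R]_d.
Local Notation phi := (@kernel_profile R).
Implicit Types (X Y : V) (n : nat).

Lemma kernel_profile_half_power n (a b : R) : (1 <= n)%N -> 0 < a -> 0 < b ->
  `|phi n a - phi n b| <= 2 * Num.sqrt `|a - b| *
    (Num.sqrt a * a ^- n + Num.sqrt b * b ^- n).
Proof.
move=> n1; wlog ab : a b / a <= b.
  move=> H a0 b0; case/orP: (le_total a b) => ab; first exact: H.
  by rewrite distrC [`|a - b|]distrC [X in _ * X]addrC H.
move=> a0 b0; rewrite distrC [`|a - b|]distrC !ger0_norm ?subr_ge0//; last first.
  have := kernel_profile_increase_ge n1 a0 ab; rewrite -subr_ge0; apply: le_trans.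
  by rewrite mulr_ge0 ?subr_ge0// invr_ge0 exprn_ge0 ?ltW.
apply: le_trans (kernel_profile_increase_le n1 a0 ab) _.
rewrite ler_wpM2l ?mulr_ge0 ?sqrtr_ge0// lerDl mulr_ge0 ?sqrtr_ge0//.
by rewrite invr_ge0 exprn_ge0 ?ltW.
Qed.

(** The Laplacian of the regularized kernel is positive, of the order of [h ^+ 2]
    times a power of the lifted norm; for [s <= c * h] it absorbs the fourth-order
    error of the second differences, of the order of [s ^+ 2] times the same
    power. *)
Lemma regularized_kernel_second_difference n : n.+1 = d -> (1 <= n)%N ->
  exists2 c : R, 0 < c & forall X h s, 0 < h -> 0 < s -> s <= c * h ->
  0 <= \sum_(i < d)
    (phi n (lifted_norm h (X + s *: delta_mx 0 i)) +
     phi n (lifted_norm h (X - s *: delta_mx 0 i)) -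
     2 * phi n (lifted_norm h X)).
Proof.
move=> nd n1; pose C : R := n.+3%:R * n.+4.+1%:R * 2 ^+ n.+4.+2.
have C1 : 1 <= C.
  apply: mulr_ege1; last by apply: exprn_ege1; rewrite ler1n.
  by apply: mulr_ege1; rewrite ler1n.
have C0 : 0 < C by lra.
exists (4 * C)^-1 => [|X h s h0 s0 sh]; first by rewrite invr_gt0 mulr_gt0.
have sCh : 4 * C * s <= h by rewrite -ler_pdivlMl// mulr_gt0.
have sh4 : 4 * s <= h.
  by apply: le_trans sCh; rewrite ler_wpM2r ?(ltW s0)// ler_peMr.
(* The squared lifted norms of the two neighbours in a coordinate direction are
   symmetric about [Q], not about [q]; the passage from [q] to [Q] yields the positive
   term that dominates. *)
pose q := enorm X ^+ 2 + h ^+ 2; pose Q := q + s ^+ 2.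
have X20 : 0 <= enorm X ^+ 2 by rewrite sqr_ge0.
have h20 : 0 < h ^+ 2 by rewrite exprn_gt0.
have s20 : 0 < s ^+ 2 by rewrite exprn_gt0.
have q0 : 0 < q by rewrite /q; lra.
have Q0 : 0 < Q by rewrite /Q; lra.
pose S := Num.sqrt Q; have S0 : 0 < S by rewrite sqrtr_gt0.
have SE : S ^+ 2 = Q by rewrite sqr_sqrtr ?(ltW Q0).
pose P := S ^- n.+4.+3.
have P0 : 0 < P by rewrite invr_gt0 exprn_gt0.
have P3 : S ^- n.+3 = Q ^+ 2 * P.
  by rewrite -SE -exprM (@exprVD_cancel _ 4 n.+3).
have P1 : S ^- n.+1 = Q * (Q ^+ 2 * P).
  by rewrite -P3 -SE (@exprVD_cancel _ 2 n.+1).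
have hS : 4 * s <= S.
  apply: le_trans sh4 _; rewrite -ler_sqr ?nnegrE ?(ltW S0) ?(ltW h0)// SE /Q /q; lra.
have XS i : `|X 0 i| <= S.
  apply: le_trans (enorm_coord X i) _.
  by rewrite -ler_sqr ?nnegrE ?enorm_ge0 ?(ltW S0)// SE /Q /q; lra.
have lower : s ^+ 2 * (Q * (Q ^+ 2 * P)) <= 2 * (phi n S - phi n (Num.sqrt q)).
  have sq0 : 0 < Num.sqrt q by rewrite sqrtr_gt0.
  have sqS : Num.sqrt q <= S by rewrite ler_sqrt ?(ltW Q0)// /Q; lra.
  have := kernel_profile_increase_ge n1 sq0 sqS.
  have -> : S ^- n = S * S ^- n.+1.
    by rewrite -[X in X * _]expr1 (@exprVD_cancel _ 1 n).
  rewrite P1 => H; have : 0 <= 2 :> R by []; move=> /ler_wpM2l/(_ _ _ H).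
  apply: le_trans.
  have : s ^+ 2 <= 2 * S * (S - Num.sqrt q).
    have : s ^+ 2 = (S - Num.sqrt q) * (S + Num.sqrt q).
      by rewrite -subr_sqr SE sqr_sqrtr ?(ltW q0)// /Q; ring.
    move=> ->; rewrite mulrC ler_wpM2r ?subr_ge0//; lra.
  have T0 : 0 <= Q * (Q ^+ 2 * P) by rewrite !mulr_ge0 ?(ltW Q0) ?(ltW P0).
  by move=> /(ler_wpM2r T0) /le_trans; apply; rewrite le_eqVlt; apply/orP; left;
    apply/eqP; ring.
pose c4 : R := n.+1%:R / 4.
pose T i : R := - c4 * (Q ^+ 2 * P * (4 * s ^+ 2 * X 0 i ^+ 2) +
   C * P * (16 * s ^+ 4 * X 0 i ^+ 4)) + s ^+ 2 * (Q * (Q ^+ 2 * P)).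
have term i : T i <= phi n (lifted_norm h (X + s *: delta_mx 0 i)) +
     phi n (lifted_norm h (X - s *: delta_mx 0 i)) -
     2 * phi n (lifted_norm h X).
  pose b := 2 * s * `|X 0 i|.
  have b0 : 0 <= b by rewrite !mulr_ge0// ltW.
  have bQ : b <= Q / 2.
    have : b <= 2 * s * S by rewrite ler_wpM2l ?XS// mulr_ge0// (ltW s0).
    have := ler_wpM2r (ltW S0) hS; rewrite -expr2 SE; lra.
  have := kernel_profile_second_difference n1 Q0 b0 bQ.
  rewrite -/S -/P -/C P3.
  have -> : b ^+ 2 = 4 * s ^+ 2 * X 0 i ^+ 2.
    by rewrite /b !exprMn real_normK ?num_real//; ring.
  have -> : b ^+ 4 = 16 * s ^+ 4 * X 0 i ^+ 4.
    rewrite /b !exprMn (_ : `|X 0 i| ^+ 4 = X 0 i ^+ 4); first by ring.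
    by rewrite -normrX ger0_norm// (exprM _ 2 2) sqr_ge0.
  have -> : phi n (Num.sqrt (Q + b)) + phi n (Num.sqrt (Q - b)) =
    phi n (lifted_norm h (X + s *: delta_mx 0 i)) +
    phi n (lifted_norm h (X - s *: delta_mx 0 i)).
    have eP : lifted_norm h (X + s *: delta_mx 0 i) = Num.sqrt (Q + 2 * s * X 0 i).
      rewrite /lifted_norm sqr_enormD enormZ enorm_delta mulr1 real_normK ?num_real//.
      rewrite dotvZr dotv_delta.
      by congr Num.sqrt; rewrite /Q /q; ring.
    have eM : lifted_norm h (X - s *: delta_mx 0 i) = Num.sqrt (Q - 2 * s * X 0 i).
      rewrite /lifted_norm sqr_enormD enormN enormZ enorm_delta mulr1 real_normK ?num_real//.
      rewrite dotvNr dotvZr dotv_delta.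
      by congr Num.sqrt; rewrite /Q /q; ring.
    rewrite eP eM /b; case: (ger0P (X 0 i)) => _ //.
    by rewrite mulrN opprK addrC.
  move=> H; have := lerD H lower; rewrite -/q /T /c4.
  have -> : lifted_norm h X = Num.sqrt q by [].
  by move: (phi n S) (Q ^+ 2 * P) => pS QP; lra.
clearbody C; apply: le_trans (ler_sum _ (fun i _ => term i)).
have sum2 : \sum_(i < d) X 0 i ^+ 2 = enorm X ^+ 2 by rewrite sqr_enorm.
have sum4 : \sum_(i < d) X 0 i ^+ 4 <= Q * enorm X ^+ 2.
  rewrite -sum2 mulr_sumr; apply: ler_sum => i _.
  rewrite (exprD _ 2 2) ler_wpM2r ?sqr_ge0// -SE -[leLHS]real_normK ?num_real//.
  by rewrite ler_sqr ?nnegrE ?normr_ge0 ?(ltW S0).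
have -> : \sum_(i < d) T i = n.+1%:R * s ^+ 2 * P *
   (Q ^+ 3 - Q ^+ 2 * enorm X ^+ 2 - 4 * C * s ^+ 2 * \sum_(i < d) X 0 i ^+ 4).
  rewrite /T big_split/= sumr_const card_ord -mulr_sumr big_split/= -!mulr_sumr sum2.
  have dE : d%:R = n.+1%:R :> R by rewrite nd.
  rewrite -[_ *+ d]mulr_natl dE /c4.
  move: (\sum_(i < d) X 0 i ^+ 4) (enorm X ^+ 2) => t u.
  by field.
apply: mulr_ge0; first by rewrite !mulr_ge0 ?(ltW P0) ?(ltW s0).
have h1 : 4 * C * s ^+ 2 <= h ^+ 2.
  have : 4 * C * s * s <= h * h.
    have a1 : 0 <= 4 * C * s by rewrite !mulr_ge0 ?(ltW s0) ?(ltW C0).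
    by apply: (ler_pM a1 (ltW s0) sCh); lra.
  by rewrite !expr2; lra.
have h2 : 4 * C * s ^+ 2 * \sum_(i < d) X 0 i ^+ 4 <= h ^+ 2 * (Q * enorm X ^+ 2).
  apply: ler_pM => //; first by rewrite !mulr_ge0 ?(ltW s0) ?(ltW C0).
  by apply: sumr_ge0 => i _; rewrite (exprM _ 2 2) sqr_ge0.
have h3 : enorm X ^+ 2 * Q <= Q * Q by rewrite ler_wpM2r ?(ltW Q0)// /Q /q; lra.
have h4 := ler_wpM2l (ltW h20) h3.
have h5 : 0 <= s ^+ 2 * Q ^+ 2 by rewrite !mulr_ge0 ?(ltW s0) ?(ltW Q0).
have -> : Q ^+ 3 = (enorm X ^+ 2 + h ^+ 2 + s ^+ 2) * Q ^+ 2 by rewrite /Q /q; ring.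
rewrite expr2 in h5 *; lra.
Qed.

End regularized_kernel.

(** * Derivatives of the fundamental solution *)

Section fundamental_solution_hessian.
Context {R : realType}.
Local Notation phi := (@kernel_profile R).

Lemma derive_quadratic_error d (f : 'rV[R]_d -> R) (X v : 'rV[R]_d) (l C e : R) :
  0 < e ->
  (forall s, `|s| < e -> `|f (X + s *: v) - f X - s * l| <= C * s ^+ 2) ->
  'D_v f X = l.
Proof.
move=> e0 H; apply/cvg_lim => //; apply/cvgrPdist_le => eps eps0.
have C1 : 0 < `|C| + 1 by rewrite ltr_wpDl.
near=> h.
have h0 : h != 0 by near: h; exact: nbhs_dnbhs_neq.
have he : `|h| < e.
  by near: h; apply: dnbhs0_lt.
have hC : `|h| < eps / (`|C| + 1).
  by near: h; apply: dnbhs0_lt; rewrite divr_gt0.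
rewrite /= [h *: v + X]addrC.
have -> : l - h^-1 *: (f (X + h *: v) - f X) = - (h^-1 * (f (X + h *: v) - f X - h * l)).
  by rewrite /GRing.scale/=; field.
rewrite normrN normrM normfV ler_pdivrMl ?normr_gt0//.
apply: le_trans (H _ he) _; rewrite -[h ^+ 2]real_normK ?num_real// expr2 mulrCA.
rewrite ler_wpM2l//.
apply: (@le_trans _ _ ((`|C| + 1) * `|h|)).
  by rewrite ler_wpM2r// (le_trans (ler_norm _))// lerDl.
by rewrite mulrC -ler_pdivlMr// ltW.
Unshelve. all: by end_near.
Qed.

Lemma ball_volume_gt0 k : 0 < ball_volume R k.
Proof.
suff : 0 < ball_volume R k /\ 0 < ball_volume R k.+1 by case.
elim: k => [|k [IH1 IH2]]; first by split => /=.
split => //.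
by rewrite [ball_volume _ _]/= mulr_gt0// divr_gt0// mulr_gt0// pi_gt0.
Qed.

Definition fundamental_constant n : R :=
  if n == 1%N then (2 * pi)^-1 else (n.+1%:R * ball_volume R n.+1)^-1.

Lemma fundamental_constant_gt0 n : 0 < fundamental_constant n.
Proof.
rewrite /fundamental_constant; case: ifP => _; rewrite invr_gt0 mulr_gt0 ?pi_gt0//.
exact: ball_volume_gt0.
Qed.

Lemma fundamental_solutionE n (X : 'rV[R]_n.+1) :
  fundamental_solution X = fundamental_constant n * phi n (enorm X).
Proof.
rewrite /fundamental_solution /fundamental_constant /phi; case: ifP => _.
  by rewrite mulrC.
rewrite mulNr mulrN -!invfM; congr (- _^-1).
by move: (ball_volume R n.+1) (enorm X ^+ n.-1) => A B; ring.
Qed.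

Let enormD_gt0 d (X v : 'rV[R]_d) : 0 < enorm X -> enorm v = 1 ->
  forall s, `|s| < enorm X / 2 -> enorm (s *: v) <= enorm X / 2 /\
    0 < enorm (X + s *: v).
Proof.
move=> X0 v1 s sX; have vs : enorm (s *: v) = `|s| by rewrite enormZ v1 mulr1.
split; first by rewrite vs ltW.
have := ler_enormD (X + s *: v) (- (s *: v)); rewrite addrK enormN vs; lra.
Qed.

Lemma derive_fundamental_solution n (X : 'rV[R]_n.+1) j : (1 <= n)%N ->
  0 < enorm X ->
  'D_(delta_mx 0 j) (@fundamental_solution R n) X =
    fundamental_constant n * kernel_grad n X 0 j.
Proof.
move=> n1 X0; have [C C0 H] := @kernel_profile_expansion R n.+1 n n1.
have eX0 : 0 < enorm X / 2 by rewrite divr_gt0.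
have c0 := fundamental_constant_gt0 n.
apply: (@derive_quadratic_error _ _ _ _ _
  (fundamental_constant n * (C * enorm X ^- n.+1)) _ eX0) => s sX.
have [sX2 _] := enormD_gt0 X0 (enorm_delta j) sX.
have := H X (s *: delta_mx 0 j) 0 X0 (lexx _); rewrite addr0 lifted_norm0 => /(_ sX2).
rewrite enormZ enorm_delta mulr1 real_normK ?num_real//.
rewrite dotvZr dotv_delta.
move=> h; rewrite !fundamental_solutionE.
rewrite (_ : _ - _ = fundamental_constant n *
  (phi n (enorm (X + s *: delta_mx 0 j)) - phi n (enorm X) - s * kernel_grad n X 0 j));
  last by ring.
rewrite normrM (ger0_norm (ltW c0)) -mulrA ler_wpM2l ?(ltW c0)//.
by rewrite mulrAC.
Qed.

Lemma hessian_fundamental_solution n (X : 'rV[R]_n.+1) i j : (1 <= n)%N ->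
  0 < enorm X ->
  hessian (@fundamental_solution R n) X i j =
    fundamental_constant n * kernel_hess n X i j.
Proof.
move=> n1 X0; have [C C0 H] := @kernel_grad_expansion R n.+1 n.
have eX0 : 0 < enorm X / 2 by rewrite divr_gt0.
have c0 := fundamental_constant_gt0 n.
rewrite mxE; apply: (@derive_quadratic_error _ _ _ _ _
  (fundamental_constant n * (C * enorm X ^- n.+2)) _ eX0) => s sX.
have [sX2 sX3] := enormD_gt0 X0 (enorm_delta i) sX.
rewrite !derive_fundamental_solution//.
have := H X (s *: delta_mx 0 i) j X0 sX2.
rewrite enormZ enorm_delta mulr1 real_normK ?num_real//.
have -> : \sum_k kernel_hess n X j k * (s *: delta_mx 0 i : 'rV[R]_n.+1) 0 k =
    s * kernel_hess n X i j.
  rewrite (bigD1 i)//= big1 ?addr0; last first.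
    by move=> k ki; rewrite !mxE eqxx/= (negbTE ki) !mulr0.
  rewrite !mxE !eqxx mulr1 mulrC; congr (_ * _).
  by rewrite /kernel_hess eq_sym; ring.
move=> h.
rewrite (_ : _ - _ = fundamental_constant n *
  (kernel_grad n (X + s *: delta_mx 0 i) 0 j - kernel_grad n X 0 j - s * kernel_hess n X i j));
  last by ring.
rewrite normrM (ger0_norm (ltW c0)) -mulrA ler_wpM2l ?(ltW c0)//.
by rewrite mulrAC.
Qed.

End fundamental_solution_hessian.

(** * Euclidean balls and the measurability of closed sets *)

Section euclidean_topology.
Context {R : realType} {d : nat}.
Local Notation V := 'rV[R]_d.
Implicit Types (x y : V) (A B U : set V).

Lemma nbhs_eball x U : nbhs x U <-> exists2 e : R, 0 < e & eball x e `<=` U.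
Proof.
split=> [/nbhs_ballP[e /= e0 eU]|[e e0 eU]].
  exists e => // y xy; apply: eU; split => // i j; rewrite ord1.
  have := enorm_coord (x - y) j; rewrite /ball/= !mxE => /le_lt_trans; apply.
  by rewrite enorm_distC.
apply/nbhs_ballP; exists (e / (d%:R + 1)) => /=; first by rewrite divr_gt0// ltr_wpDl.
move=> y [_ xy]; apply: eU; rewrite /eball/=.
have e1 : 0 <= e / (d%:R + 1) by rewrite divr_ge0 ?ltW// ltr_wpDl.
apply: (@le_lt_trans _ _ (d%:R * (e / (d%:R + 1)))).
  apply: enorm_le_coord => // i; rewrite !mxE distrC.
  by have := xy 0 i; rewrite /ball/= => /ltW.
by rewrite mulrA ltr_pdivrMr ?ltr_wpDl// mulrC ltr_pM2l// ltrDl.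
Qed.

Lemma eball_center x (r : R) : 0 < r -> eball x r x.
Proof. by rewrite /eball/= subrr enorm0. Qed.

Lemma eball_sub x y (r s : R) : enorm (x - y) + r <= s -> eball x r `<=` eball y s.
Proof.
move=> h z; rewrite /eball/= => zx; apply: le_lt_trans (ler_enorm_dist z x y) _.
by apply: lt_le_trans h; rewrite addrC ltrD2l.
Qed.

Lemma open_eball x (r : R) : open (eball x r).
Proof.
rewrite openE => y xy; apply/nbhs_eball; exists (r - enorm (y - x)).
  by rewrite subr_gt0.
by apply: eball_sub; rewrite addrC subrK.
Qed.

Lemma closed_eball_disjoint A x : closed A -> ~ A x ->
  exists2 e : R, 0 < e & forall y, A y -> e <= enorm (x - y).
Proof.
move=> cA Ax; have : nbhs x (~` A) by apply: open_nbhs_nbhs; split=> //; exact: closed_openC.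
move=> /nbhs_eball[e e0 eA]; exists e => // y Ay.
rewrite leNgt; apply/negP => xy; apply: (eA y) => //.
by rewrite /eball/= enorm_distC.
Qed.

End euclidean_topology.

Section metric_outer_measure.
Context {R : realType} {d : nat}.
Local Notation V := 'rV[R]_d.
Implicit Types (A B C X : set V).
Local Open Scope ereal_scope.

Definition separated_sets A B := exists2 e : R, (0 < e)%R &
  forall x y, A x -> B y -> (e < enorm (x - y))%R.

(** Caratheodory's criterion.  The part of [X] off a closed set [C] is cut into
    shells accumulating at [C]; non-adjacent shells are separated, so their
    measures are summable, and the shells close to [C] carry little mass. *)
Lemma metric_outer_measure_closed (mu : {outer_measure set V -> \bar R}) C :
  (forall A B, separated_sets A B -> mu A + mu B <= mu (A `|` B)) ->
  closed C -> mu.-caratheodory C.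
Proof.
move=> sepU cC; apply: le_caratheodory_measurable => X.
have [->|Xoo] := eqVneq (mu X) +oo; first by rewrite leey.
have mu0 Y : 0 <= mu Y := outer_measure_ge0 mu Y.
have Xfin : mu X \is a fin_num.
  by rewrite ge0_fin_numE// lt_neqAle Xoo leey.
pose A k := X `&` [set x | forall c, C c -> (k.+1%:R^-1 < enorm (x - c))%R].
pose D k := A k.+1 `\` A k.
have AX k : A k `<=` X by move=> x [].
have muA k : mu (A k) <= mu X by apply: le_outer_measure.
have Amono i j : (i <= j)%N -> A i `<=` A j.
  move=> ij x [Xx Ax]; split => // c /Ax; apply: le_lt_trans.
  by rewrite lef_pV2 ?posrE// ler_nat.
have sepAC k : separated_sets (X `&` C) (A k).
  exists k.+1%:R^-1%R; first by rewrite invr_gt0.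
  by move=> x y [_ Cx] [_ /(_ _ Cx)]; rewrite enorm_distC.
have sepAD j : separated_sets (A j.+1) (D j.+2).
  exists (j.+2%:R^-1 - j.+3%:R^-1)%R.
    by rewrite subr_gt0 ltf_pV2 ?posrE// ltr_nat.
  move=> x y [_ Ax] [[Xy Ay'] /not_andP[//|/existsNP[c /not_implyP[Cc /negP]]]].
  rewrite -leNgt => yc.
  have := Ax _ Cc; have := ler_enorm_dist x y c.
  by move: yc (j.+2%:R^-1)%R; move: (j.+3%:R^-1)%R => p yc q; lra.
have sumD N : exists a b, [/\ \sum_(0 <= i < N.+2) mu (D i) = a + b,
    0 <= a, 0 <= b, a <= mu (A N.+1) & b <= mu (A N.+2)].
  elim: N => [|N [a [b [e a0 b0 ha hb]]]].
    exists (mu (D 0%N)), (mu (D 1%N)); split => //.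
    - by rewrite big_nat_recr//= big_nat1.
    - by apply: le_outer_measure => x [].
    - by apply: le_outer_measure => x [].
  exists b, (a + mu (D N.+2)); split => //.
  - by rewrite big_nat_recr//= e [a + b]addeC -addeA.
  - by rewrite adde_ge0.
  - apply: le_trans (leeD ha (lexx _)) _; apply: le_trans (sepU _ _ (sepAD N)) _.
    apply: le_outer_measure => x [/(Amono _ _ (leq_addl 2 N.+1))//|[]//].
have sumDoo : \sum_(0 <= i <oo) mu (D i) < +oo.
  apply: (@le_lt_trans _ _ (mu X + mu X)); last by rewrite lte_add_pinfty// ltey_eq Xfin.
  apply: lime_le; first by apply: is_cvg_nneseries.
  near=> N; have [a [b [e a0 b0 ha hb]]] := sumD N.
  apply: (@le_trans _ _ (\sum_(0 <= i < N.+2) mu (D i))).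
    by apply: lee_sum_nneg_natr => //; rewrite ltnW.
  rewrite e leeD//; [exact: le_trans ha _|exact: le_trans hb _].
have tail0 := nneseries_tail_cvg sumDoo (fun k _ => mu0 (D k)).
have XC k : X `&` ~` C `<=` A k `|` \bigcup_(i in ~` `I_k) D i.
  move=> x [Xx Cx]; have [e e0 he] := closed_eball_disjoint cC Cx.
  have [m me] : exists m, A m x.
    exists (Num.truncn e^-1); split => // c /he; apply: lt_le_trans.
    rewrite invf_plt ?posrE//; exact: truncnS_gt.
  pose P := fun m => `[<A m x>].
  have exP : exists m, P m by exists m; apply/asboolP.
  case: (ex_minnP exP) => i /asboolP Aix imin.
  have [ik|ki] := leqP i k; first by left; exact: Amono Aix.
  case: i => // i in Aix imin ki *; right; exists i; first by rewrite /= ltnNge -ltnS ki.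
  split => // Ai; have := imin i; rewrite /P; move/(_ (asboolT Ai)).
  by rewrite ltnn.
have bound k : mu (X `&` C) + mu (X `&` ~` C) <= mu X + \sum_(k <= i <oo) mu (D i).
  have h1 : mu (X `&` ~` C) <= mu (A k) + \sum_(k <= i <oo) mu (D i).
    apply: le_trans (le_outer_measure mu _ _ (XC k)) _.
    apply: le_trans (outer_measureU2 mu _ _) _.
    by rewrite leeD2l// outer_measure_sigma_subadditive_tail.
  apply: le_trans (leeD (lexx _) h1) _; rewrite addeA leeD2r//.
  apply: le_trans (sepU _ _ (sepAC k)) _.
  by apply: le_outer_measure => x [[]|[]].
have cv : (mu X + \sum_(k <= i <oo) mu (D i)) @[k --> \oo] --> mu X + 0.
  apply: cvgeD => //; first by rewrite fin_num_adde_defr.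
  exact: cvg_cst.
rewrite -[leRHS]adde0 -(cvg_lim _ cv)//; apply: lime_ge; first by apply/cvg_ex; exists (mu X + 0).
by near=> k; exact: bound.
Unshelve. all: by end_near. Qed.

(** A cover by sets of diameter smaller than the gap between [A] and [B] splits into
    a cover of [A] and a cover of [B]. *)
Lemma hausdorff_separated n A B : separated_sets A B ->
  @hausdorff R d n A + hausdorff n B <= hausdorff n (A `|` B).
Proof.
move=> [e e0 AB].
have [->|Hoo] := eqVneq (hausdorff n (A `|` B)) +oo; first by rewrite leey.
have H0 Y : 0 <= hausdorff n Y := outer_measure_ge0 (@hausdorff R d n) Y.
set H := hausdorff n (A `|` B) in Hoo *.
have Hfin : H \is a fin_num by rewrite ge0_fin_numE ?H0// lt_neqAle Hoo leey.
have gauge_sum (F : (set V)^nat) : 0 <= \sum_(k <oo) hausdorff_gauge n (F k).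
  by apply: nneseries_ge0 => k _ _; exact: hausdorff_gauge_ge0.
have content_ge0 delta Y : 0 <= @hausdorff_content R d n delta Y.
  by apply: le_ereal_inf_tmp => _ [F _ <-].
have content_mono d1 d2 Y : (d1 <= d2)%R ->
    @hausdorff_content R d n d2 Y <= hausdorff_content n d1 Y.
  move=> d12; apply: le_ereal_inf_tmp => _ [F [YF dF] <-].
  apply: ereal_inf_lbound; exists F => //; split => // k.
  by apply: le_trans (dF k) _; rewrite lee_fin.
have add delta : (0 < delta)%R -> (delta <= e)%R ->
    @hausdorff_content R d n delta A + hausdorff_content n delta B <= H.
  move=> delta0 de; apply: (@le_trans _ _ (hausdorff_content n delta (A `|` B))); last first.
    by apply: ereal_sup_ubound; exists delta.
  apply: le_ereal_inf_tmp => _ [F [YF dF] <-].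
  (* This is [F k] if [F k] meets [Y], and the empty set otherwise. *)
  pose meet (Y : set V) k := F k `&` [set _ | F k `&` Y !=set0].
  have meetE Y k : meet Y k = F k \/ meet Y k = set0.
    have [h|h] := pselect (F k `&` Y !=set0); [left|right]; apply/seteqP; split => //.
    - by move=> x [].
    - by move=> x [_] /h.
  have meet_cover Y : Y `<=` A `|` B -> hausdorff_cover delta Y (meet Y).
    move=> YAB; split => [x Yx|k].
      have [k _ Fkx] := YF _ (YAB _ Yx); exists k => //; split => //; by exists x.
    have [->|->] := meetE Y k; first exact: dF.
    by rewrite /ediam setX0 image_set0 ereal_sup0 leNye.
  have content_le Y : Y `<=` A `|` B ->
      hausdorff_content n delta Y <= \sum_(k <oo) hausdorff_gauge n (meet Y k).
    by move=> YAB; apply: ereal_inf_lbound; exists (meet Y) => //; exact: meet_cover.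
  apply: le_trans (leeD (content_le A _) (content_le B _)) _ => //.
  rewrite -nneseriesD; last 2 first.
  - by move=> k _ _; exact: hausdorff_gauge_ge0.
  - by move=> k _ _; exact: hausdorff_gauge_ge0.
  apply: lee_nneseries => [k _ _|k _].
    by rewrite adde_ge0// hausdorff_gauge_ge0.
  have g0 : @hausdorff_gauge R d n set0 = 0 by rewrite /hausdorff_gauge eqxx.
  have [h|h] := pselect (F k `&` A !=set0); last first.
    have -> : meet A k = set0 by apply/seteqP; split => // x [].
    rewrite g0 add0e; have [->//|->] := meetE B k.
    by rewrite g0 hausdorff_gauge_ge0.
  have -> : meet B k = set0.
    apply/seteqP; split => // x [_ [z [Fz Bz]]]; have [y [Fy Ay]] := h.
    have := AB _ _ Ay Bz; apply/negP; rewrite -leNgt (le_trans _ de)// -lee_fin.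
    by apply: le_trans (dF k); apply: ereal_sup_ubound; exists (y, z).
  rewrite g0 adde0; have [->//|->] := meetE A k.
  by rewrite g0 hausdorff_gauge_ge0.
have cfin delta Y : (0 < delta)%R -> Y `<=` A `|` B ->
    @hausdorff_content R d n delta Y \is a fin_num.
  move=> delta0 YAB; rewrite ge0_fin_numE//; apply: (@le_lt_trans _ _ H).
    apply: (@le_trans _ _ (hausdorff n Y)); last exact: (le_outer_measure (@hausdorff R d n)).
    by apply: ereal_sup_ubound; exists delta.
  by rewrite -ge0_fin_numE// H0.
have Afin : hausdorff n A \is a fin_num.
  rewrite ge0_fin_numE//; apply: (@le_lt_trans _ _ H).
    exact: (le_outer_measure (@hausdorff R d n)).
  by rewrite -ge0_fin_numE// H0.
rewrite -leeBrDl//; apply: ge_ereal_sup => _ [d2 /= d20 <-].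
have Bfin := cfin d2 B d20 (@subsetUr _ A B).
rewrite leeBrDl// -leeBrDr//; apply: ge_ereal_sup => _ [d1 /= d10 <-].
rewrite leeBrDr//.
pose m := Num.min (Num.min d1 d2) e.
have m0 : (0 < m)%R by rewrite /m !lt_min d10 d20.
have [m1 m2 me] : [/\ m <= d1, m <= d2 & m <= e]%R.
  by rewrite /m !ge_min !lexx !orbT.
apply: le_trans (add _ m0 me); apply: leeD; exact: content_mono.
Qed.

Lemma closed_caratheodory_hausdorff n C : closed C ->
  (@hausdorff_outer R d n).-caratheodory C.
Proof.
by apply: metric_outer_measure_closed => A B; exact: hausdorff_separated.
Qed.

End metric_outer_measure.

Section hausdorff_measurability.
Context {R : realType} {d : nat}.
Variable n : nat.
Local Notation V := 'rV[R]_d.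
Local Notation T := (caratheodory_type (@hausdorff_outer R d n)).
Local Notation phi := (@kernel_profile R).
Implicit Types (X : V).

Lemma closed_hausdorff_measurable (C : set V) : closed C -> measurable (C : set T).
Proof. exact: closed_caratheodory_hausdorff. Qed.

Lemma open_hausdorff_measurable (U : set V) : open U -> measurable (U : set T).
Proof.
move=> oU; rewrite -[U]setCK; apply: measurableC.
exact/closed_hausdorff_measurable/open_closedC.
Qed.

Lemma coord_hausdorff_measurable i :
  measurable_fun [set: T] (fun z : T => (z : V) 0 i).
Proof.
apply: (measurability _ (RGenOpens.measurableE R)) => _ [_ [a [b ->]] <-].
rewrite setTI; apply: open_hausdorff_measurable.
apply: (@open_comp _ _ (fun z : V => z 0 i) `]a, b[%classic); last exact: interval_open.
by move=> z _; exact: coord_continuous.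
Qed.

Lemma enorm_hausdorff_measurable X :
  measurable_fun [set: T] (fun z : T => enorm (X - (z : V))).
Proof.
rewrite (_ : (fun _ => _) = fun z : T =>
    (Num.sqrt (\sum_(i < d) (X 0 i - (z : V) 0 i) ^+ 2))); last first.
  apply/funext => z; congr Num.sqrt; apply: eq_bigr => i _.
  by rewrite !mxE.
apply: (measurableT_comp (continuous_measurable_fun (@sqrt_continuous R))).
apply: measurable_sum => i; apply: measurable_funX.
by apply: measurable_funB; [exact: measurable_cst|exact: coord_hausdorff_measurable].
Qed.

Lemma lifted_norm_hausdorff_measurable h X :
  measurable_fun [set: T] (fun z : T => lifted_norm h (X - (z : V))).
Proof.
apply: (measurableT_comp (continuous_measurable_fun (@sqrt_continuous R))).
apply: measurable_funD; last exact: measurable_cst.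
apply: measurable_funX.
exact: enorm_hausdorff_measurable.
Qed.

Lemma exprV_hausdorff_measurable (f : T -> R) m : (forall z, 0 <= f z) ->
  measurable_fun [set: T] f -> measurable_fun [set: T] (fun z => f z ^- m).
Proof.
move=> f0 mf; rewrite (_ : (fun _ => _) = fun z => (f z) `^ (- m%:R)); last first.
  by apply/funext => z; rewrite powR_invn.
exact: (measurableT_comp (measurable_powR _)).
Qed.

Lemma profile_hausdorff_measurable m (f : T -> R) : (forall z, 0 <= f z) ->
  measurable_fun [set: T] f -> measurable_fun [set: T] (fun z => phi m (f z)).
Proof.
move=> f0 mf; rewrite /kernel_profile; case: eqP => _.
  exact: (measurableT_comp (@measurable_ln R)).
rewrite (_ : (fun _ => _) = fun z => - (m.-1%:R^-1 * f z ^- m.-1)); last first.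
  by apply/funext => z; rewrite invfM.
apply: (measurableT_comp (@oppr_measurable R setT)).
apply: measurable_funM; first exact: measurable_cst.
exact: exprV_hausdorff_measurable.
Qed.

Lemma kernel_grad_hausdorff_measurable m X i :
  measurable_fun [set: T] (fun z : T => kernel_grad m (X - (z : V)) 0 i).
Proof.
rewrite (_ : (fun _ => _) = fun z : T =>
  enorm (X - (z : V)) ^- m.+1 * (X 0 i - (z : V) 0 i)); last first.
  by apply/funext => z; rewrite !mxE.
apply: measurable_funM.
  by apply: exprV_hausdorff_measurable => [z|]; [exact: enorm_ge0|exact: enorm_hausdorff_measurable].
by apply: measurable_funB; [exact: measurable_cst|exact: coord_hausdorff_measurable].
Qed.

Lemma kernel_hess_hausdorff_measurable m X i j :
  measurable_fun [set: T] (fun z : T => kernel_hess m (X - (z : V)) i j).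
Proof.
rewrite (_ : (fun _ => _) = fun z : T =>
  (i == j)%:R * enorm (X - (z : V)) ^- m.+1 -
  m.+1%:R * (X 0 i - (z : V) 0 i) * (X 0 j - (z : V) 0 j) * enorm (X - (z : V)) ^- m.+3);
  last by apply/funext => z; rewrite /kernel_hess !mxE.
have mP k : measurable_fun [set: T] (fun z : T => enorm (X - (z : V)) ^- k).
  by apply: exprV_hausdorff_measurable => [z|]; [exact: enorm_ge0|exact: enorm_hausdorff_measurable].
have mc k : measurable_fun [set: T] (fun z : T => X 0 k - (z : V) 0 k).
  by apply: measurable_funB; [exact: measurable_cst|exact: coord_hausdorff_measurable].
apply: measurable_funB; apply: measurable_funM; [exact: measurable_cst|exact: mP| |exact: mP].
apply: measurable_funM; [apply: measurable_funM; [exact: measurable_cst|]|]; exact: mc.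
Qed.

End hausdorff_measurability.

(** * Ahlfors regularity *)

Section ahlfors_regularity.
Context {R : realType} {d : nat}.
Local Notation V := 'rV[R]_d.
Implicit Types (x y X : V) (E : set V) (r : R).

Lemma ediam_ge E x y : E x -> E y -> ((enorm (x - y))%:E <= ediam E)%E.
Proof. by move=> Ex Ey; apply: ereal_sup_ubound; exists (x, y). Qed.

Lemma bounded_closed_finite_cover E (x0 : V) D r : closed E -> 0 < r ->
  (forall y, E y -> enorm (y - x0) <= D) ->
  exists2 s : seq V, (forall e, e \in s -> E e) &
    E `<=` \bigcup_(e in [set` s]) eball e r.
Proof.
move=> cE r0 bE.
have E_compact : compact E.
  apply: bounded_closed_compact => //.
  exists (D + enorm x0); split; first exact: num_real.
  move=> M DM y Ey; suff : mx_norm y <= M by [].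
  rewrite mx_normrE; apply/bigmax_leP; split => /=.
    by apply: le_trans (ltW DM); rewrite addr_ge0 ?enorm_ge0 ?(le_trans (enorm_ge0 _) (bE _ Ey)).
  move=> [i j] _ /=; rewrite ord1; apply: le_trans (enorm_coord y j) _.
  apply: le_trans (ltW DM); have := bE _ Ey; have := ler_enorm_dist y x0 0.
  by rewrite !subr0; lra.
move: E_compact; rewrite compact_cover => /(_ V E (fun e => eball e r)).
case=> [e _|y Ey|F FE EF]; first exact: open_eball.
  by exists y => //; exact: eball_center.
exists (finmap.enum_fset F) => [e eF|y /EF[e eF ye]]; first by have := FE e eF; rewrite inE.
by exists e.
Qed.

(** Upper regularity at every centre and every scale.  The constant may depend on
    [E]: when [E] is bounded, the scales beyond its diameter are controlled by a
    finite cover. *)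
Lemma ADR_upper n E : ADR n E -> (0 < ediam E)%E -> exists2 C : R, 0 < C &
  forall X r, 0 < r -> (hausdorff n (E `&` eball X r) <= (C * r ^+ n)%:E)%E.
Proof.
move=> [cE [C1 C10 adr]] dE.
have small X r : 0 < r -> ((2 * r)%:E < ediam E)%E ->
    (hausdorff n (E `&` eball X r) <= (C1 * 2 ^+ n * r ^+ n)%:E)%E.
  move=> r0 rE; have r20 : 0 < 2 * r by rewrite mulr_gt0.
  have [->|/set0P[e [Ee eX]]] := eqVneq (E `&` eball X r) set0.
    by rewrite (outer_measure0 (@hausdorff R d n)) lee_fin !mulr_ge0 ?exprn_ge0 ?ltW.
  have [_ h] := adr e (2 * r) Ee r20 rE.
  rewrite -mulrA -exprMn; apply: le_trans h.
  apply: (le_outer_measure (@hausdorff R d n)) => z [Ez zX]; split => //.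
  rewrite /eball/=; apply: le_lt_trans (ler_enorm_dist z X e) _.
  by move: eX zX; rewrite /eball/= [enorm (X - e)]enorm_distC; lra.
have [Doo|Dfin] := eqVneq (ediam E) +oo%E.
  exists (C1 * 2 ^+ n) => [|X r r0]; first by rewrite mulr_gt0 ?exprn_gt0.
  by apply: small => //; rewrite Doo ltry.
have {Dfin}[D DE] : exists D : R, ediam E = D%:E.
  by move: (ediam E) dE Dfin => [D _ _| |]//; exists D.
rewrite DE lte_fin in dE.
have D20 : 0 < D / 2 by rewrite divr_gt0.
have [E0|/set0P[x0 Ex0]] := eqVneq E set0.
  exists 1 => // X r r0; rewrite E0 set0I (outer_measure0 (@hausdorff R d n)).
  by rewrite lee_fin mul1r exprn_ge0 ?ltW.
have bE y : E y -> enorm (y - x0) <= D.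
  by move=> Ey; rewrite -lee_fin -DE; exact: ediam_ge.
have [s sE sC] := bounded_closed_finite_cover cE D20 bE.
pose M := \sum_(e <- s) C1 * (D / 2) ^+ n.
have M0 : 0 <= M.
  by apply: sumr_ge0 => e _; rewrite mulr_ge0 ?exprn_ge0 ?ltW.
have HE : (hausdorff n E <= M%:E)%E.
  rewrite /M -sumEFin.
  have {sC} : E `<=` \bigcup_(e in [set` s]) (E `&` eball e (D / 2)).
    by move=> z Ez; have [e es ze] := sC z Ez; exists e.
  move/(le_outer_measure (@hausdorff R d n)) => /le_trans; apply.
  elim: s sE {M M0} => [|e s IH] sE.
    rewrite big_nil (_ : \bigcup_(e in _) _ = set0) ?(outer_measure0 (@hausdorff R d n))//.
    by apply/seteqP; split => // z [].
  rewrite big_cons.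
  apply: (@le_trans _ _ (hausdorff n ((E `&` eball e (D / 2)) `|`
      \bigcup_(e in [set` s]) (E `&` eball e (D / 2))))).
    apply: (le_outer_measure (@hausdorff R d n)) => z [e' /=].
    by rewrite inE => /predU1P[->|e's] ze; [left|right; exists e'].
  apply: le_trans (outer_measureU2 (@hausdorff R d n) _ _) _.
  apply: leeD; last by apply: IH => e' e's; apply: sE; rewrite inE e's orbT.
  have [||//] := adr e (D / 2) _ D20 _; first by apply: sE; rewrite mem_head.
  by rewrite DE lte_fin; lra.
exists (C1 * 2 ^+ n + M * (2 / D) ^+ n) => [|X r r0].
  by rewrite ltr_pwDl ?mulr_gt0 ?exprn_gt0// mulr_ge0// exprn_ge0// divr_ge0// ltW.
have [rD|Dr] := ltP (2 * r) D.
  apply: le_trans (small X r r0 _) _; first by rewrite DE lte_fin.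
  rewrite lee_fin ler_wpM2r ?exprn_ge0 ?(ltW r0)// lerDl mulr_ge0// exprn_ge0//.
  by rewrite divr_ge0// ltW.
apply: (@le_trans _ _ (hausdorff n E)).
  by apply: (le_outer_measure (@hausdorff R d n)) => z [].
apply: le_trans HE _; rewrite lee_fin mulrDl ler_wpDl//.
  by rewrite !mulr_ge0 ?exprn_ge0 ?ltW.
rewrite -mulrA -exprMn ler_peMr// exprn_ege1// mulrAC ler_pdivlMr//; lra.
Qed.

End ahlfors_regularity.

(** * Bounds for integrals against an upper regular measure *)

Section absolute_integral.
Context {R : realType} {disp : measure_display} {T : measurableType disp}.
Context (mu : {measure set T -> \bar R}).
Implicit Types (D : set T) (f g : T -> R) (M : R).
Local Notation mfun f := (measurable_fun [set: T] f).

(** One predicate for integrability and for the bound of the integral. *)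
Definition abs_integral_le D f M : Prop :=
  (\int[mu]_(z in D) (`|f z|)%:E <= M%:E)%E.

Let mabs D f : measurable D -> mfun f ->
  measurable_fun D (fun z : T => (`|f z|)%:E).
Proof.
move=> mD mf; apply: measurable_funTS; apply/measurable_EFinP.
exact: (measurableT_comp (@normr_measurable R setT)).
Qed.

Lemma abs_integral_le_mono D f g M : measurable D -> mfun f -> mfun g ->
  (forall z, D z -> `|f z| <= `|g z|) -> abs_integral_le D g M ->
  abs_integral_le D f M.
Proof.
move=> mD mf mg fg; rewrite /abs_integral_le; apply: le_trans.
apply: ge0_le_integral.
- exact: mD.
- by move=> z _; rewrite lee_fin.
- exact: mabs.
- exact: mabs.
- by move=> z Dz; rewrite lee_fin; exact: fg.
Qed.

Lemma abs_integral_leZ D f M k : measurable D -> mfun f ->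
  abs_integral_le D f M -> abs_integral_le D (fun z => k * f z) (`|k| * M).
Proof.
move=> mD mf h; rewrite /abs_integral_le.
under eq_integral do rewrite normrM EFinM.
rewrite ge0_integralZl//; last exact: mabs.
by rewrite EFinM; apply: lee_wpmul2l.
Qed.

Lemma abs_integral_leD D f g M N : measurable D -> mfun f -> mfun g ->
  abs_integral_le D f M -> abs_integral_le D g N ->
  abs_integral_le D (fun z => f z + g z) (M + N).
Proof.
move=> mD mf mg hf hg; rewrite /abs_integral_le EFinD.
apply: le_trans (leeD hf hg); rewrite -ge0_integralD//; last 2 first.
- exact: mabs.
- exact: mabs.
apply: ge0_le_integral => //.
- by apply: mabs => //; exact: measurable_funD.
- by apply: emeasurable_funD; exact: mabs.
- by move=> z _; rewrite -EFinD lee_fin ler_normD.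
Qed.

Lemma abs_integral_leU D1 D2 f M N : measurable D1 ->
  measurable D2 -> mfun f ->
  abs_integral_le D1 f M -> abs_integral_le D2 f N ->
  abs_integral_le (D1 `|` D2) f (M + N).
Proof.
move=> m1 m2 mf h1 h2; rewrite /abs_integral_le EFinD.
have -> : D1 `|` D2 = D1 `|` (D2 `\` D1) by rewrite setUDr setDv setD0.
have m21 : measurable (D2 `\` D1) by exact: measurableD.
rewrite ge0_integral_setU//; last 2 first.
- by apply: mabs => //; exact: measurableU.
- by apply/disj_setPS => z [Dz [_]].
apply: leeD => //; apply: le_trans h2; apply: ge0_subset_integral => //.
exact: mabs.
Qed.

Lemma abs_integral_le_integrable D f M : measurable D -> mfun f ->
  abs_integral_le D f M -> mu.-integrable D (EFin \o f).
Proof.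
move=> mD mf h; apply/integrableP; split.
  by apply: measurable_funTS; exact/measurable_EFinP.
by apply: le_lt_trans h _; rewrite ltry.
Qed.

Lemma abs_integral_le_norm D f M : measurable D -> mfun f ->
  abs_integral_le D f M -> `|\int[mu]_(z in D) f z| <= M.
Proof.
move=> mD mf h; have fi := abs_integral_le_integrable mD mf h.
apply: le_trans (le_normr_Rintegral mD fi) _.
rewrite -lee_fin; apply: le_trans h; rewrite /Rintegral fineK//.
have [_ fo] := integrableP _ _ _ fi.
by rewrite ge0_fin_numE// integral_ge0.
Qed.

(** Layer-cake bound: the mass [m k] of each [B k] is paid once, at the level
    [c k]. *)
Lemma abs_integral_le_layers D f (B : nat -> set T) (c m : nat -> R) M :
  measurable D -> mfun f -> (forall k, measurable (B k)) ->
  (forall k, 0 <= c k) -> 0 <= M ->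
  (forall k, (mu (D `&` B k) <= (m k)%:E)%E) ->
  (forall k, c k * m k <= M / 2 ^+ k) ->
  (forall z, D z -> exists k, `|f z| <= c k /\ B k z) ->
  abs_integral_le D f (2 * M).
Proof.
move=> mD mf mB c0 M0 Bm cM fc; rewrite /abs_integral_le.
pose h k (z : T) : \bar R := (c k * \1_(B k) z)%:E.
have h0 k z : (0 <= h k z)%E by rewrite lee_fin mulr_ge0.
have mh k : measurable_fun D (h k).
  apply: measurable_funTS; apply/measurable_EFinP.
  by apply: measurable_funM; [exact: measurable_cst|exact: measurable_indic].
apply: (@le_trans _ _ (\int[mu]_(z in D) (\sum_(k <oo) h k z))%E).
  apply: ge0_le_integral => //; first exact: mabs.
    by apply: ge0_emeasurable_sum.
  move=> z Dz; have [k [fk zk]] := fc z Dz.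
  apply: (@le_trans _ _ (h k z)).
    by rewrite lee_fin indicE mem_set ?mulr1.
  apply: le_trans (nneseries_lim_ge k.+1 _) => //.
  rewrite big_mkord (bigD1 (Ordinal (ltnSn k)))//= leeDl//.
  by apply: sume_ge0 => i _.
rewrite integral_nneseries//.
have term k : (\int[mu]_(z in D) h k z <= (M / 2 ^+ k)%:E)%E.
  have -> : (\int[mu]_(z in D) h k z = (c k)%:E * mu (D `&` B k))%E.
    rewrite /h; under eq_integral do rewrite EFinM.
    rewrite ge0_integralZl//; last 2 first.
    - by apply: measurable_funTS; apply/measurable_EFinP; exact: measurable_indic.
    - by rewrite lee_fin.
    by rewrite integral_indic// setIC.
  apply: (@le_trans _ _ ((c k)%:E * (m k)%:E)%E); last by rewrite -EFinM lee_fin.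
  by apply: lee_wpmul2l; rewrite ?lee_fin.
apply: (@le_trans _ _ (\sum_(k <oo) (M / 2 ^+ k)%:E)%E).
  by apply: lee_nneseries => [k _ _|k _]; [apply: integral_ge0 => z _|exact: term].
rewrite le_eqVlt; apply/orP; left; apply/eqP.
apply/cvg_lim => //.
have := @cvg_geometric_series R M (2^-1) _.
have h2 : `|2^-1| < 1 :> R by rewrite ger0_norm// invf_lt1// ltr1n.
move=> /(_ h2) cv.
have -> : 2 * M = M / (1 - 2^-1) by field.
rewrite (_ : (fun _ => _) = EFin \o series (geometric M 2^-1)).
  by apply: cvg_EFin; [exact: nearW|exact: cv].
apply/funext => N; rewrite /series/= -sumEFin; apply: eq_bigr => k _.
by rewrite /geometric/= exprVn.
Qed.

End absolute_integral.

Section integration_upper_regular.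
Context {R : realType} {d : nat} (n : nat) (E : set 'rV[R]_d) (C : R).
Local Notation V := 'rV[R]_d.
Local Notation T := (caratheodory_type (@hausdorff_outer R d n)).
Local Notation mu := (@hausdorff_measure R d n).
Implicit Types (X : V) (D : set T).
Hypothesis C0 : 0 < C.
Hypothesis upper : forall X r, 0 < r ->
  (hausdorff n (E `&` eball X r) <= (C * r ^+ n)%:E)%E.

Local Notation mfun f := (measurable_fun [set: T] (f : T -> R)).

Let abs_integral_le_balls D f X (c rad : nat -> R) M :
  measurable D -> D `<=` E -> mfun f ->
  (forall k, 0 <= c k) -> (forall k, 0 < rad k) -> 0 <= M ->
  (forall k, c k * (C * rad k ^+ n) <= M / 2 ^+ k) ->
  (forall z, D z -> exists k, `|f z| <= c k /\ eball X (rad k) z) ->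
  abs_integral_le mu D f (2 * M).
Proof.
move=> mD DE mf c0 rad0 M0 cM fc.
apply: (@abs_integral_le_layers _ _ _ mu D f (fun k => eball X (rad k)) c
  (fun k => C * rad k ^+ n)); [exact: mD|exact: mf| |exact: c0|exact: M0| |exact: cM|exact: fc].
  by move=> k; exact/open_hausdorff_measurable/open_eball.
move=> k; apply: le_trans (upper X (rad0 k)).
by apply: (le_outer_measure (@hausdorff R d n)) => z [Dz zk]; split => //; exact: DE.
Qed.

Let pow2_gt (x : R) : exists k : nat, x < 2 ^+ k.
Proof.
exists (Num.truncn x).+1; apply: lt_trans (truncnS_gt x) _.
by rewrite -natrX ltr_nat ltn_expl.
Qed.

(** Far field: the mass of a ball grows at most like the power [n] of the radius, so
    that the shares of successive dyadic annuli decay geometrically. *)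
Lemma abs_integral_le_far D X rho (a : T -> R) : measurable D ->
  D `<=` E -> mfun a -> (forall z, 0 <= a z) -> 0 < rho ->
  (forall z, D z -> rho <= a z /\ enorm (X - z) <= a z) ->
  abs_integral_le mu D (fun z => a z ^- n.+1) (2 * (2 ^+ n * C / rho)).
Proof.
move=> mD DE ma a0 rho0 aD.
have p2 k : 0 < 2 ^+ k * rho :> R by rewrite mulr_gt0 ?exprn_gt0.
apply: (@abs_integral_le_balls _ _ X (fun k => (2 ^+ k * rho) ^- n.+1)
    (fun k => 2 ^+ k.+1 * rho)).
- exact: mD.
- exact: DE.
- exact: exprV_hausdorff_measurable.
- by move=> k; rewrite invr_ge0 exprn_ge0 ?ltW.
- by [].
- by rewrite divr_ge0 ?mulr_ge0 ?exprn_ge0 ?ltW.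
- move=> k; have := p2 k.
  have -> : 2 ^+ k.+1 * rho = 2 * (2 ^+ k * rho) by rewrite exprS mulrA.
  have -> : 2 ^+ n * C / rho / 2 ^+ k = 2 ^+ n * C / (2 ^+ k * rho).
    by rewrite [in RHS]invfM [in RHS]mulrC -[in LHS]mulrA [in LHS]mulrC [_^-1 / _]mulrC.
  move: (2 ^+ k * rho) => q q0; have qn : q ^+ n != 0 by rewrite expf_neq0// gt_eqF.
  rewrite exprMn exprSr invfM.
  have -> : q ^- n * q^-1 * (C * (2 ^+ n * q ^+ n)) =
     2 ^+ n * C / q * (q ^- n * q ^+ n) by ring.
  by rewrite mulVf// mulr1.
- move=> z /aD[rz Xz].
  pose P := fun k : nat => a z < 2 ^+ k.+1 * rho.
  have exP : exists k, P k.
    have [k hk] := pow2_gt (a z / rho); exists k; rewrite /P.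
    by rewrite -ltr_pdivrMr//; apply: lt_le_trans hk _; rewrite ler_weXn2l ?ler1n.
  case: (ex_minnP exP) => k Pk kmin; exists k; split; last first.
    by rewrite /eball/= enorm_distC; exact: le_lt_trans Pk.
  rewrite ger0_norm ?invr_ge0 ?exprn_ge0//; apply: ler_exprV => //.
  case: k Pk kmin => [|k] Pk kmin; first by rewrite expr0 mul1r.
  by rewrite leNgt; apply/negP => h; have := kmin k h; rewrite ltnn.
Qed.

(** Near field: the half-power gained by [kernel_profile_half_power] makes the
    dyadic sum towards the singularity converge. *)
Lemma abs_integral_le_near D X rho (a : T -> R) : (1 <= n)%N ->
  measurable D -> D `<=` E -> mfun a -> (forall z, 0 <= a z) ->
  0 < rho ->
  (forall z, D z -> [/\ 0 < a z, a z < rho & enorm (X - z) <= a z]) ->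
  abs_integral_le mu D (fun z => Num.sqrt (a z) * a z ^- n)
    (2 * (4 ^+ n * C * Num.sqrt rho)).
Proof.
move=> n1 mD DE ma a0 rho0 aD.
have p4 k : 0 < (4 ^+ k)^-1 * rho :> R by rewrite mulr_gt0 ?invr_gt0 ?exprn_gt0.
apply: (@abs_integral_le_balls _ _ X
    (fun k => Num.sqrt ((4 ^+ k)^-1 * rho) * ((4 ^+ k.+1)^-1 * rho) ^- n)
    (fun k => (4 ^+ k)^-1 * rho)).
- exact: mD.
- exact: DE.
- apply: measurable_funM; last exact: exprV_hausdorff_measurable.
  exact: (measurableT_comp (continuous_measurable_fun (@sqrt_continuous R))).
- by move=> k; rewrite mulr_ge0 ?sqrtr_ge0// invr_ge0 exprn_ge0 ?ltW.
- by [].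
- by rewrite !mulr_ge0 ?exprn_ge0 ?sqrtr_ge0 ?ltW.
- move=> k.
  have -> : Num.sqrt ((4 ^+ k)^-1 * rho) = Num.sqrt rho / 2 ^+ k.
    rewrite sqrtrM ?invr_ge0 ?exprn_ge0// mulrC; congr (_ * _).
    rewrite (_ : (4 ^+ k)^-1 = ((2 ^+ k)^-1) ^+ 2).
      by rewrite sqrtr_sqr ger0_norm// invr_ge0 exprn_ge0.
    by rewrite exprVn -exprM mulnC exprM (_ : 2 ^+ 2 = 4)// expr2; ring.
  have -> : (4 ^+ k.+1)^-1 * rho = 4^-1 * ((4 ^+ k)^-1 * rho).
    by rewrite exprS invfM mulrA.
  have := p4 k; move: ((4 ^+ k)^-1 * rho) => q q0.
  have -> : (4^-1 * q) ^- n = 4 ^+ n * q ^- n.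
    by rewrite exprMn exprVn invfM invrK.
  have -> : Num.sqrt rho / 2 ^+ k * (4 ^+ n * q ^- n) * (C * q ^+ n) =
    4 ^+ n * C * Num.sqrt rho / 2 ^+ k * (q ^- n * q ^+ n) by ring.
  by rewrite mulVf ?expf_neq0 ?gt_eqF// mulr1.
- move=> z /aD[az arho Xz].
  pose P := fun k : nat => (4 ^+ k.+1)^-1 * rho <= a z.
  have exP : exists k, P k.
    have [k hk] := pow2_gt (rho / a z); exists k; rewrite /P.
    rewrite ler_pdivrMl ?exprn_gt0// mulrC -ler_pdivrMl// mulrC.
    apply: le_trans (ltW hk) _; apply: (@le_trans _ _ (4 ^+ k)).
      by apply: lerXn2r; rewrite ?nnegrE// ler_nat.
    by rewrite ler_weXn2l// ler1n.
  case: (ex_minnP exP) => k Pk kmin; exists k.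
  have ak : a z < (4 ^+ k)^-1 * rho.
    case: k Pk kmin => [|k] Pk kmin; first by rewrite expr0 invr1 mul1r.
    by rewrite ltNge; apply/negP => h; have := kmin k h; rewrite ltnn.
  split; last by rewrite /eball/= enorm_distC; exact: le_lt_trans ak.
  rewrite ger0_norm ?mulr_ge0 ?sqrtr_ge0 ?invr_ge0 ?exprn_ge0//.
  apply: ler_pM; rewrite ?sqrtr_ge0 ?invr_ge0 ?exprn_ge0//.
    by rewrite ler_sqrt ?ltW.
  exact: ler_exprV.
Qed.

End integration_upper_regular.

(** * Integration against the Hausdorff measure of a closed set *)

Section hausdorff_integral.
Context {R : realType} {d : nat} (n : nat) (E : set 'rV[R]_d) (C : R).
Local Notation V := 'rV[R]_d.
Local Notation T := (caratheodory_type (@hausdorff_outer R d n)).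
Local Notation mu := (@hausdorff_measure R d n).
Local Notation phi := (@kernel_profile R).
Implicit Types (X : V) (f g : V -> R).

Definition hmeas f : Prop := measurable_fun [set: T] (f : T -> R).

Lemma hmeas_cst k : hmeas (fun=> k).
Proof. exact: measurable_cst. Qed.

Lemma hmeasD f g : hmeas f -> hmeas g -> hmeas (fun z => f z + g z).
Proof. by move=> mf mg; exact: measurable_funD. Qed.

Lemma hmeasB f g : hmeas f -> hmeas g -> hmeas (fun z => f z - g z).
Proof. by move=> mf mg; exact: measurable_funB. Qed.

Lemma hmeasM f g : hmeas f -> hmeas g -> hmeas (fun z => f z * g z).
Proof. by move=> mf mg; exact: measurable_funM. Qed.

Lemma hmeas_sum (I : finType) (F : I -> V -> R) : (forall i, hmeas (F i)) ->
  hmeas (fun z => \sum_i F i z).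
Proof. by move=> mF; exact: measurable_sum. Qed.

Lemma hmeas_indic (A : set V) : measurable (A : set T) -> hmeas (\1_A).
Proof. by move=> mA; exact: measurable_indic. Qed.

Lemma hmeas_sqrt f : hmeas f -> hmeas (fun z => Num.sqrt (f z)).
Proof.
by move=> mf; exact: (measurableT_comp (continuous_measurable_fun (@sqrt_continuous R)) mf).
Qed.

Lemma hmeasXV f m : (forall z, 0 <= f z) -> hmeas f -> hmeas (fun z => f z ^- m).
Proof. by move=> f0 mf; exact: exprV_hausdorff_measurable. Qed.

Lemma hmeas_enorm X : hmeas (fun z => enorm (X - z)).
Proof. exact: enorm_hausdorff_measurable. Qed.

Lemma hmeas_lifted_norm h X : hmeas (fun z => lifted_norm h (X - z)).
Proof. exact: lifted_norm_hausdorff_measurable. Qed.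

Lemma hmeas_profile m h X : hmeas (fun z => phi m (lifted_norm h (X - z))).
Proof.
apply: profile_hausdorff_measurable; first by move=> z; exact: sqrtr_ge0.
exact: lifted_norm_hausdorff_measurable.
Qed.

Lemma hmeas_grad m X i : hmeas (fun z => kernel_grad m (X - z) 0 i).
Proof. exact: kernel_grad_hausdorff_measurable. Qed.

Lemma hmeas_hess m X i j : hmeas (fun z => kernel_hess m (X - z) i j).
Proof. exact: kernel_hess_hausdorff_measurable. Qed.

Lemma hmeas_gradD m X (D : V) : hmeas (fun z => dotv (kernel_grad m (X - z)) D).
Proof.
apply: hmeas_sum => i; apply: hmeasM; last exact: hmeas_cst.
exact: hmeas_grad.
Qed.

Definition admissible f : Prop := hmeas f /\ exists M, abs_integral_le mu (E : set T) f M.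

Definition hint f : R := \int[mu]_(z in (E : set T)) f z.

Hypothesis cE : closed E.

Let mE : measurable (E : set T).
Proof. exact: closed_hausdorff_measurable. Qed.

Let admissible_integrable f : admissible f ->
  mu.-integrable (E : set T) (EFin \o (f : T -> R)).
Proof. by move=> [mf [M hM]]; exact: abs_integral_le_integrable mE mf hM. Qed.

Lemma admissibleZ k f : admissible f -> admissible (fun z => k * f z).
Proof.
move=> [mf [M hM]]; split; first by apply: hmeasM => //; exact: hmeas_cst.
by exists (`|k| * M); exact: abs_integral_leZ.
Qed.

Lemma admissibleD f g : admissible f -> admissible g -> admissible (fun z => f z + g z).
Proof.
move=> [mf [M hM]] [mg [N hN]]; split; first exact: hmeasD.
by exists (M + N); exact: abs_integral_leD.
Qed.

Lemma admissibleB f g : admissible f -> admissible g -> admissible (fun z => f z - g z).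
Proof.
move=> af ag; have -> : (fun z => f z - g z) = fun z => f z + -1 * g z.
  by apply/funext => z; rewrite mulN1r.
by apply: admissibleD => //; exact: admissibleZ.
Qed.

Lemma hintZ k f : admissible f -> hint (fun z => k * f z) = k * hint f.
Proof. by move=> /admissible_integrable fi; exact: RintegralZl. Qed.

Lemma hintD f g : admissible f -> admissible g ->
  hint (fun z => f z + g z) = hint f + hint g.
Proof.
by move=> /admissible_integrable fi /admissible_integrable gi; exact: RintegralD.
Qed.

Lemma hintB f g : admissible f -> admissible g ->
  hint (fun z => f z - g z) = hint f - hint g.
Proof.
by move=> /admissible_integrable fi /admissible_integrable gi; exact: RintegralB.
Qed.

Lemma admissible0 : admissible (fun=> 0).
Proof.
split; first exact: hmeas_cst.
exists 0; rewrite /abs_integral_le (eq_integral (fun=> 0%E)).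
  by rewrite integral0.
by move=> z _; rewrite normr0.
Qed.

Lemma hint0 : hint (fun=> 0) = 0.
Proof. by rewrite /hint /Rintegral integral0. Qed.

Lemma admissible_sum m (F : 'I_m -> V -> R) : (forall i, admissible (F i)) ->
  admissible (fun z => \sum_i F i z).
Proof.
elim: m F => [|m IH] F aF.
  rewrite (_ : (fun _ => _) = fun=> 0); first exact: admissible0.
  by apply/funext => z; rewrite big_ord0.
rewrite (_ : (fun _ => _) = fun z => F ord0 z + \sum_i F (lift ord0 i) z).
  by apply: admissibleD => //; exact: IH.
by apply/funext => z; rewrite big_ord_recl.
Qed.

Lemma hint_sum m (F : 'I_m -> V -> R) : (forall i, admissible (F i)) ->
  hint (fun z => \sum_i F i z) = \sum_i hint (F i).
Proof.
elim: m F => [|m IH] F aF.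
  rewrite big_ord0 -[RHS]hint0; congr hint.
  by apply/funext => z; rewrite big_ord0.
rewrite big_ord_recl -IH// -hintD//; last exact: admissible_sum.
by congr hint; apply/funext => z; rewrite big_ord_recl.
Qed.

Lemma eq_hint f g : (forall z, E z -> f z = g z) -> hint f = hint g.
Proof. by move=> fg; apply: eq_Rintegral => z /set_mem; exact: fg. Qed.

Lemma hint_ge0 f : (forall z, E z -> 0 <= f z) -> 0 <= hint f.
Proof. by move=> f0; apply: Rintegral_ge0. Qed.

Lemma hint_le f g : admissible f -> admissible g -> (forall z, E z -> f z <= g z) ->
  hint f <= hint g.
Proof.
by move=> /admissible_integrable fi /admissible_integrable gi fg; exact: le_Rintegral.
Qed.

Lemma hint_bound f M : hmeas f -> abs_integral_le mu (E : set T) f M ->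
  `|hint f| <= M.
Proof. by move=> mf hM; exact: abs_integral_le_norm mE mf hM. Qed.

Lemma hint_indic (A : set V) M : measurable (A : set T) ->
  hausdorff n (E `&` A) = M%:E -> admissible (\1_A) /\ hint (\1_A) = M.
Proof.
move=> mA hM.
have e : (\int[mu]_(z in (E : set T)) (`|\1_A z|)%:E = M%:E)%E.
  rewrite (eq_integral (fun z : T => (\1_A z)%:E)) => [|z _]; last by rewrite ger0_norm.
  by rewrite integral_indic// setIC.
split; first by split; [exact: hmeas_indic|exists M; rewrite /abs_integral_le e].
rewrite /hint /Rintegral (_ : (\int[_]_(_ in _) _)%E = M%:E)//.
by rewrite integral_indic// setIC.
Qed.

Hypothesis C0 : 0 < C.
Hypothesis upper : forall X r, 0 < r ->
  (hausdorff n (E `&` eball X r) <= (C * r ^+ n)%:E)%E.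

(** This is [rho%:E <= point_dist X E], stated with real numbers. *)
Definition far_from rho X := forall z, E z -> rho <= enorm (X - z).

Definition far_constant : R := 2 * (2 ^+ n * C).

Lemma far_constant_gt0 : 0 < far_constant.
Proof. by rewrite mulr_gt0// mulr_gt0// exprn_gt0. Qed.

Lemma far_integral_le f A X rho : hmeas f -> 0 < rho -> far_from rho X -> 0 <= A ->
  (forall z, E z -> `|f z| <= A * enorm (X - z) ^- n.+1) ->
  abs_integral_le mu (E : set T) f (A * (far_constant / rho)).
Proof.
move=> mf rho0 Xf A0 fA.
pose g z := enorm (X - z) ^- n.+1.
have mg : hmeas g.
  apply: exprV_hausdorff_measurable; first by move=> z; exact: enorm_ge0.
  exact: enorm_hausdorff_measurable.
have hg : abs_integral_le mu (E : set T) g (far_constant / rho).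
  rewrite /far_constant -mulrA; apply: (abs_integral_le_far C0 upper (X := X)).
  - exact: mE.
  - by [].
  - exact: enorm_hausdorff_measurable.
  - by move=> z; exact: enorm_ge0.
  - by [].
  - by move=> z Ez; split => //; exact: Xf.
have := abs_integral_leZ A mE mg hg; rewrite ger0_norm//.
apply: (abs_integral_le_mono mE mf).
  by apply: hmeasM => //; exact: hmeas_cst.
move=> z Ez; apply: le_trans (fA z Ez) (ler_norm _).
Qed.

Lemma far_admissible f A X rho : hmeas f -> 0 < rho -> far_from rho X -> 0 <= A ->
  (forall z, E z -> `|f z| <= A * enorm (X - z) ^- n.+1) -> admissible f.
Proof.
move=> mf rho0 Xf A0 fA; split => //.
by exists (A * (far_constant / rho)); exact: far_integral_le fA.
Qed.

Lemma far_hint_le f A X rho : hmeas f -> 0 < rho -> far_from rho X -> 0 <= A ->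
  (forall z, E z -> `|f z| <= A * enorm (X - z) ^- n.+1) ->
  `|hint f| <= A * (far_constant / rho).
Proof.
move=> mf rho0 Xf A0 fA; apply: hint_bound => //.
exact: far_integral_le fA.
Qed.

End hausdorff_integral.

(** * The single layer potential and its derivatives *)

Section layer_potential.
Context {R : realType} (n : nat) (E : set 'rV[R]_n.+1) (C : R).
Local Notation V := 'rV[R]_n.+1.
Local Notation phi := (@kernel_profile R).
Local Notation far_from := (far_from E).
Local Notation admissible := (admissible n E).
Local Notation hint := (hint n E).
Local Notation hmeas := (@hmeas R n.+1 n).
Local Notation K0 := (far_constant n C).
Implicit Types (X D : V).
Hypothesis n1 : (1 <= n)%N.
Hypothesis cE : closed E.
Hypothesis C0 : 0 < C.
Hypothesis upper : forall X r, 0 < r ->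
  (hausdorff n (E `&` eball X r) <= (C * r ^+ n)%:E)%E.

Let K00 : 0 < K0 := far_constant_gt0 n C0.

Lemma far_from_gt0 rho X z : 0 < rho -> far_from rho X -> E z -> 0 < enorm (X - z).
Proof. by move=> rho0 Xf /Xf; exact: lt_le_trans. Qed.

Lemma far_from_half rho X X' : far_from rho X -> enorm (X' - X) <= rho / 2 ->
  far_from (rho / 2) X'.
Proof.
move=> Xf XX' z Ez; have := Xf z Ez; have := ler_enorm_dist X X' z.
by rewrite [enorm (X - X')]enorm_distC; lra.
Qed.

Let shift_kernel X X' (z : V) : X' - z = (X - z) + (X' - X).
Proof. by rewrite [RHS]addrC addrA subrK. Qed.

Definition layer_hessian X i j : R := hint (fun z => kernel_hess n (X - z) i j).

Lemma layer_hessian_admissible rho X i j : 0 < rho -> far_from rho X ->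
  admissible (fun z => kernel_hess n (X - z) i j).
Proof.
move=> rho0 Xf; apply: (far_admissible cE C0 upper _ rho0 Xf (A := n.+2%:R)) => //.
  exact: hmeas_hess.
by move=> z _; exact: kernel_hess_le.
Qed.

Lemma layer_hessian_increment : exists2 A : R, 0 <= A &
  forall rho X X' i j, 0 < rho -> far_from rho X -> enorm (X' - X) <= rho / 2 ->
  `|layer_hessian X' i j - layer_hessian X i j| <= A * enorm (X' - X) / rho ^+ 2.
Proof.
have [A A0 H] := @kernel_hess_increment R n.+1 n.
exists (A * K0) => [|rho X X' i j rho0 Xf XX']; first by rewrite mulr_ge0 ?(ltW K00).
have aX := layer_hessian_admissible i j rho0 Xf.
have aX' := layer_hessian_admissible i j (divr_gt0 rho0 (ltr0Sn R 1)) (far_from_half Xf XX').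
rewrite /layer_hessian -hintB//.
have hm : hmeas (fun z => kernel_hess n (X' - z) i j - kernel_hess n (X - z) i j).
  by apply: hmeasB; exact: hmeas_hess.
have A1 : 0 <= A * enorm (X' - X) / rho.
  by rewrite divr_ge0 ?mulr_ge0 ?enorm_ge0 ?(ltW rho0).
apply: le_trans (far_hint_le cE C0 upper hm rho0 Xf A1 _) _; last first.
  by rewrite le_eqVlt; apply/orP; left; apply/eqP; field; rewrite gt_eqF.
move=> z Ez; have Xz := far_from_gt0 rho0 Xf Ez.
rewrite (shift_kernel X X'); apply: le_trans (H _ _ i j Xz _) _.
  by apply: le_trans XX' _; rewrite ler_pM2r//; exact: Xf.
rewrite (exprVD 1 n.+1) expr1 !mulrA ler_wpM2r ?invr_ge0 ?exprn_ge0 ?enorm_ge0//.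
rewrite ler_wpM2l ?mulr_ge0 ?enorm_ge0// lef_pV2 ?posrE//; exact: Xf.
Qed.

Section anchored.
Variables (Xs : V) (rs : R).
Hypothesis rs0 : 0 < rs.
Hypothesis Xsf : far_from rs Xs.

(** Subtracting the first-order expansion at an anchor [Xs] off [E] makes the
    integrals over an unbounded [E] converge.  Both functions then vanish at [Xs],
    from where bounds are propagated. *)
Definition layer_grad X i : R :=
  hint (fun z => kernel_grad n (X - z) 0 i - kernel_grad n (Xs - z) 0 i).

Definition potential_kernel h X (z : V) : R :=
  phi n (lifted_norm h (X - z)) - phi n (enorm (Xs - z)) -
    dotv (kernel_grad n (Xs - z)) (X - Xs).

Definition layer_potential h X : R := hint (potential_kernel h X).

Lemma layer_grad_anchor i : layer_grad Xs i = 0.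
Proof.
rewrite -[RHS](hint0 n E); apply: eq_hint => z _; exact: subrr.
Qed.

Lemma layer_potential_anchor : layer_potential 0 Xs = 0.
Proof.
rewrite -[RHS](hint0 n E); apply: eq_hint => z _.
rewrite /potential_kernel lifted_norm0 !subrr sub0r /dotv big1 ?oppr0// => i _.
by rewrite [X in _ * X]mxE mulr0.
Qed.

Lemma hmeas_potential_kernel h X : hmeas (potential_kernel h X).
Proof.
apply: hmeasB; last exact: hmeas_gradD.
apply: hmeasB; first exact: hmeas_profile.
have := @hmeas_profile R n.+1 n n 0 Xs.
by rewrite (_ : (fun _ => _) = fun z => phi n (enorm (Xs - z)))//;
  apply/funext => z; rewrite lifted_norm0.
Qed.

(* Near the anchor a bounded kernel is dominated trivially, so only the decay at
   infinity has to be checked. *)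
Lemma anchored_admissible f (B L A : R) : hmeas f -> 0 <= B -> 0 <= A ->
  (forall z, E z -> enorm (Xs - z) <= L -> `|f z| <= B) ->
  (forall z, E z -> L <= enorm (Xs - z) -> `|f z| <= A * enorm (Xs - z) ^- n.+1) ->
  admissible f.
Proof.
move=> mf B0 A0 near far.
have L0 : 0 <= `|L| by [].
apply: (far_admissible cE C0 upper mf rs0 Xsf (A := A + B * `|L| ^+ n.+1)) => [|z Ez].
  by rewrite addr_ge0 ?mulr_ge0 ?exprn_ge0.
have z0 := far_from_gt0 rs0 Xsf Ez.
have P0 : 0 <= enorm (Xs - z) ^- n.+1 by rewrite invr_ge0 exprn_ge0 ?enorm_ge0.
have [zL|Lz] := leP (enorm (Xs - z)) L.
  apply: le_trans (near z Ez zL) _.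
  apply: (@le_trans _ _ (B * `|L| ^+ n.+1 * enorm (Xs - z) ^- n.+1)).
    rewrite -mulrA ler_peMr// ler_pdivlMr ?exprn_gt0// mul1r.
    by apply: lerXn2r; rewrite ?nnegrE ?enorm_ge0// (le_trans zL)// ler_norm.
  by rewrite ler_wpM2r// lerDr.
apply: le_trans (far z Ez (ltW Lz)) _.
by rewrite ler_wpM2r// lerDl mulr_ge0 ?exprn_ge0.
Qed.

Lemma layer_grad_admissible rho X i : 0 < rho -> far_from rho X ->
  admissible (fun z => kernel_grad n (X - z) 0 i - kernel_grad n (Xs - z) 0 i).
Proof.
move=> rho0 Xf; have [A A0 H] := @kernel_grad_increment R n.+1 n.
apply: (@anchored_admissible _ (rho ^- n + rs ^- n) (2 * enorm (X - Xs))
    (A * enorm (X - Xs))).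
- by apply: hmeasB; exact: hmeas_grad.
- by rewrite addr_ge0 ?invr_ge0 ?exprn_ge0 ?ltW.
- by rewrite mulr_ge0 ?enorm_ge0.
- move=> z Ez _; apply: le_trans (ler_normB _ _) _; apply: lerD.
    by apply: le_trans (kernel_grad_le _ _ _) _; apply: ler_exprV => //; exact: Xf.
  by apply: le_trans (kernel_grad_le _ _ _) _; apply: ler_exprV => //; exact: Xsf.
- move=> z Ez zL; rewrite (shift_kernel Xs X); apply: H.
    exact: far_from_gt0 Xsf Ez.
  lra.
Qed.

Lemma layer_potential_admissible rho h X : 0 <= h -> 0 < rho ->
  (forall z, E z -> rho <= lifted_norm h (X - z)) -> admissible (potential_kernel h X).
Proof.
move=> h0 rho0 Xf; have [A A0 H] := @kernel_profile_expansion R n.+1 n n1.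
pose L := 2 * (enorm (X - Xs) + h).
have bound (a b s : R) : 0 < a -> a <= s -> s <= b -> `|phi n s| <= `|phi n a| + `|phi n b|.
  move=> a0 as_ sb; have := ler_kernel_profile n1 a0 as_.
  have := ler_kernel_profile n1 (lt_le_trans a0 as_) sb.
  have := ler_norm (phi n b); have := ler_norm (- phi n a); rewrite normrN => h1 h2 h3 h4.
  have := normr_ge0 (phi n a); have := normr_ge0 (phi n b) => h5 h6.
  by rewrite ler_norml; apply/andP; split; lra.
pose M := L + enorm (X - Xs) + h.
apply: (@anchored_admissible _ (`|phi n rho| + `|phi n M| + (`|phi n rs| + `|phi n L|)
   + \sum_(i < n.+1) rs ^- n * enorm (X - Xs)) L (A * (enorm (X - Xs) + h) ^+ 2)).
- exact: hmeas_potential_kernel.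
- rewrite !addr_ge0// sumr_ge0// => i _.
  by rewrite mulr_ge0 ?enorm_ge0 ?invr_ge0 ?exprn_ge0 ?ltW.
- by rewrite mulr_ge0 ?sqr_ge0 ?enorm_ge0.
- move=> z Ez zL; apply: le_trans (ler_normB _ _) _; apply: lerD.
    apply: le_trans (ler_normB _ _) _; apply: lerD.
      apply: bound => //; first exact: Xf.
      apply: le_trans (lifted_norm_le _ h0) _; rewrite lerD2r.
      by have := ler_enorm_dist X Xs z; rewrite /M; lra.
    by apply: bound => //; exact: Xsf.
  apply: le_trans (ler_norm_sum _ _ _) _; apply: ler_sum => i _.
  rewrite normrM; apply: ler_pM => //; last exact: enorm_coord.
  apply: le_trans (kernel_grad_le _ _ _) _; apply: ler_exprV => //; exact: Xsf.
- move=> z Ez zL; rewrite /potential_kernel (shift_kernel Xs X); apply: H => //.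
    exact: far_from_gt0 Xsf Ez.
  rewrite /L in zL; lra.
Qed.

End anchored.

(** Differentiation under the integral sign in quantitative form: integrating the
    error of the expansion of the kernel costs one power of the distance. *)
Lemma layer_grad_expansion : exists2 A : R, 0 <= A &
  forall Xs rs rho X X' i, 0 < rs -> far_from rs Xs -> 0 < rho -> far_from rho X -> enorm (X' - X) <= rho / 2 ->
  `|layer_grad Xs X' i - layer_grad Xs X i - \sum_j layer_hessian X i j * (X' - X) 0 j|
    <= A * enorm (X' - X) ^+ 2 / rho ^+ 2.
Proof.
have [A A0 H] := @kernel_grad_expansion R n.+1 n.
exists (A * K0) => [|Xs rs rho X X' i rs0 Xsf rho0 Xf XX']; first by rewrite mulr_ge0 ?(ltW K00).
have aX := layer_grad_admissible rs0 Xsf i rho0 Xf.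
have aX' := layer_grad_admissible rs0 Xsf i (divr_gt0 rho0 (ltr0Sn R 1)) (far_from_half Xf XX').
pose F j z := (X' - X) 0 j * kernel_hess n (X - z) i j.
have aF j : admissible (F j).
  by apply: admissibleZ => //; exact: layer_hessian_admissible Xf.
have -> : \sum_j layer_hessian X i j * (X' - X) 0 j = hint (fun z => \sum_j F j z).
  rewrite hint_sum//; apply: eq_bigr => j _; rewrite /F hintZ//; first by rewrite mulrC.
  exact: layer_hessian_admissible Xf.
have aS : admissible (fun z => \sum_j F j z) by apply: admissible_sum.
rewrite /layer_grad -hintB// -hintB//; last by apply: admissibleB.
have A1 : 0 <= A * enorm (X' - X) ^+ 2 / rho.
  by rewrite divr_ge0 ?mulr_ge0 ?sqr_ge0 ?enorm_ge0 ?(ltW rho0).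
have [hm _] : admissible (fun z =>
    kernel_grad n (X' - z) 0 i - kernel_grad n (Xs - z) 0 i -
    (kernel_grad n (X - z) 0 i - kernel_grad n (Xs - z) 0 i) - \sum_j F j z).
  by apply: admissibleB => //; by apply: admissibleB.
apply: le_trans (far_hint_le cE C0 upper hm rho0 Xf A1 _) _; last first.
  by rewrite le_eqVlt; apply/orP; left; apply/eqP; field; rewrite gt_eqF.
move=> z Ez; have Xz := far_from_gt0 rho0 Xf Ez.
have -> : kernel_grad n (X' - z) 0 i - kernel_grad n (Xs - z) 0 i -
    (kernel_grad n (X - z) 0 i - kernel_grad n (Xs - z) 0 i) - \sum_j F j z =
    kernel_grad n ((X - z) + (X' - X)) 0 i - kernel_grad n (X - z) 0 i -
    \sum_j kernel_hess n (X - z) i j * (X' - X) 0 j.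
  rewrite -shift_kernel (eq_bigr (fun j => kernel_hess n (X - z) i j * (X' - X) 0 j)).
    by ring.
  by move=> j _; rewrite /F mulrC.
apply: le_trans (H _ _ i Xz _) _.
  by apply: le_trans XX' _; rewrite ler_pM2r//; exact: Xf.
rewrite (exprVD 1 n.+1) expr1 !mulrA ler_wpM2r ?invr_ge0 ?exprn_ge0 ?enorm_ge0//.
by rewrite ler_wpM2l ?mulr_ge0 ?sqr_ge0 ?enorm_ge0// lef_pV2 ?posrE//; exact: Xf.
Qed.

Lemma layer_potential_expansion : exists2 A : R, 0 <= A &
  forall Xs rs rho X X', 0 < rs -> far_from rs Xs -> 0 < rho -> far_from rho X -> enorm (X' - X) <= rho / 2 ->
  `|layer_potential Xs 0 X' - layer_potential Xs 0 X -
     \sum_j layer_grad Xs X j * (X' - X) 0 j|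
    <= A * enorm (X' - X) ^+ 2 / rho.
Proof.
have [A A0 H] := @kernel_profile_expansion R n.+1 n n1.
exists (A * K0) => [|Xs rs rho X X' rs0 Xsf rho0 Xf XX']; first by rewrite mulr_ge0 ?(ltW K00).
have aU Y r : 0 < r -> far_from r Y -> admissible (potential_kernel Xs 0 Y).
  move=> r0 Yf; apply: (@layer_potential_admissible Xs rs rs0 Xsf r) => // z Ez.
  by rewrite lifted_norm0; exact: Yf.
have aX := aU _ _ rho0 Xf.
have aX' := aU _ _ (divr_gt0 rho0 (ltr0Sn R 1)) (far_from_half Xf XX').
pose F j z := (X' - X) 0 j * (kernel_grad n (X - z) 0 j - kernel_grad n (Xs - z) 0 j).
have aF j : admissible (F j).
  by apply: admissibleZ => //; exact: (layer_grad_admissible rs0 Xsf _ rho0 Xf).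
have -> : \sum_j layer_grad Xs X j * (X' - X) 0 j = hint (fun z => \sum_j F j z).
  rewrite hint_sum//; apply: eq_bigr => j _; rewrite /F hintZ//; first by rewrite mulrC.
  exact: (layer_grad_admissible rs0 Xsf _ rho0 Xf).
have aS : admissible (fun z => \sum_j F j z) by apply: admissible_sum.
rewrite /layer_potential -hintB// -hintB//; last by apply: admissibleB.
have A1 : 0 <= A * enorm (X' - X) ^+ 2.
  by rewrite mulr_ge0 ?sqr_ge0 ?enorm_ge0.
have [hm _] : admissible (fun z =>
    potential_kernel Xs 0 X' z - potential_kernel Xs 0 X z - \sum_j F j z).
  by apply: admissibleB => //; by apply: admissibleB.
apply: le_trans (far_hint_le cE C0 upper hm rho0 Xf A1 _) _; last first.
  by rewrite le_eqVlt; apply/orP; left; apply/eqP; field; rewrite gt_eqF.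
move=> z Ez; have Xz := far_from_gt0 rho0 Xf Ez.
have -> : potential_kernel Xs 0 X' z - potential_kernel Xs 0 X z - \sum_j F j z =
    phi n (lifted_norm 0 ((X - z) + (X' - X))) - phi n (enorm (X - z)) -
    dotv (kernel_grad n (X - z)) (X' - X).
  rewrite -shift_kernel /potential_kernel !lifted_norm0.
  have -> : \sum_j F j z = dotv (kernel_grad n (X - z)) (X' - X) -
      (dotv (kernel_grad n (Xs - z)) (X' - Xs) - dotv (kernel_grad n (Xs - z)) (X - Xs)).
    rewrite /dotv -!sumrB; apply: eq_bigr => j _; rewrite /F.
    by move: (kernel_grad _ _ _ _) (kernel_grad _ _ _ _) => a b; rewrite !mxE; ring.
  by ring.
have := H (X - z) (X' - X) 0 Xz (lexx _); rewrite addr0 -mulrA; apply.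
by apply: le_trans XX' _; rewrite ler_pM2r//; exact: Xf.
Qed.

End layer_potential.

(** * Comparison of the regularized potential with the potential off the set *)

Section potential_estimates.
Context {R : realType} (n : nat) (E : set 'rV[R]_n.+1) (C : R).
Local Notation V := 'rV[R]_n.+1.
Local Notation T := (caratheodory_type (@hausdorff_outer R n.+1 n)).
Local Notation mu := (@hausdorff_measure R n.+1 n).
Local Notation phi := (@kernel_profile R).
Local Notation far_from := (far_from E).
Local Notation admissible := (admissible n E).
Local Notation hint := (hint n E).
Local Notation hmeas := (@hmeas R n.+1 n).
Local Notation K0 := (far_constant n C).
Implicit Types (X y : V).
Hypothesis n1 : (1 <= n)%N.
Hypothesis cE : closed E.
Hypothesis C0 : 0 < C.
Hypothesis upper : forall X r, 0 < r ->
  (hausdorff n (E `&` eball X r) <= (C * r ^+ n)%:E)%E.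

Let K00 : 0 < K0 := far_constant_gt0 n C0.

Let mE : measurable (E : set T).
Proof. exact: closed_hausdorff_measurable. Qed.

Let mball X r : measurable (eball X r : set T).
Proof. exact/open_hausdorff_measurable/open_eball. Qed.

Lemma dotv_grad_le m (Y D : V) :
  `|dotv (kernel_grad m Y) D| <= n.+1%:R * (enorm Y ^- m * enorm D).
Proof.
apply: le_trans (ler_norm_sum _ _ _) _.
apply: (@le_trans _ _ (\sum_(i < n.+1) enorm Y ^- m * enorm D)).
  apply: ler_sum => i _; rewrite normrM.
  by apply: ler_pM => //; [exact: kernel_grad_le|exact: enorm_coord].
by rewrite sumr_const card_ord [leRHS]mulr_natl.
Qed.

Let hmeas_enormXV X m : hmeas (fun z => enorm (X - z) ^- m).
Proof. by apply: hmeasXV => [z|]; [exact: enorm_ge0|exact: hmeas_enorm]. Qed.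

Let hmeas_half h X : hmeas (fun z => Num.sqrt (lifted_norm h (X - z)) *
  lifted_norm h (X - z) ^- n).
Proof.
apply: hmeasM; first by apply: hmeas_sqrt; exact: hmeas_lifted_norm.
by apply: hmeasXV => [z|]; [exact: sqrtr_ge0|exact: hmeas_lifted_norm].
Qed.

(** The regularized potential at an arbitrary point, possibly on [E], against
    the potential at a nearby point off [E].  Near [E] the half-power modulus is
    used, far away the cancellation in the Taylor expansion. *)
Lemma layer_potential_compare (c1 : R) : 0 < c1 -> exists2 A : R, 0 <= A &
  forall t eps y X X' Xs rho, 0 < t -> 0 < eps -> eps <= 1 ->
  enorm (X - y) <= t -> enorm (X' - y) <= 2 * t -> enorm (Xs - y) <= t ->
  far_from (c1 * t) Xs -> 0 < rho -> far_from rho X' ->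
  enorm (X - X') <= 2 * eps * t ->
  `|layer_potential E Xs (eps * t) X - layer_potential E Xs 0 X'| <=
    A * Num.sqrt eps * t.
Proof.
move=> c10.
have [A1 A10 H1] := @kernel_profile_expansion R n.+1 n n1.
have [A2 A20 H2] := @kernel_grad_increment R n.+1 n.
pose N : R := n.+1%:R.
pose B1 := 64 * 4 ^+ n * C; pose B2 := 18 * N * K0 / c1.
pose B3 := 2 * A1 * K0; pose B4 := 6 * N * A2 * K0 / c1.
have N0 : 0 <= N by [].
have B10 : 0 <= B1 by rewrite !mulr_ge0 ?exprn_ge0 ?(ltW C0).
have B20 : 0 <= B2 
  by apply: divr_ge0; [apply: mulr_ge0; [rewrite mulr_ge0|exact: ltW]|exact: ltW].
have B30 : 0 <= B3 by apply: mulr_ge0; [rewrite mulr_ge0|exact: ltW].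
have B40 : 0 <= B4 
  by apply: divr_ge0; [apply: mulr_ge0; [rewrite !mulr_ge0|exact: ltW]|exact: ltW].
exists (B1 + B2 + (B3 + B4)); first by rewrite !addr_ge0.
move=> t eps y X X' Xs rho t0 eps0 eps1 Xy X'y Xsy Xsf rho0 X'f XX'.
have rs0 : 0 < c1 * t by rewrite mulr_gt0.
pose h := eps * t; have h0 : 0 < h by rewrite mulr_gt0.
have ht : h <= t by rewrite /h ler_piMl// ltW.
have XX'h : enorm (X - X') <= 2 * h by rewrite /h mulrA.
have aX : admissible (potential_kernel Xs h X).
  apply: (layer_potential_admissible n1 cE C0 upper rs0 Xsf (ltW h0) h0) => z _.
  exact: lifted_norm_ge_height.
have aX' : admissible (potential_kernel Xs 0 X').
  apply: (layer_potential_admissible n1 cE C0 upper rs0 Xsf (lexx 0) rho0) => z Ez.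
  by rewrite lifted_norm0; exact: X'f.
rewrite /layer_potential -hintB//.
have mk : hmeas (fun z => potential_kernel Xs h X z - potential_kernel Xs 0 X' z).
  by apply: hmeasB; exact: hmeas_potential_kernel.
have kE z : potential_kernel Xs h X z - potential_kernel Xs 0 X' z =
    phi n (lifted_norm h (X - z)) - phi n (enorm (X' - z)) -
    dotv (kernel_grad n (Xs - z)) (X - X').
  rewrite /potential_kernel lifted_norm0.
  have -> : dotv (kernel_grad n (Xs - z)) (X - X') =
    dotv (kernel_grad n (Xs - z)) (X - Xs) - dotv (kernel_grad n (Xs - z)) (X' - Xs).
    rewrite /dotv -sumrB; apply: eq_bigr => j _.
    by move: (kernel_grad _ _ _ _) => a; rewrite !mxE; ring.
  by ring.
have le_eps : eps <= Num.sqrt eps.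
  by rewrite -{1}[eps]sqr_sqrtr ?(ltW eps0)// expr2 ler_piMr ?sqrtr_ge0// -sqrtr1 ler_sqrt.
have ab z : `|lifted_norm h (X - z) - enorm (X' - z)| <= 3 * h.
  have l1 := lifted_norm_le (X - z) (ltW h0).
  have l2 := lifted_norm_ge h (X - z).
  have l3 := ler_enorm_dist X X' z; have l4 := ler_enorm_dist X' X z.
  by move: l4; rewrite [enorm (X' - X)]enorm_distC => l4; rewrite ler_norml; apply/andP; split; lra.
apply: (hint_bound cE mk).
pose D1 : set T := E `&` eball y (8 * t); pose D2 : set T := E `\` eball y (8 * t).
have mD1 : measurable D1 by exact: measurableI.
have mD2 : measurable D2 by exact: measurableD.
have D1E : D1 `<=` E by move=> z [].
have D2E : D2 `<=` E by move=> z [].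
have -> : (E : set T) = D1 `|` D2 by rewrite /D1 /D2 setUIDK.
have far_far (D : set T) (Y : V) r : measurable D -> D `<=` E -> 0 < r ->
    (forall z, D z -> r <= enorm (Y - z)) ->
    abs_integral_le mu D (fun z => enorm (Y - z) ^- n.+1) (K0 / r).
  move=> mD DE r0 Yf; rewrite /far_constant -mulrA.
  apply: (abs_integral_le_far C0 upper (X := Y)).
  - exact: mD.
  - exact: DE.
  - exact: enorm_hausdorff_measurable.
  - by move=> z; exact: enorm_ge0.
  - exact: r0.
  - by move=> z Dz; split => //; exact: Yf.
have hE : h / t = eps by rewrite /h mulfK// gt_eqF.
(* On the near part [D1], in a ball of radius comparable to [t], no cancellation is
   needed: three kernels are integrated one by one. *)
have near1 : abs_integral_le mu D1
    (fun z => potential_kernel Xs h X z - potential_kernel Xs 0 X' z)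
    ((B1 + B2) * Num.sqrt eps * t).
  pose ga z := Num.sqrt (lifted_norm h (X - z)) * lifted_norm h (X - z) ^- n.
  pose gb z := Num.sqrt (lifted_norm 0 (X' - z)) * lifted_norm 0 (X' - z) ^- n.
  pose gc z := enorm (Xs - z) ^- n.+1.
  pose k1 := 2 * Num.sqrt (3 * h); pose k2 := N * (9 * t * (2 * h)).
  have k10 : 0 <= k1 by rewrite mulr_ge0 ?sqrtr_ge0.
  have k20 : 0 <= k2.
    by apply: mulr_ge0 => //; apply: mulr_ge0; apply: mulr_ge0 => //; exact: ltW.
  have t16 : 0 < 16 * t by rewrite mulr_gt0.
  have s16 : Num.sqrt (16 * t) = 4 * Num.sqrt t.
    rewrite sqrtrM//; congr (_ * _).
    by rewrite (_ : 16 = 4 ^+ 2) ?sqrtr_sqr ?ger0_norm// expr2; ring.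
  have Ia : abs_integral_le mu D1 ga (2 * (4 ^+ n * C * (4 * Num.sqrt t))).
    rewrite -s16; apply: (abs_integral_le_near C0 upper (X := X) n1 mD1 D1E _ _ t16).
    - exact: hmeas_lifted_norm.
    - by move=> z; exact: sqrtr_ge0.
    - move=> z [Ez zy]; split.
      + exact: lt_le_trans h0 (lifted_norm_ge_height _ _).
      + apply: le_lt_trans (lifted_norm_le _ (ltW h0)) _.
        have := ler_enorm_dist X y z; move: zy; rewrite /eball/= [enorm (y - z)]enorm_distC; lra.
      + exact: lifted_norm_ge.
  have Ib : abs_integral_le mu D1 gb (2 * (4 ^+ n * C * (4 * Num.sqrt t))).
    rewrite -s16; apply: (abs_integral_le_near C0 upper (X := X') n1 mD1 D1E _ _ t16).
    - exact: hmeas_lifted_norm.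
    - by move=> z; exact: sqrtr_ge0.
    - move=> z [Ez zy]; rewrite lifted_norm0; split => //.
      + exact: far_from_gt0 X'f Ez.
      + have := ler_enorm_dist X' y z; move: zy; rewrite /eball/= [enorm (y - z)]enorm_distC; lra.
  have Ic : abs_integral_le mu D1 gc (K0 / (c1 * t)).
    by apply: far_far => // z [Ez _]; exact: Xsf.
  have mga : hmeas ga := hmeas_half h X.
  have mgb : hmeas gb := hmeas_half 0 X'.
  have mgc : hmeas gc := hmeas_enormXV Xs n.+1.
  have mk1 f k : hmeas f -> hmeas (fun z => k * f z).
    by move=> mf; apply: hmeasM => //; exact: hmeas_cst.
  have IA := abs_integral_leZ k1 mD1 mga Ia; have IB := abs_integral_leZ k1 mD1 mgb Ib.
  have IC := abs_integral_leZ k2 mD1 mgc Ic.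
  have IAB := abs_integral_leD mD1 (mk1 _ k1 mga) (mk1 _ k1 mgb) IA IB.
  have IABC := abs_integral_leD mD1 (hmeasD (mk1 _ k1 mga) (mk1 _ k1 mgb)) (mk1 _ k2 mgc) IAB IC.
  have k1le : k1 <= 4 * (Num.sqrt eps * Num.sqrt t).
    have : Num.sqrt (3 * h) <= Num.sqrt (4 * (eps * t)) by rewrite ler_sqrt -/h; lra.
    rewrite (sqrtrM (eps * t) (ler0n _ 4)) (sqrtrM t (ltW eps0)).
    rewrite (_ : 4 = 2 ^+ 2); last by rewrite expr2; ring.
    by rewrite sqrtr_sqr ger0_norm// /k1 => H; rewrite expr2; lra.
  apply: (@le_trans _ _ (`|k1| * (2 * (4 ^+ n * C * (4 * Num.sqrt t))) +
    `|k1| * (2 * (4 ^+ n * C * (4 * Num.sqrt t))) + `|k2| * (K0 / (c1 * t)))%:E); last first.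
    rewrite lee_fin !ger0_norm//.
    have -> : (B1 + B2) * Num.sqrt eps * t =
      B1 * Num.sqrt eps * t + B2 * Num.sqrt eps * t by ring.
    apply: lerD.
      have q0 : 0 <= 16 * (4 ^+ n * C * Num.sqrt t).
        by rewrite !mulr_ge0 ?exprn_ge0 ?sqrtr_ge0 ?(ltW C0).
      have := ler_wpM2r q0 k1le.
      have -> : 4 * (Num.sqrt eps * Num.sqrt t) * (16 * (4 ^+ n * C * Num.sqrt t)) =
          B1 * Num.sqrt eps * (Num.sqrt t * Num.sqrt t) by rewrite /B1; ring.
      by rewrite -expr2 sqr_sqrtr ?(ltW t0)//; lra.
    have -> : k2 * (K0 / (c1 * t)) = B2 * eps * t.
      by rewrite /k2 /B2 /h; field; rewrite !gt_eqF.
    by rewrite ler_wpM2r ?(ltW t0)// ler_wpM2l.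
  apply: (abs_integral_le_mono mD1 mk _ _ IABC).
    by apply: hmeasD; [apply: hmeasD|]; exact: mk1.
  move=> z [Ez zy]; rewrite kE [leRHS]ger0_norm; last first.
    by rewrite !addr_ge0// mulr_ge0// ?mulr_ge0// ?sqrtr_ge0// invr_ge0 exprn_ge0// ?sqrtr_ge0 ?enorm_ge0.
  apply: le_trans (ler_normB _ _) _; apply: lerD.
    rewrite -[phi n (enorm _)](_ : phi n (lifted_norm 0 (X' - z)) = _); last by rewrite lifted_norm0.
    have a0 : 0 < lifted_norm h (X - z) by exact: lt_le_trans h0 (lifted_norm_ge_height _ _).
    have b0 : 0 < lifted_norm 0 (X' - z) by rewrite lifted_norm0; exact: far_from_gt0 X'f Ez.
    apply: le_trans (kernel_profile_half_power n1 a0 b0) _.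
    rewrite -mulrDr; apply: ler_wpM2r.
      by rewrite addr_ge0// mulr_ge0 ?sqrtr_ge0// invr_ge0 exprn_ge0// sqrtr_ge0.
    by rewrite ler_wpM2l// ler_sqrt ?lifted_norm0// mulr_ge0// ltW.
  apply: le_trans (dotv_grad_le _ _ _) _; rewrite /k2 -mulrA ler_wpM2l//.
  have z0 := far_from_gt0 rs0 Xsf Ez.
  have -> : enorm (Xs - z) ^- n = enorm (Xs - z) * gc z.
    by rewrite /gc -[X in X * _]expr1 (@exprVD_cancel _ 1 n).
  rewrite mulrAC; apply: ler_wpM2r.
    by rewrite invr_ge0 exprn_ge0 ?enorm_ge0.
  apply: ler_pM; rewrite ?enorm_ge0//.
  by have := ler_enorm_dist Xs y z; move: zy; rewrite /eball/= [enorm (y - z)]enorm_distC; lra.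
(* On the far part [D2] there are two cancellations: to first order between [X'] and
   [X], and between the gradients at [Xs] and at [X']. *)
have far1 : abs_integral_le mu D2
    (fun z => potential_kernel Xs h X z - potential_kernel Xs 0 X' z)
    ((B3 + B4) * Num.sqrt eps * t).
  pose gb z := enorm (X' - z) ^- n.+1.
  pose gc z := enorm (Xs - z) ^- n.+1.
  pose k1 := A1 * (3 * h) ^+ 2; pose k2 := N * (A2 * (3 * t) * (2 * h)).
  have k10 : 0 <= k1 by rewrite mulr_ge0 ?sqr_ge0.
  have k20 : 0 <= k2.
    apply: mulr_ge0 => //; apply: mulr_ge0; apply: mulr_ge0 => //; last exact: ltW.
    by apply: mulr_ge0 => //; exact: ltW.
  have t6 : 0 < 6 * t by rewrite mulr_gt0.
  have far_y z : D2 z -> 8 * t <= enorm (y - z).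
    by move=> [_ /negP]; rewrite /eball/= -leNgt enorm_distC.
  have X'6 z : D2 z -> 6 * t <= enorm (X' - z).
    move=> /far_y zy; have := ler_enorm_dist y X' z.
    by rewrite [enorm (y - X')]enorm_distC; lra.
  have Xs7 z : D2 z -> 7 * t <= enorm (Xs - z).
    move=> /far_y zy; have := ler_enorm_dist y Xs z.
    by rewrite [enorm (y - Xs)]enorm_distC; lra.
  have Ib := far_far _ _ _ mD2 D2E t6 X'6.
  have Ic : abs_integral_le mu D2 gc (K0 / (c1 * t)).
    by apply: far_far => // z [Ez _]; exact: Xsf.
  have mgb : hmeas gb := hmeas_enormXV X' n.+1.
  have mgc : hmeas gc := hmeas_enormXV Xs n.+1.
  have mk1 f k : hmeas f -> hmeas (fun z => k * f z).
    by move=> mf; apply: hmeasM => //; exact: hmeas_cst.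
  have IB := abs_integral_leZ k1 mD2 mgb Ib.
  have IC := abs_integral_leZ k2 mD2 mgc Ic.
  have IBC := abs_integral_leD mD2 (mk1 _ k1 mgb) (mk1 _ k2 mgc) IB IC.
  apply: (@le_trans _ _ (`|k1| * (K0 / (6 * t)) + `|k2| * (K0 / (c1 * t)))%:E); last first.
    rewrite lee_fin !ger0_norm//.
    have -> : (B3 + B4) * Num.sqrt eps * t =
      B3 * Num.sqrt eps * t + B4 * Num.sqrt eps * t by ring.
    apply: lerD.
      have -> : k1 * (K0 / (6 * t)) = 3 / 2 * A1 * K0 * eps * (eps * t).
        by rewrite /k1 /h; field; rewrite gt_eqF.
      have AK0 : 0 <= A1 * K0 by apply: mulr_ge0 => //; exact: ltW.
      have Q0 : 0 <= A1 * K0 * (eps * t) by apply: mulr_ge0 => //; exact: ltW.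
      have := ler_wpM2l Q0 eps1.
      have Q1 : 0 <= A1 * K0 * t by apply: mulr_ge0 => //; exact: ltW.
      have := ler_wpM2l Q1 le_eps.
      by rewrite /B3; lra.
    have -> : k2 * (K0 / (c1 * t)) = B4 * eps * t.
      by rewrite /k2 /B4 /h; field; rewrite !gt_eqF.
    by rewrite ler_wpM2r ?(ltW t0)// ler_wpM2l.
  apply: (abs_integral_le_mono mD2 mk _ _ IBC).
    by apply: hmeasD; exact: mk1.
  move=> z D2z; have [Ez _] := D2z.
  have z6 := X'6 _ D2z; have z7 := Xs7 _ D2z.
  have gb0 : 0 <= gb z by rewrite invr_ge0 exprn_ge0 ?enorm_ge0.
  have gc0 : 0 <= gc z by rewrite invr_ge0 exprn_ge0 ?enorm_ge0.
  rewrite kE [leRHS]ger0_norm; last by apply: addr_ge0; apply: mulr_ge0.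
  have -> : phi n (lifted_norm h (X - z)) - phi n (enorm (X' - z)) -
      dotv (kernel_grad n (Xs - z)) (X - X') =
    (phi n (lifted_norm h ((X' - z) + (X - X'))) - phi n (enorm (X' - z)) -
      dotv (kernel_grad n (X' - z)) (X - X')) +
    \sum_i (kernel_grad n ((Xs - z) + (X' - Xs)) 0 i - kernel_grad n (Xs - z) 0 i) *
      (X - X') 0 i.
    have -> : (X' - z) + (X - X') = X - z by rewrite [LHS]addrC addrA subrK.
    have -> : (Xs - z) + (X' - Xs) = X' - z by rewrite [LHS]addrC addrA subrK.
    rewrite [\sum_i _](_ : _ = dotv (kernel_grad n (X' - z)) (X - X') -
      dotv (kernel_grad n (Xs - z)) (X - X')); first by ring.
    by rewrite /dotv -sumrB; apply: eq_bigr => i _; rewrite mulrBl.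
  apply: le_trans (ler_normD _ _) _; apply: lerD.
    have X'z0 : 0 < enorm (X' - z) by lra.
    have eX : enorm (X - X') + h <= enorm (X' - z) / 2 by lra.
    apply: le_trans (H1 _ _ _ X'z0 (ltW h0) eX) _.
    rewrite ler_wpM2r// ler_wpM2l//.
    have e0 : 0 <= enorm (X - X') + h by apply: addr_ge0; [exact: enorm_ge0|exact: ltW].
    have e3 : enorm (X - X') + h <= 3 * h by lra.
    by rewrite ler_sqr ?nnegrE ?(le_trans e0 e3).
  have Xsz0 : 0 < enorm (Xs - z) by lra.
  have X'Xs : enorm (X' - Xs) <= 3 * t.
    by have := ler_enorm_dist X' y Xs; rewrite [enorm (y - Xs)]enorm_distC; lra.
  have eXs : enorm (X' - Xs) <= enorm (Xs - z) / 2 by lra.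
  apply: le_trans (ler_norm_sum _ _ _) _.
  apply: (@le_trans _ _ (\sum_(i < n.+1) A2 * (3 * t) * (2 * h) * gc z)).
    apply: ler_sum => i _; rewrite normrM.
    have := H2 _ _ i Xsz0 eXs => g1.
    have {}g1 : `|kernel_grad n (Xs - z + (X' - Xs)) 0 i - kernel_grad n (Xs - z) 0 i| <=
        A2 * (3 * t) * gc z.
      by apply: le_trans g1 _; rewrite ler_wpM2r// ler_wpM2l.
    have g2 : `|(X - X') 0 i| <= 2 * h by apply: le_trans XX'h; exact: enorm_coord.
    by apply: le_trans (ler_pM (normr_ge0 _) (normr_ge0 _) g1 g2) _; rewrite mulrAC.
  by rewrite sumr_const card_ord -[leLHS]mulr_natl /k2 mulrA.
have -> : (B1 + B2 + (B3 + B4)) * Num.sqrt eps * t =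
  (B1 + B2) * Num.sqrt eps * t + (B3 + B4) * Num.sqrt eps * t by ring.
exact: (abs_integral_leU mD1 mD2 mk near1 far1).
Qed.

End potential_estimates.

(** * The maximum principle and the oscillation of the potential *)

Section maximum_principle.
Context {R : realType} (n : nat) (E : set 'rV[R]_n.+1) (C : R).
Local Notation V := 'rV[R]_n.+1.
Local Notation T := (caratheodory_type (@hausdorff_outer R n.+1 n)).
Local Notation phi := (@kernel_profile R).
Local Notation far_from := (far_from E).
Local Notation admissible := (admissible n E).
Local Notation hint := (hint n E).
Local Notation hmeas := (@hmeas R n.+1 n).
Implicit Types (X y : V).
Hypothesis n1 : (1 <= n)%N.
Hypothesis cE : closed E.
Hypothesis C0 : 0 < C.
Hypothesis upper : forall X r, 0 < r ->
  (hausdorff n (E `&` eball X r) <= (C * r ^+ n)%:E)%E.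

(** A small multiple of [enorm (X - y) ^+ 2] makes the sums of second differences
    positive; then the supremum over the ball is not nearly attained in the inner
    half, from where steps of length [s] stay in the ball. *)
Lemma discrete_maximum_principle (w : V -> R) y t s B e :
  0 < s -> s <= t / 2 -> 0 < e ->
  (forall X, enorm (X - y) <= t -> w X <= B) ->
  (forall X, 0 <= \sum_(i < n.+1)
     (w (X + s *: delta_mx 0 i) + w (X - s *: delta_mx 0 i) - 2 * w X)) ->
  exists X, [/\ enorm (X - y) <= t, t / 2 < enorm (X - y) & w y - e <= w X].
Proof.
move=> s0 st e0 wB lap; have t0 : 0 < t by lra.
pose k := e / (2 * t ^+ 2).
have t20 : 0 < t ^+ 2 by rewrite exprn_gt0.
have k0 : 0 < k by rewrite divr_gt0// mulr_gt0.
have kt : k * (2 * t ^+ 2) = e by rewrite /k divfK// gt_eqF// mulr_gt0.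
pose v X := w X + k * enorm (X - y) ^+ 2.
pose S := [set v X | X in [set X | enorm (X - y) <= t]].
have S_y : S (v y) by exists y => //=; rewrite subrr enorm0 ltW.
have supS : has_sup S.
  split; first by exists (v y).
  exists (B + k * t ^+ 2) => _ [X /= Xt <-]; apply: lerD; first exact: wB.
  by rewrite ler_pM2l// ler_sqr ?nnegrE ?enorm_ge0// ltW.
have ks0 : 0 < k * s ^+ 2 by rewrite mulr_gt0// exprn_gt0.
have [_ [X /= Xt <-] vX] := sup_adherent ks0 supS.
have vS Z : enorm (Z - y) <= t -> v Z <= sup S.
  by move=> Zt; apply: sup_ubound => //; [case: supS|exists Z].
have vy := vS y; rewrite subrr enorm0 in vy; have {}vy := vy (ltW t0).
have vyE : v y = w y by rewrite /v subrr enorm0 expr0n mulr0 addr0.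
have st2 : s ^+ 2 <= t ^+ 2 by rewrite ler_sqr ?nnegrE ?(ltW s0) ?(ltW t0)//; lra.
have kst : k * s ^+ 2 <= k * t ^+ 2 by rewrite ler_pM2l.
have [tX|Xt2] := ltP (t / 2) (enorm (X - y)).
  exists X; split => //.
  have kX : k * enorm (X - y) ^+ 2 <= k * t ^+ 2.
    by rewrite ler_pM2l// ler_sqr ?nnegrE ?enorm_ge0// ltW.
  have : v X = w X + k * enorm (X - y) ^+ 2 by [].
  lra.
have step i (sg : R) : `|sg| = 1 ->
    v (X + (sg * s) *: delta_mx 0 i) <= sup S.
  move=> sg1; apply: vS.
  rewrite addrAC; apply: le_trans (ler_enormD _ _) _.
  rewrite enormZ enorm_delta mulr1 normrM sg1 mul1r ger0_norm; lra.
have stepP i : v (X + s *: delta_mx 0 i) <= sup S.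
  by have := step i 1 (normr1 _); rewrite mul1r.
have stepM i : v (X - s *: delta_mx 0 i) <= sup S.
  by have := step i (-1) (normrN1 _); rewrite mulN1r scaleNr.
have vlap : \sum_(i < n.+1)
     (v (X + s *: delta_mx 0 i) + v (X - s *: delta_mx 0 i) - 2 * v X) =
  \sum_(i < n.+1)
     (w (X + s *: delta_mx 0 i) + w (X - s *: delta_mx 0 i) - 2 * w X) +
  \sum_(i < n.+1) (2 * (k * s ^+ 2)).
  rewrite -big_split/=; apply: eq_bigr => i _; rewrite /v.
  rewrite [X + _ - y]addrAC [X - _ - y]addrAC; move: (X - y) => Y.
  rewrite !sqr_enormD dotvNr enormN !dotvZr dotv_delta.
  rewrite enormZ enorm_delta mulr1 real_normK ?num_real//; ring.
have up : \sum_(i < n.+1)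
     (v (X + s *: delta_mx 0 i) + v (X - s *: delta_mx 0 i) - 2 * v X) <
  \sum_(i < n.+1) (2 * (k * s ^+ 2)).
  apply: ltr_sum => [|i _]; first by apply/hasP; exists ord0; rewrite ?mem_index_enum.
  by have := stepP i; have := stepM i; lra.
by have := lap X; move: up; rewrite vlap; lra.
Qed.

(** The mass of [E] near [y] forces the potential to oscillate.  Subtracting the
    potential of that mass leaves a subharmonic function, which by the maximum
    principle is no larger at [y] than somewhere in the outer half of the ball,
    whereas the subtracted potential is definitely larger there than at [y]. *)
Lemma layer_potential_oscillation (cL : R) t h y Xs rs M : 0 < cL ->
  0 < h -> h <= t / 8 -> 0 < rs -> far_from rs Xs ->
  ((cL * (t / 8) ^+ n)%:E <= hausdorff n (E `&` eball y (t / 8)))%E ->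
  (forall X, enorm (X - y) <= t -> `|layer_potential E Xs h X| <= M) ->
  cL * 8 ^- n.+1 / 4 * t <= M.
Proof.
move=> cL0 h0 ht rs0 Xsf lower UM; have t0 : 0 < t by lra.
pose B := eball y (t / 8).
have mB : measurable (B : set T) by exact/open_hausdorff_measurable/open_eball.
have [m hm] : exists m : R, hausdorff n (E `&` B) = m%:E.
  have t80 : 0 < t / 8 by lra.
  exists (fine (hausdorff n (E `&` B))); rewrite fineK// ge0_fin_numE.
    exact: le_lt_trans (upper y t80) (ltry _).
  exact: (outer_measure_ge0 (@hausdorff R n.+1 n)).
have cLm : cL * (t / 8) ^+ n <= m by rewrite -lee_fin -hm.
have m0 : 0 <= m by apply: le_trans cLm; rewrite mulr_ge0 ?exprn_ge0 ?(ltW cL0)//; lra.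
have [aB hB] := hint_indic cE mB hm.
have lift0 Y : 0 < lifted_norm h Y := lt_le_trans h0 (lifted_norm_ge_height h Y).
pose pk X z := \1_B z * phi n (lifted_norm h (X - z)).
have mpk X : hmeas (pk X).
  by apply: hmeasM; [exact: hmeas_indic|exact: hmeas_profile].
have apk X : admissible (pk X).
  pose b := enorm (X - y) + t / 8 + h.
  apply: (anchored_admissible cE C0 upper rs0 Xsf (B := `|phi n h| + `|phi n b|)
    (L := enorm (Xs - y) + t / 8) (A := 0) (mpk X)) => //.
  - move=> z Ez _; rewrite /pk indicE; have [zB|] := boolP (z \in B); last first.
      by rewrite mul0r normr0 addr_ge0.
    rewrite mul1r; move: zB; rewrite inE /B /eball/= => zB.
    have l1 := ler_kernel_profile n1 h0 (lifted_norm_ge_height h (X - z)).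
    have l2 : phi n (lifted_norm h (X - z)) <= phi n b.
      apply: (ler_kernel_profile n1) => //; apply: le_trans (lifted_norm_le _ (ltW h0)) _.
      rewrite /b lerD2r; have := ler_enorm_dist X y z; rewrite [enorm (y - z)]enorm_distC; lra.
    have := ler_norm (phi n b); have := ler_norm (- phi n h); rewrite normrN => h1 h2.
    have := normr_ge0 (phi n h); have := normr_ge0 (phi n b) => h5 h6.
    by rewrite ler_norml; apply/andP; split; lra.
  - move=> z Ez zL; rewrite mul0r /pk indicE memNset ?mul0r ?normr0//.
    rewrite /B /eball/= => zB; have := ler_enorm_dist Xs y z.
    by rewrite [enorm (y - z)]enorm_distC; lra.
have aU X : admissible (potential_kernel Xs h X).
  apply: (layer_potential_admissible n1 cE C0 upper rs0 Xsf (ltW h0) h0) => z _.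
  exact: lifted_norm_ge_height.
pose wk X z := potential_kernel Xs h X z - pk X z.
have awk X : admissible (wk X) := admissibleB cE (aU X) (apk X).
pose w X := hint (wk X).
have wE X : w X = layer_potential E Xs h X - hint (pk X) 
  by rewrite /w (hintB cE (aU X) (apk X)).
have [c c0 lap_kernel] := @regularized_kernel_second_difference R n.+1 n erefl n1.
pose s := Num.min (c * h) (t / 2).
have s0 : 0 < s by rewrite /s lt_min mulr_gt0//=; lra.
have sch : s <= c * h by rewrite /s ge_min lexx.
have st : s <= t / 2 by rewrite /s ge_min lexx orbT.
have lap X : 0 <= \sum_(i < n.+1)
     (w (X + s *: delta_mx 0 i) + w (X - s *: delta_mx 0 i) - 2 * w X).
  pose F (i : 'I_n.+1) z := wk (X + s *: delta_mx 0 i) z + wk (X - s *: delta_mx 0 i) z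
     - 2 * wk X z.
  have a2 : admissible (fun z => 2 * wk X z) by exact: (admissibleZ cE 2 (awk X)).
  have a1 i : admissible (fun z => wk (X + s *: delta_mx 0 i) z +
      wk (X - s *: delta_mx 0 i) z) by exact: (admissibleD cE (awk _) (awk _)).
  have aF i : admissible (F i) := admissibleB cE (a1 i) a2.
  have -> : \sum_(i < n.+1)
     (w (X + s *: delta_mx 0 i) + w (X - s *: delta_mx 0 i) - 2 * w X) =
     hint (fun z => \sum_i F i z).
    rewrite hint_sum//; apply: eq_bigr => i _.
    by rewrite /F (hintB cE (a1 i) a2) (hintD cE (awk _) (awk _)) (hintZ cE _ (awk X)).
  apply: hint_ge0 => z Ez.
  have -> : \sum_i F i z = (1 - \1_B z) * \sum_(i < n.+1)
    (phi n (lifted_norm h ((X - z) + s *: delta_mx 0 i)) +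
     phi n (lifted_norm h ((X - z) - s *: delta_mx 0 i)) -
     2 * phi n (lifted_norm h (X - z))).
    rewrite mulr_sumr; apply: eq_bigr => i _; rewrite /F /wk /pk /potential_kernel.
    rewrite [X + _ - z]addrAC [X - _ - z]addrAC.
    have -> : dotv (kernel_grad n (Xs - z)) (X + s *: delta_mx 0 i - Xs) =
       dotv (kernel_grad n (Xs - z)) (X - Xs) + s * kernel_grad n (Xs - z) 0 i.
      rewrite -(dotv_delta (kernel_grad n (Xs - z)) i) -dotvZr /dotv -big_split/=.
      by apply: eq_bigr => j _; rewrite -mulrDr; congr (_ * _); rewrite !mxE; ring.
    have -> : dotv (kernel_grad n (Xs - z)) (X - s *: delta_mx 0 i - Xs) =
       dotv (kernel_grad n (Xs - z)) (X - Xs) - s * kernel_grad n (Xs - z) 0 i.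
      rewrite -(dotv_delta (kernel_grad n (Xs - z)) i) -dotvZr /dotv -sumrB.
      by apply: eq_bigr => j _; rewrite -mulrBr; congr (_ * _); rewrite !mxE; ring.
    by ring.
  apply: mulr_ge0; last exact: lap_kernel.
  by rewrite subr_ge0 indicE; case: (z \in B).
have pk_lower X : phi n h * m <= hint (pk X).
  rewrite -hB -(hintZ cE _ aB); apply: (hint_le cE (admissibleZ cE _ aB) (apk X)).
  move=> z Ez; rewrite /pk [leRHS]mulrC ler_wpM2r//.
  by apply: (ler_kernel_profile n1) => //; exact: lifted_norm_ge_height.
have wB X : enorm (X - y) <= t -> w X <= M - phi n h * m.
  move=> Xt; rewrite wE; have := UM X Xt; rewrite ler_norml => /andP[_ ?].
  by apply: lerB.
(* The gain of the profile from radius [t / 4] to radius [3 * t / 8], on which its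
   derivative is at least [t ^- n]. *)
pose g := t ^- n * (t / 8).
have g0 : 0 <= g by rewrite mulr_ge0 ?invr_ge0 ?exprn_ge0 ?(ltW t0)//; lra.
have pX X : t / 2 < enorm (X - y) -> g * m <= hint (pk X) - hint (pk y).
  move=> tX.
  rewrite -(hintB cE (apk X) (apk y)) -hB -(hintZ cE g aB).
  apply: (hint_le cE (admissibleZ cE g aB) (admissibleB cE (apk X) (apk y))).
  move=> z Ez; rewrite /pk -mulrBr [leLHS]mulrC indicE.
  have [zB|] := boolP (z \in B); last by rewrite !mul0r.
  rewrite !mul1r; move: zB; rewrite inE /B /eball/= => zB.
  have a0 : 0 < t / 4 by lra.
  have ab : t / 4 <= 3 * t / 8 by lra.
  have l1 : phi n (lifted_norm h (y - z)) <= phi n (t / 4).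
    apply: (ler_kernel_profile n1) => //; apply: le_trans (lifted_norm_le _ (ltW h0)) _.
    by rewrite enorm_distC; lra.
  have l2 : phi n (3 * t / 8) <= phi n (lifted_norm h (X - z)).
    apply: (ler_kernel_profile n1); first by lra.
    apply: le_trans (lifted_norm_ge _ _).
    by have := ler_enorm_dist X z y; lra.
  have l3 := kernel_profile_increase_ge n1 a0 ab.
  have l4 : g <= (3 * t / 8) ^- n * (3 * t / 8 - t / 4).
    rewrite /g (_ : 3 * t / 8 - t / 4 = t / 8); last by field.
    rewrite ler_wpM2r//; first by lra.
    by apply: ler_exprV; lra.
  lra.
have gm : cL * 8 ^- n.+1 * t <= g * m.
  apply: le_trans (ler_wpM2l g0 cLm).
  rewrite /g exprMn exprVn exprS invfM le_eqVlt; apply/orP; left; apply/eqP.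
  by field; rewrite !expf_neq0// gt_eqF.
have gm0 : 0 < cL * 8 ^- n.+1 * t.
  by rewrite !mulr_gt0// invr_gt0 exprn_gt0.
have e0 : 0 < cL * 8 ^- n.+1 * t / 2 by lra.
have [X [Xt tX wX]] := discrete_maximum_principle s0 st e0 wB lap.
have := wX; rewrite !wE.
have := UM X Xt; have := UM y; rewrite subrr enorm0 => /(_ (ltW t0)).
rewrite !ler_norml => /andP[u1 u2] /andP[u3 u4] H.
move: gm (pX X tX) H u1 u2 u3 u4.
move: (cL * 8 ^- n.+1) (hint _) (hint _) (layer_potential _ _ _ _) (layer_potential _ _ _ _).
by clear -t0 => k p1 p2 U1 U2; lra.
Qed.

End maximum_principle.

(** * Volume integrals and cubes *)

Section volume_of_cubes.
Context {R : realType}.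
Local Notation TR := (measurableTypeR R).
Local Open Scope ereal_scope.

(** The integral of a nonnegative function is the supremum of the integrals of the
    simple functions below it, whence the monotonicity even for a [g] that is not
    known to be measurable. *)
Lemma le_integral_ge0 d (T : measurableType d) (mu : {measure set T -> \bar R})
    (f g : T -> \bar R) : (forall x, 0 <= f x) -> (forall x, f x <= g x) ->
  \int[mu]_x f x <= \int[mu]_x g x.
Proof.
move=> f0 fg; have g0 x : 0 <= g x := le_trans (f0 x) (fg x).
rewrite !ge0_integralTE//; apply: ge_ereal_sup => _ [h hf <-].
by apply: ereal_sup_ubound; exists h => // x; exact: le_trans (hf x) (fg x).
Qed.

Definition cube d (c : 'I_d -> R) (a : R) : set (d.-tuple TR) :=
  [set t | forall i, (`|tnth t i - c i| < a)%R].

Lemma measurable_cube d (c : 'I_d -> R) a : measurable (cube c a).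
Proof.
rewrite (_ : cube c a = \bigcap_(i in [set: 'I_d])
    ((fun t : d.-tuple TR => tnth t i) @^-1` `](c i - a)%R, (c i + a)%R[%classic)).
  apply: fin_bigcap_measurable; first exact: finite_finset.
  move=> i _; rewrite -[X in measurable X]setTI.
  by apply: (measurable_tnth i) => //; exact: measurable_itv.
apply/seteqP; split => [t tc i _|t tc i].
  by have := tc i; rewrite /= in_itv/= ltr_distl.
by have := tc i I; rewrite /= in_itv/= ltr_distl.
Qed.

Lemma lebesgue_cube d (c : 'I_d -> R) a : (0 < a)%R ->
  lebesgue_tuple d (cube c a) = ((2 * a) ^+ d)%:E.
Proof.
move=> a0; elim: d c => [|d IH] c.
  rewrite /lebesgue_tuple/= expr0 diracE mem_set// => i; by case: i.
rewrite /lebesgue_tuple/= -/(lebesgue_tuple d) /cons_measure /pushforward.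
pose c' i := c (lift ord0 i).
have -> : @tcons _ _ d @^-1` cube c a =
    (`](c ord0 - a)%R, (c ord0 + a)%R[%classic : set TR) `*` cube c' a.
  apply/seteqP; split => [[x t] /= xt|[x t] [/= x0 t0] i].
    split => [|i]; first by have := xt ord0; rewrite tnth0 /= in_itv/= ltr_distl.
    by have := xt (lift ord0 i); rewrite tnthS.
  case: (unliftP ord0 i) => [j ->|->]; first by rewrite tnthS; exact: t0.
  by rewrite tnth0; move: x0; rewrite in_itv/= ltr_distl.
rewrite product_measure1E; [|exact: measurable_itv|exact: measurable_cube].
have e : lebesgue_measure (`](c ord0 - a)%R, (c ord0 + a)%R[%classic : set R) = (2 * a)%:E.
  rewrite lebesgue_measure_itv/= lte_fin ifT; last by lra.
  by rewrite -EFinB; congr EFin; ring.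
by rewrite IH [X in X * _]e -EFinM exprS.
Qed.

(** Cubes rather than balls, because their Lebesgue measure is a product. *)
Lemma integral_dX_ge_cubes d (A : set 'rV[R]_d) (f : 'rV[R]_d -> \bar R) (I : eqType)
    (s : seq I) (c : I -> 'rV[R]_d) (a v : I -> R) :
  (forall X, 0 <= f X) ->
  (forall k, k \in s -> 0 < a k)%R -> (forall k, 0 <= v k)%R ->
  (forall k (X : 'rV[R]_d), k \in s -> (forall i, (`|X 0%R i - c k 0%R i| < a k)%R) ->
     A X /\ (v k)%:E <= f X) ->
  pairwise (fun k l => `[< forall X : 'rV[R]_d,
     (forall i, (`|X 0%R i - c k 0%R i| < a k)%R) ->
     (forall i, (`|X 0%R i - c l 0%R i| < a l)%R) -> False >]) s ->
  (\sum_(k <- s) v k * (2 * a k) ^+ d)%:E <= integral_dX A f.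
Proof.
move=> f0 a0 v0 hf sdisj; rewrite /integral_dX integral_mkcond.
pose Q k := @cube d (fun i => c k 0%R i) (a k).
have -> : (\sum_(k <- s) v k * (2 * a k) ^+ d)%:E =
    \int[@lebesgue_tuple R d]_t (\sum_(k <- s) (v k * \1_(Q k) t)%:E).
  rewrite ge0_integral_sum//; last 2 first.
  - move=> k; apply/measurable_EFinP; apply: measurable_funM => //.
    by apply: measurable_indic; exact: measurable_cube.
  - by move=> k t _; rewrite lee_fin mulr_ge0.
  rewrite -sumEFin big_seq [RHS]big_seq; apply: eq_bigr => k ks.
  under eq_integral do rewrite EFinM.
  rewrite ge0_integralZl//; last 2 first.
  - by apply/measurable_EFinP; apply: measurable_indic; exact: measurable_cube.
  - by rewrite lee_fin.
  rewrite integral_indic//; last exact: measurable_cube.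
  have e := @lebesgue_cube d (fun i => c k 0%R i) _ (a0 k ks).
  by rewrite setIT [X in _ * X]e -EFinM.
apply: le_integral_ge0 => t.
  by apply: sume_ge0 => k _; rewrite lee_fin mulr_ge0.
have QX k : Q k t -> forall i, (`|vec_of_tuple t 0%R i - c k 0%R i| < a k)%R.
  by move=> Qt i; rewrite mxE; exact: Qt.
have h0 : 0 <= ((f \o (@vec_of_tuple R d)) \_ (@vec_of_tuple R d @^-1` A)) t.
  by rewrite patchE; case: ifP => // _; exact: f0.
have hQ k : k \in s -> Q k t ->
    (v k)%:E <= ((f \o (@vec_of_tuple R d)) \_ (@vec_of_tuple R d @^-1` A)) t.
  move=> ks /QX kt; have [At vt] := hf _ _ ks kt.
  by rewrite patchE mem_set.
move: ((_ \_ _) t) h0 hQ => F F0.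
elim: s sdisj {a0 v0 hf} => [_ _|k s IH]; first by rewrite big_nil.
rewrite pairwise_cons => /andP[/allP ks sdisj] hQ; rewrite big_cons.
have [kt|kt] := pselect (Q k t).
  rewrite big_seq big1 ?adde0 => [|l ls].
    by rewrite indicE mem_set// mulr1; apply: hQ => //; rewrite mem_head.
  rewrite indicE memNset ?mulr0// => /QX lt_.
  by have /asboolP/(_ (vec_of_tuple t)) := ks _ ls; apply => //; exact: QX.
rewrite indicE memNset// mulr0 add0e; apply: IH => // l ls.
by apply: hQ; rewrite inE ls orbT.
Qed.

End volume_of_cubes.

(** * A scale at which the Hessian is small *)

Section good_scale.
Context {R : realType} (n : nat) (E : set 'rV[R]_n.+1) (C cL CU : R).
Local Notation V := 'rV[R]_n.+1.
Local Notation far_from := (far_from E).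
Implicit Types (X y x : V).
Hypothesis n1 : (1 <= n)%N.
Hypothesis cE : closed E.
Hypothesis C0 : 0 < C.
Hypothesis upper : forall X r, 0 < r ->
  (hausdorff n (E `&` eball X r) <= (C * r ^+ n)%:E)%E.
Hypothesis cL0 : 0 < cL.
Hypothesis lower : forall x r, E x -> 0 < r -> (r%:E < ediam E)%E ->
  ((cL * r ^+ n)%:E <= hausdorff n (E `&` eball x r))%E.

Definition carleson_density X : \bar R :=
  ((frobenius_sq (hessian_single_layer1 E X))%:E * point_dist X E)%E.

Hypothesis carleson : forall x r, E x -> 0 < r -> (r%:E <= ediam E)%E ->
  (integral_dX (eball x r) carleson_density <= (CU * r ^+ n)%:E)%E.

Lemma point_dist_ge0 X : (0 <= point_dist X E)%E.
Proof. by apply: le_ereal_inf_tmp => _ [z _ <-]; rewrite lee_fin enorm_ge0. Qed.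

Lemma point_dist_far rho X : far_from rho X -> (rho%:E <= point_dist X E)%E.
Proof. by move=> Xf; apply: le_ereal_inf_tmp => _ [z Ez <-]; rewrite lee_fin Xf. Qed.

Lemma hessian_single_layer1E rho X i j : 0 < rho -> far_from rho X ->
  hessian_single_layer1 E X i j = fundamental_constant n * layer_hessian E X i j.
Proof.
move=> rho0 Xf; rewrite mxE.
rewrite -(hintZ cE _ (layer_hessian_admissible cE C0 upper i j rho0 Xf)).
apply: eq_hint => z Ez; rewrite hessian_fundamental_solution//.
exact: far_from_gt0 Xf Ez.
Qed.

Lemma carleson_density_ge0 X : (0 <= carleson_density X)%E.
Proof.
apply: mule_ge0; last exact: point_dist_ge0.
by rewrite lee_fin; do 2 (apply: sumr_ge0 => ? _); exact: sqr_ge0.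
Qed.

Definition bad_point kappa K t X : Prop :=
  far_from (t / K) X /\ exists i j, kappa / t <= `|layer_hessian E X i j|.

(** By the Lipschitz estimate for the Hessian, a bad point carries a definite
    amount of the Carleson measure in a cube of comparable size. *)
Lemma bad_point_density kappa K : 0 < kappa -> 1 <= K ->
  exists a v : R, [/\ 0 < a, 0 < v & forall t X X', 0 < t -> bad_point kappa K t X ->
    (forall i, `|X' 0 i - X 0 i| < a * t) ->
    [/\ enorm (X' - X) <= t / (2 * K), far_from (t / (2 * K)) X' &
      ((v / t)%:E <= carleson_density X')%E] ].
Proof.
move=> kappa0 K1; have K0 : 0 < K by lra.
have [A A0 H] := @layer_hessian_increment R n E C cE C0 upper.
pose N : R := n.+1%:R; have N0 : 0 < N by [].
pose S := 2 * K + 2 * A * K ^+ 2 / kappa.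
have S1 : 0 <= 2 * A * K ^+ 2 / kappa by rewrite divr_ge0 ?mulr_ge0 ?(ltW K0) ?(ltW kappa0).
have S0 : 0 < S by rewrite /S; lra.
pose a := (N * S)^-1; have a0 : 0 < a by rewrite invr_gt0 mulr_gt0.
have Na : N * a = S^-1 by rewrite /a invfM mulrA divff ?mul1r// gt_eqF.
have c0 := @fundamental_constant_gt0 R n.
pose c : R := fundamental_constant n.
pose v := (c * (kappa / 2)) ^+ 2 / (2 * K).
have v0 : 0 < v by rewrite divr_gt0 ?exprn_gt0 ?mulr_gt0 ?divr_gt0.
exists a, v; split => // t X X' t0 [Xf [i [j bad]]] XX'.
have at0 : 0 <= a * t by rewrite mulr_ge0 ?ltW.
have X'X : enorm (X' - X) <= S^-1 * t.
  rewrite -Na -mulrA; apply: enorm_le_coord => // k; rewrite !mxE; exact: ltW.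
have tK0 : 0 < t / K by rewrite divr_gt0.
have dX : enorm (X' - X) <= t / (2 * K).
  apply: le_trans X'X _; rewrite mulrC ler_pM2l// lef_pV2 ?posrE ?mulr_gt0//.
  by rewrite /S; lra.
have dX2 : enorm (X' - X) <= t / K / 2 by rewrite -mulrA -invfM [K * 2]mulrC.
have X'f : far_from (t / (2 * K)) X'.
  have := far_from_half Xf dX2; by rewrite -mulrA -invfM [K * 2]mulrC.
split => //.
have h := H _ _ _ i j tK0 Xf dX2.
have {}h : `|layer_hessian E X' i j - layer_hessian E X i j| <= kappa / 2 / t.
  apply: le_trans h _.
  have -> : A * enorm (X' - X) / (t / K) ^+ 2 = A * K ^+ 2 * enorm (X' - X) / t / t.
    by field; rewrite !gt_eqF.
  rewrite ler_pM2r ?invr_gt0// ler_pdivrMr//.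
  have AK : 0 <= A * K ^+ 2 by rewrite mulr_ge0 ?sqr_ge0.
  apply: le_trans (ler_wpM2l AK X'X) _; rewrite mulrA ler_pM2r//.
  rewrite ler_pdivrMr//.
  have -> : kappa / 2 * S = kappa * K + A * K ^+ 2.
    by rewrite /S; field; rewrite gt_eqF.
  by rewrite lerDr mulr_ge0 ?ltW.
have big : kappa / 2 / t <= `|layer_hessian E X' i j|.
  have half (e p q : R) : e <= `|p| -> `|q - p| <= e / 2 -> e / 2 <= `|q|.
    move=> ep qp; have := ler_normD q (p - q).
    by rewrite [`|p - q|]distrC addrC subrK; lra.
  rewrite mulrAC; apply: (half _ (layer_hessian E X i j)) => //.
  by rewrite mulrAC.
have tK20 : 0 < t / (2 * K) by rewrite divr_gt0// mulr_gt0.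
apply: (@le_trans _ _ (((c * (kappa / 2 / t)) ^+ 2)%:E * (t / (2 * K))%:E)%E).
  rewrite -EFinM lee_fin le_eqVlt; apply/orP; left; apply/eqP.
  by rewrite /v; field; rewrite !gt_eqF.
apply: lee_pmul.
- by rewrite lee_fin sqr_ge0.
- by rewrite lee_fin ltW.
- rewrite lee_fin /frobenius_sq (bigD1 i)//= (bigD1 j)//= -addrA.
  apply: (@le_trans _ _ (hessian_single_layer1 E X' i j ^+ 2)).
    rewrite (hessian_single_layer1E _ _ tK20 X'f) -[leRHS]real_normK ?num_real//.
    rewrite ler_sqr ?nnegrE//; last first.
      by apply: mulr_ge0; [exact: ltW|rewrite !divr_ge0 ?(ltW kappa0) ?(ltW t0)].
    by rewrite normrM ger0_norm ?(ltW c0)// ler_pM2l.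
  rewrite lerDl addr_ge0//; apply: sumr_ge0 => ? _; first exact: sqr_ge0.
  by apply: sumr_ge0 => ? _; exact: sqr_ge0.
- exact: point_dist_far.
Qed.

(** Centre, bad point and scale. *)
Let site : eqType := (V * V * R)%type.
Let ctr (p : site) : V := p.1.1.
Let pt (p : site) : V := p.1.2.
Let scl (p : site) : R := p.2.

Let bad_site kappa K x r (p : site) : Prop :=
  [/\ 0 < scl p, 8 * K * scl p <= r, enorm (ctr p - x) < r / 2,
     enorm (pt p - ctr p) < K * scl p & bad_point kappa K (scl p) (pt p)].

(* A point whose distance to [E] lies between [t / (2 * K)] and [2 * K * t] determines
   [t] up to the factor [4 * K ^+ 2]. *)
Let apart K (p q : site) : bool :=
  [|| (scl p == scl q) && (4 * K * scl p <= enorm (ctr p - ctr q)),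
      4 * K ^+ 2 * scl p <= scl q | 4 * K ^+ 2 * scl q <= scl p].

(* The cubes of two sites that are apart are disjoint: at equal scales the
   centres are far away from each other, at different scales the distances to [E]
   do not match. *)
Let packing_bound kappa K x r (a v : R) (s : seq site) : 1 <= K -> 0 < r -> E x -> (r%:E <= ediam E)%E ->
  0 < a -> 0 < v ->
  (forall t X X', 0 < t -> bad_point kappa K t X ->
    (forall i, `|X' 0 i - X 0 i| < a * t) ->
    [/\ enorm (X' - X) <= t / (2 * K), far_from (t / (2 * K)) X' &
      ((v / t)%:E <= carleson_density X')%E]) ->
  (forall p, p \in s -> bad_site kappa K x r p /\ E (ctr p)) -> pairwise (apart K) s ->
  v * (2 * a) ^+ n.+1 * \sum_(p <- s) scl p ^+ n <= CU * r ^+ n.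
Proof.
move=> K1 r0 Ex rE a0 v0 dens sbad sap; rewrite -lee_fin.
have K0 : 0 < K := lt_le_trans ltr01 K1.
apply: le_trans (carleson Ex r0 rE).
have near p X : p \in s -> (forall i, `|X 0 i - pt p 0 i| < a * scl p) ->
    [/\ enorm (X - ctr p) < 2 * K * scl p, far_from (scl p / (2 * K)) X &
      ((v / scl p)%:E <= carleson_density X)%E].
  move=> ps pX; have [[p0 pr px pc pbad] Ec] := sbad p ps.
  have [d1 d2 d3] := dens _ _ _ p0 pbad pX; split => //.
  apply: le_lt_trans (ler_enorm_dist X (pt p) (ctr p)) _.
  have : scl p / (2 * K) <= K * scl p.
    rewrite ler_pdivrMr ?mulr_gt0// mulrC mulrA ler_peMl ?(ltW p0)//.
    have := ler_pM ler01 ler01 K1 K1; lra.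
  lra.
have -> : v * (2 * a) ^+ n.+1 * \sum_(p <- s) scl p ^+ n =
    \sum_(p <- s) v / `|scl p| * (2 * (a * scl p)) ^+ n.+1.
  rewrite mulr_sumr big_seq [RHS]big_seq; apply: eq_bigr => p /sbad[[p0 _ _ _ _] _].
  rewrite gtr0_norm// mulrA [in RHS]exprMn [scl p ^+ n.+1]exprSr.
  by field; rewrite gt_eqF.
apply: integral_dX_ge_cubes.
- exact: carleson_density_ge0.
- by move=> p /sbad[[p0 _ _ _ _] _]; rewrite mulr_gt0.
- by move=> p; rewrite divr_ge0// ltW.
- move=> p X ps pX; have [[p0 pr px pc pbad] Ec] := sbad p ps.
  have [h1 h2 h3] := near p X ps pX; split; last by rewrite gtr0_norm.
  rewrite /eball/=; apply: le_lt_trans (ler_enorm_dist X (ctr p) x) _.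
  lra.
- move: sap; apply: (sub_in_pairwise (P := mem s)); last exact/allP.
  move=> p q ps qs pq; apply/asboolP => X pX qX.
  have [[p0 pr px pc pbad] Ep] := sbad p ps.
  have [[q0 qr qx qc qbad] Eq] := sbad q qs.
  have [h1 h2 _] := near p X ps pX; have [k1 k2 _] := near q X qs qX.
  have K20 : 0 < 2 * K by rewrite mulr_gt0.
  have ratio (t u : R) : t / (2 * K) < 2 * K * u -> t < 4 * K ^+ 2 * u.
    by rewrite ltr_pdivrMr// => /lt_le_trans; apply; rewrite expr2; lra.
  have pE : scl q / (2 * K) < 2 * K * scl p := le_lt_trans (k2 _ Ep) h1.
  have qE : scl p / (2 * K) < 2 * K * scl q := le_lt_trans (h2 _ Eq) k1.
  move: pq => /or3P[/andP[/eqP e h]|h|h].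
  - have := ler_enorm_dist (ctr p) X (ctr q); rewrite enorm_distC -e in k1 *.
    by rewrite [enorm (ctr p - X)]enorm_distC; lra.
  - by have := ratio _ _ pE; rewrite ltNge h.
  - by have := ratio _ _ qE; rewrite ltNge h.
Qed.

(* A maximal family of bad sites of one scale, if bad points occur everywhere at
   that scale, is large: the balls about its centres cover [E] near [x]. *)
Let bad_layer kappa K x r (a v : R) (t : R) : 1 <= K -> 0 < r -> E x ->
  (r%:E < ediam E)%E -> 0 < a -> 0 < v ->
  (forall t X X', 0 < t -> bad_point kappa K t X ->
    (forall i, `|X' 0 i - X 0 i| < a * t) ->
    [/\ enorm (X' - X) <= t / (2 * K), far_from (t / (2 * K)) X' &
      ((v / t)%:E <= carleson_density X')%E]) ->
  0 < t -> 8 * K * t <= r ->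
  (forall y, E y -> enorm (y - x) < r / 2 ->
    exists2 X, enorm (X - y) < K * t & bad_point kappa K t X) ->
  exists s : seq site, [/\ forall p, p \in s -> bad_site kappa K x r p /\ E (ctr p),
    forall p, p \in s -> scl p = t, pairwise (apart K) s &
    cL / (C * (8 * K) ^+ n) * r ^+ n <= \sum_(p <- s) scl p ^+ n].
Proof.
move=> K1 r0 Ex rE a0 v0 dens t0 tr bad; have K0 : 0 < K := lt_le_trans ltr01 K1.
pose good_seq (s : seq site) := [/\ forall p, p \in s -> bad_site kappa K x r p /\ E (ctr p),
    forall p, p \in s -> scl p = t & pairwise (apart K) s].
pose P m := `[< exists2 s, good_seq s & size s = m >].
have sumE s : good_seq s -> \sum_(p <- s) scl p ^+ n = (size s)%:R * t ^+ n.
  move=> [_ st _]; rewrite big_seq (eq_bigr (fun=> t ^+ n)) => [|p ps].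
    by rewrite -big_seq big_const_seq count_predT iter_addr_0 mulr_natl.
  by rewrite st.
have P0 : P 0%N by apply/asboolP; exists [::].
pose b := v * (2 * a) ^+ n.+1 * t ^+ n.
have b0 : 0 < b by rewrite !mulr_gt0 ?exprn_gt0 ?mulr_gt0.
have Pbound m : P m -> (m <= Num.truncn (CU * r ^+ n / b))%N.
  move=> /asboolP[s gs <-]; have [s1 s2 s3] := gs.
  have := packing_bound K1 r0 Ex (ltW rE) a0 v0 dens s1 s3.
  rewrite (sumE s gs) => h.
  have hb : (size s)%:R <= CU * r ^+ n / b.
    rewrite ler_pdivlMr// /b; apply: le_trans h.
    by rewrite le_eqVlt; apply/orP; left; apply/eqP; ring.
  by rewrite truncn_ge_nat// (le_trans _ hb).
have exP : exists m, P m by exists 0%N.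
case: (ex_maxnP exP Pbound) => m /asboolP[s gs sm] mmax.
have [s1 s2 s3] := gs; exists s; split => //.
have cover y : E y -> enorm (y - x) < r / 2 ->
    exists2 p, p \in s & enorm (y - ctr p) < 4 * K * t.
  move=> Ey yx; apply: contrapT => nc; have [X Xy Xbad] := bad y Ey yx.
  have ny p : p \in s -> 4 * K * t <= enorm (y - ctr p).
    by move=> ps; rewrite leNgt; apply/negP => h; apply: nc; exists p.
  suff /mmax : P m.+1 by rewrite ltnn.
  apply/asboolP; exists ((y, X, t) :: s); last by rewrite /= sm.
  split.
  - by move=> p; rewrite inE => /predU1P[->|/s1//].
  - by move=> p; rewrite inE => /predU1P[->|/s2//].
  - rewrite pairwise_cons s3 andbT; apply/allP => p ps; apply/or3P; apply: Or31.
    by rewrite /= /scl/= -[p.2]/(scl p) (s2 p ps) eqxx/=; exact: ny.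
have r20 : 0 < r / 2 by rewrite divr_gt0.
have r2E : ((r / 2)%:E < ediam E)%E by apply: le_lt_trans rE; rewrite lee_fin; lra.
have Kt0 : 0 < 4 * K * t by rewrite !mulr_gt0.
have H : (hausdorff n (E `&` eball x (r / 2)) <= ((size s)%:R * (C * (4 * K * t) ^+ n))%:E)%E.
  have : E `&` eball x (r / 2) `<=` \bigcup_(p in [set` s]) (E `&` eball (ctr p) (4 * K * t)).
    by move=> y [Ey yx]; have [p ps yp] := cover y Ey yx; exists p.
  move/(le_outer_measure (@hausdorff R n.+1 n)) => /le_trans; apply.
  elim: (s) => [|p s' IH].
    rewrite mul0r (_ : \bigcup_(p in _) _ = set0) ?(outer_measure0 (@hausdorff R n.+1 n))//.
    by apply/seteqP; split => // z [].
  apply: (@le_trans _ _ (hausdorff n ((E `&` eball (ctr p) (4 * K * t)) `|`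
      \bigcup_(p in [set` s']) (E `&` eball (ctr p) (4 * K * t))))).
    apply: (le_outer_measure (@hausdorff R n.+1 n)) => z [q /=].
    by rewrite inE => /predU1P[->|qs] zq; [left|right; exists q].
  apply: le_trans (outer_measureU2 (@hausdorff R n.+1 n) _ _) _.
  have -> : (size (p :: s'))%:R * (C * (4 * K * t) ^+ n) =
      C * (4 * K * t) ^+ n + (size s')%:R * (C * (4 * K * t) ^+ n).
    by rewrite /= -nat1r mulrDl mul1r.
  rewrite EFinD; apply: leeD; first exact: upper.
  exact: IH.
have := le_trans (lower Ex r20 r2E) H; rewrite lee_fin sumE//.
have D0 : 0 < C * (8 * K) ^+ n by rewrite mulr_gt0 ?exprn_gt0 ?mulr_gt0.
have -> : C * (4 * K * t) ^+ n = C * (8 * K) ^+ n * t ^+ n / 2 ^+ n.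
  have -> : 8 * K = 2 * (4 * K) by ring.
  by rewrite !exprMn; field; rewrite expf_neq0.
rewrite exprMn exprVn !mulrA ler_pM2r ?invr_gt0 ?exprn_gt0// => h.
rewrite mulrAC ler_pdivrMr//; apply: le_trans h _.
by rewrite le_eqVlt; apply/orP; left; apply/eqP; ring.
Qed.

(** Every bad site is charged to the Carleson measure, and a scale at which all the
    surface balls contain bad points accounts for a fixed proportion of the mass that
    the Carleson condition allows; hence one among finitely many scales, their number
    depending only on the constants, is good. *)
Lemma good_scale kappa K : 0 < kappa -> 1 <= K -> exists2 c : R, 0 < c &
  forall x r, E x -> 0 < r -> (r%:E < ediam E)%E -> exists y t,
  [/\ E y, enorm (y - x) < r / 2, c * r <= t, 8 * K * t <= r &
    forall X, enorm (X - y) < K * t -> far_from (t / K) X ->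
    forall i j, `|layer_hessian E X i j| < kappa / t].
Proof.
move=> kappa0 K1; have K0 : 0 < K := lt_le_trans ltr01 K1.
have [a [v [a0 v0 dens]]] := bad_point_density kappa0 K1.
pose g := cL / (C * (8 * K) ^+ n).
have g0 : 0 < g by rewrite divr_gt0// mulr_gt0 ?exprn_gt0 ?mulr_gt0.
pose b := v * (2 * a) ^+ n.+1; have b0 : 0 < b by rewrite mulr_gt0 ?exprn_gt0 ?mulr_gt0.
pose J := (Num.truncn (CU / (b * g))).+1.
have JCU : CU < J%:R * (b * g).
  have bg0 : 0 < b * g by apply: mulr_gt0.
  by rewrite -ltr_pdivrMr//; exact: truncnS_gt.
pose L := 4 * K ^+ 2; have L1 : 1 <= L.
  have : 1 <= K ^+ 2 by rewrite exprn_ege1.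
  by rewrite /L; lra.
have L0 : 0 < L by lra.
have LJ m : 0 < L ^- m by rewrite invr_gt0 exprn_gt0.
have K8 : 0 < 8 * K by rewrite mulr_gt0.
exists (L ^- J / (8 * K)) => [|x r Ex r0 rE]; first by rewrite divr_gt0.
apply: contrapT => no.
pose t m := L ^- m / (8 * K) * r.
have t0 m : 0 < t m by rewrite mulr_gt0 ?divr_gt0.
have tr m : 8 * K * t m <= r.
  rewrite /t mulrA mulrC [8 * K * _]mulrC divfK ?gt_eqF// ler_piMr ?(ltW r0)//.
  by rewrite invf_le1 ?exprn_gt0// exprn_ege1.
have bad m : (m < J)%N -> forall y, E y -> enorm (y - x) < r / 2 ->
    exists2 X, enorm (X - y) < K * t m & bad_point kappa K (t m) X.
  move=> mJ y Ey yx; apply: contrapT => nX; apply: no; exists y, (t m); split => //.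
    rewrite /t ler_pM2r// ler_pM2r ?invr_gt0//.
    by rewrite lef_pV2 ?posrE ?exprn_gt0// ler_weXn2l// ltnW.
  move=> X Xy Xf i j; rewrite ltNge; apply/negP => h; apply: nX.
  by exists X => //; split => //; exists i, j.
suff [s [s1 _ s3 s4]] : exists s : seq site,
    [/\ forall p, p \in s -> bad_site kappa K x r p /\ E (ctr p),
    forall p, p \in s -> exists2 m, (m < J)%N & scl p = t m, pairwise (apart K) s &
    J%:R * (g * r ^+ n) <= \sum_(p <- s) scl p ^+ n].
  have := packing_bound K1 r0 Ex (ltW rE) a0 v0 dens s1 s3; rewrite -/b => h.
  have := ler_wpM2l (ltW b0) s4; move/le_trans => /(_ _ h).
  have -> : b * (J%:R * (g * r ^+ n)) = J%:R * (b * g) * r ^+ n by ring.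
  by rewrite ler_pM2r ?exprn_gt0// leNgt JCU.
elim: J {JCU no} bad => [|m IH] bad.
  by exists [::]; split => //; rewrite mul0r big_nil.
have [s [s1 s2 s3 s4]] := IH (fun k km => bad k (ltnW km)).
have [u [u1 u2 u3 u4]] := bad_layer K1 r0 Ex rE a0 v0 dens (t0 m) (tr m) (bad m (ltnSn m)).
exists (u ++ s); split.
- by move=> p; rewrite mem_cat => /orP[/u1|/s1].
- move=> p; rewrite mem_cat => /orP[/u2 ->|/s2[k km ->]]; first by exists m.
  by exists k => //; exact: ltnW.
- rewrite pairwise_cat u3 s3 !andbT; apply/allrelP => p q /u2 pm /s2[k km qk].
  rewrite /apart pm qk; apply/or3P; apply: Or32.
  rewrite -/L /t !mulrA ler_pM2r// ler_pM2r ?invr_gt0//.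
  rewrite -(subnK km) addnS exprS invfM mulrA divff ?gt_eqF// mul1r.
  by rewrite lef_pV2 ?posrE ?exprn_gt0// ler_weXn2l// leq_addl.
- rewrite big_cat/= -natr1 mulrDl mul1r addrC; exact: lerD.
Qed.

End good_scale.

(** * Propagation of smallness along Harnack chains *)

Section propagation.
Context {R : realType}.

(** A quadratic error term disappears under subdivision. *)
Lemma subdivision_bound (f : R -> R) (A B e : R) : 0 <= A -> 0 <= B -> 0 < e ->
  (forall s s', 0 <= s -> s <= 1 -> 0 <= s' -> s' <= 1 -> `|s' - s| <= e ->
     `|f s' - f s| <= A * `|s' - s| + B * `|s' - s| ^+ 2) ->
  `|f 1 - f 0| <= A.
Proof.
move=> A0 B0 e0 H; rewrite leNgt; apply/negP => lt_.
pose eta := `|f 1 - f 0| - A; have eta0 : 0 < eta by rewrite subr_gt0.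
pose m := (maxn (Num.truncn (B / eta)) (Num.truncn e^-1)).+1.
have m0 : 0 < m%:R :> R by rewrite ltr0n.
have mB : B / eta < m%:R.
  by apply: lt_le_trans (truncnS_gt _) _; rewrite ler_nat ltnS leq_maxl.
have me : m%:R^-1 <= e.
  rewrite invf_ple ?posrE//; apply: ltW; apply: lt_le_trans (truncnS_gt _) _.
  by rewrite ler_nat ltnS leq_maxr.
have step k : (k <= m)%N -> `|f (k%:R / m%:R) - f 0| <= k%:R * (A / m%:R + B / m%:R ^+ 2).
  elim: k => [|k IH] km; first by rewrite !mul0r subrr normr0.
  rewrite -(subrKA (f (k%:R / m%:R))) -[k.+1%:R in leRHS]natr1 [leRHS]mulrDl mul1r.
  rewrite [leRHS]addrC; apply: le_trans (ler_normD _ _) _.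
  apply: lerD; last by apply: IH; exact: ltnW.
  have d : k.+1%:R / m%:R - k%:R / m%:R = m%:R^-1 :> R.
    by rewrite -mulrBl -natr1 addrC addKr mul1r.
  have mV0 : 0 <= m%:R^-1 :> R by rewrite invr_ge0 ltW.
  have := H (k%:R / m%:R) (k.+1%:R / m%:R); rewrite d ger0_norm// exprVn; apply => //.
  - by rewrite ler_pdivrMr// mul1r ler_nat ltnW.
  - by rewrite ler_pdivrMr// mul1r ler_nat.
have := step m (leqnn m); rewrite divff ?gt_eqF//.
have -> : m%:R * (A / m%:R + B / m%:R ^+ 2) = A + B / m%:R by field; rewrite gt_eqF.
have : B / m%:R < eta by rewrite ltr_pdivrMr// mulrC -ltr_pdivrMr.
rewrite /eta; lra.
Qed.

Context (n : nat) (E : set 'rV[R]_n.+1) (C : R).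
Local Notation V := 'rV[R]_n.+1.
Local Notation far_from := (far_from E).
Implicit Types (X Y p q : V).
Hypothesis n1 : (1 <= n)%N.
Hypothesis cE : closed E.
Hypothesis C0 : 0 < C.
Hypothesis upper : forall X r, 0 < r ->
  (hausdorff n (E `&` eball X r) <= (C * r ^+ n)%:E)%E.

(* Combines [subdivision_bound] with a first-order expansion of [F]. *)
Let segment_bound (F : V -> R) (G : V -> 'I_n.+1 -> R) (g B rho : R) p q :
  0 < rho -> 0 <= g -> 0 <= B ->
  (forall s, 0 <= s -> s <= 1 -> forall j, `|G (p + s *: (q - p)) j| <= g) ->
  (forall s X', 0 <= s -> s <= 1 ->
     let X := p + s *: (q - p) in enorm (X' - X) <= rho / 2 ->
     `|F X' - F X - \sum_j G X j * (X' - X) 0 j| <= B * enorm (X' - X) ^+ 2) ->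
  `|F q - F p| <= n.+1%:R * g * enorm (q - p).
Proof.
move=> rho0 g0 B0 hG hF; have L0 := enorm_ge0 (q - p).
have e0 : 0 < rho / 2 / (enorm (q - p) + 1) by rewrite divr_gt0 ?divr_gt0//; lra.
have := @subdivision_bound (fun s => F (p + s *: (q - p)))
  (n.+1%:R * g * enorm (q - p)) (B * enorm (q - p) ^+ 2) _ _ _ e0.
rewrite scale1r scale0r addr0 [p + _]addrC subrK; apply.
- by rewrite !mulr_ge0.
- by rewrite mulr_ge0 ?sqr_ge0.
move=> s s' s0 s1 s'0 s'1 ss'.
have D : (p + s' *: (q - p)) - (p + s *: (q - p)) = (s' - s) *: (q - p).
  by rewrite opprD addrACA subrr add0r scalerBl.
have eD : enorm ((p + s' *: (q - p)) - (p + s *: (q - p))) = `|s' - s| * enorm (q - p).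
  by rewrite D enormZ.
have := hF s (p + s' *: (q - p)) s0 s1; rewrite /= eD => h.
have small : `|s' - s| * enorm (q - p) <= rho / 2.
  move: ss'; rewrite ler_pdivlMr; last by lra.
  by apply: le_trans; rewrite ler_wpM2l// lerDl.
have {h}/= h := h small; rewrite exprMn in h.
set S := \sum_j _ in h.
have hS : `|S| <= n.+1%:R * (g * (`|s' - s| * enorm (q - p))).
  apply: le_trans (ler_norm_sum _ _ _) _.
  apply: (@le_trans _ _ (\sum_(j < n.+1) g * (`|s' - s| * enorm (q - p)))).
    apply: ler_sum => j _; rewrite normrM; apply: ler_pM => //; first exact: hG.
    by rewrite -eD; exact: enorm_coord.
  by rewrite sumr_const card_ord [leRHS]mulr_natl.
rewrite -[X in `|X|](subrK S); apply: le_trans (ler_normD _ _) _.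
rewrite addrC; apply: le_trans (lerD hS h) _.
by rewrite le_eqVlt; apply/orP; left; apply/eqP; ring.
Qed.

Lemma layer_grad_variation Xs rs rho eta p q i : 0 < rs -> far_from rs Xs ->
  0 < rho -> 0 <= eta ->
  (forall s, 0 <= s -> s <= 1 -> far_from rho (p + s *: (q - p)) /\
     forall j, `|layer_hessian E (p + s *: (q - p)) i j| <= eta) ->
  `|layer_grad E Xs q i - layer_grad E Xs p i| <= n.+1%:R * eta * enorm (q - p).
Proof.
move=> rs0 Xsf rho0 eta0 H; have [A A0 exp] := layer_grad_expansion cE C0 upper.
apply: (segment_bound (F := fun X => layer_grad E Xs X i)
  (G := fun X j => layer_hessian E X i j) (B := A / rho ^+ 2) rho0 eta0).
- by rewrite divr_ge0 ?sqr_ge0.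
- by move=> s s0 s1; have [] := H s s0 s1.
- move=> s X' s0 s1 X XX'; have [Xf _] := H s s0 s1.
  apply: le_trans (exp _ _ _ _ _ i rs0 Xsf rho0 Xf XX') _.
  by rewrite mulrAC.
Qed.

Lemma layer_potential_variation Xs rs rho g p q : 0 < rs -> far_from rs Xs ->
  0 < rho -> 0 <= g ->
  (forall s, 0 <= s -> s <= 1 -> far_from rho (p + s *: (q - p)) /\
     forall j, `|layer_grad E Xs (p + s *: (q - p)) j| <= g) ->
  `|layer_potential E Xs 0 q - layer_potential E Xs 0 p| <= n.+1%:R * g * enorm (q - p).
Proof.
move=> rs0 Xsf rho0 g0 H; have [A A0 exp] := layer_potential_expansion n1 cE C0 upper.
apply: (segment_bound (F := layer_potential E Xs 0)
  (G := layer_grad E Xs) (B := A / rho) rho0 g0).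
- exact: (divr_ge0 A0 (ltW rho0)).
- by move=> s s0 s1; have [] := H s s0 s1.
- move=> s X' s0 s1 X XX'; have [Xf _] := H s s0 s1.
  apply: le_trans (exp _ _ _ _ _ rs0 Xsf rho0 Xf XX') _.
  by rewrite mulrAC.
Qed.

End propagation.

Section harnack_chains.
Context {R : realType} (n : nat) (E : set 'rV[R]_n.+1) (C : R).
Local Notation V := 'rV[R]_n.+1.
Local Notation far_from := (far_from E).
Implicit Types (X Y p q y z c : V) (B : set V).

Lemma eball_segment c s p q a : eball c s p -> eball c s q ->
  0 <= a -> a <= 1 -> eball c s (p + a *: (q - p)).
Proof.
rewrite /eball /= => pc qc a0 a1.
have -> : p + a *: (q - p) - c = (1 - a) *: (p - c) + a *: (q - c).
  by apply/rowP => j; rewrite !mxE; ring.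
apply: le_lt_trans (ler_enormD _ _) _; rewrite !enormZ !ger0_norm ?subr_ge0//.
have [->|ap] := eqVneq a 0; first by rewrite subr0 mul0r mul1r addr0.
have {a0 ap}a0 : 0 < a by rewrite lt_neqAle eq_sym ap.
have -> : s = (1 - a) * s + a * s by ring.
apply: ler_ltD; last by rewrite ltr_pM2l.
by apply: ler_wpM2l; [rewrite subr_ge0|exact: ltW].
Qed.

(** The form in which the size of a Harnack ball is used: seen from any point of [E],
    the ball is small. *)
Lemma harnack_ball_dist (L : R) B p q z : 0 < L ->
  (L^-1%:E * ediam B <= set_dist B E)%E -> B p -> B q -> E z ->
  enorm (p - q) <= L * enorm (p - z).
Proof.
move=> L0 H Bp Bq Ez; rewrite -ler_pdivrMl// -lee_fin EFinM.
apply: le_trans (lee_wpmul2l _ (ediam_ge Bp Bq)) _; first by rewrite lee_fin invr_ge0 ltW.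
apply: le_trans H _; apply: (@le_trans _ _ (point_dist p E)).
  by apply: ereal_inf_lbound; exists p.
by apply: ereal_inf_lbound; exists z.
Qed.

Hypothesis n1 : (1 <= n)%N.
Hypothesis cE : closed E.
Hypothesis C0 : 0 < C.
Hypothesis upper : forall X r, 0 < r ->
  (hausdorff n (E `&` eball X r) <= (C * r ^+ n)%:E)%E.

Variables (L c1 K kappa t : R) (N : nat) (y Xs : V).
Hypotheses (L0 : 0 < L) (c10 : 0 < c1) (kappa0 : 0 < kappa) (t0 : 0 < t).
Hypotheses (KN : (1 + L) ^+ N < K) (KNc : (1 + L) ^+ N <= c1 * K).
Hypotheses (Ey : E y) (Xsf : far_from (c1 * t) Xs) (Xsy : enorm (Xs - y) <= t).
Hypothesis small_hessian : forall X, enorm (X - y) < K * t -> far_from (t / K) X ->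
  forall i j, `|layer_hessian E X i j| < kappa / t.

Let G := 1 + L.
Let W := n.+1%:R * (L * G ^+ N).
Let G1 : 1 <= G. Proof. by rewrite lerDl ltW. Qed.
Let G0 : 0 < G. Proof. exact: lt_le_trans ltr01 G1. Qed.
Let GN0 k : 0 < G ^+ k. Proof. exact: exprn_gt0. Qed.
Let W0 : 0 <= W. Proof. exact: mulr_ge0 (ler0n _ _) (mulr_ge0 (ltW L0) (ltW (GN0 N))). Qed.
Let K0 : 0 < K. Proof. exact: lt_trans (GN0 N) KN. Qed.

(* The state after [k] balls: each ball costs a factor [G] in the distances and adds
   [kappa * W] to the bound of the gradient. *)
Let reached k q := [/\ far_from (c1 * t / G ^+ k) q, enorm (q - y) <= t * G ^+ k,
  forall i, `|layer_grad E Xs q i| <= k%:R * kappa * W &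
  `|layer_potential E Xs 0 q| <= k%:R ^+ 2 * W ^+ 2 * kappa * t].

Let leGN k : (k <= N)%N -> G ^+ k <= G ^+ N.
Proof. by move=> kN; apply: ler_weXn2l. Qed.

Let reached_next k B p q : (k < N)%N ->
  (forall p q a, B p -> B q -> 0 <= a -> a <= 1 -> B (p + a *: (q - p))) ->
  (forall p q z, B p -> B q -> E z -> enorm (p - q) <= L * enorm (p - z)) ->
  B p -> B q -> reached k p -> reached k.+1 q.
Proof.
move=> kN convB distB Bp Bq [pf py pg pu].
have Gk := GN0 k; have GkN := leGN kN.
have far x : B x -> far_from (c1 * t / G ^+ k.+1) x.
  move=> Bx z Ez; rewrite exprS invfM mulrCA mulrC ler_pdivrMr//.
  have := distB x p z Bx Bp Ez; have := pf z Ez; have := ler_enorm_dist p x z.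
  by rewrite [enorm (p - x)]enorm_distC /G; nra.
have near x : B x -> enorm (x - y) <= t * G ^+ k.+1.
  move=> Bx; have := distB p x y Bp Bx Ey; have := ler_enorm_dist x p y.
  rewrite [enorm (x - p)]enorm_distC exprS mulrCA /G => h1 h2.
  apply: (@le_trans _ _ ((1 + L) * enorm (p - y))); first lra.
  by apply: ler_wpM2l => //; exact: ltW.
have pB x : B x -> enorm (x - p) <= L * (t * G ^+ N).
  move=> Bx; rewrite enorm_distC; apply: le_trans (distB p x y Bp Bx Ey) _.
  apply: ler_wpM2l; first exact: ltW.
  apply: le_trans py _; apply: ler_wpM2l; first exact: ltW.
  exact: leGN (ltnW kN).
have hess x : B x -> forall i j, `|layer_hessian E x i j| <= kappa / t.
  move=> Bx i j; apply/ltW/small_hessian.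
    apply: le_lt_trans (near x Bx) _; rewrite mulrC ltr_pM2r//.
    exact: le_lt_trans GkN KN.
  move=> z Ez; apply: le_trans (far x Bx z Ez).
  rewrite ler_pdivlMr// mulrAC ler_pdivrMr//.
  have : t * G ^+ k.+1 <= t * (c1 * K).
    by apply: ler_wpM2l; [exact: ltW|exact: le_trans GkN KNc].
  by congr (_ <= _); ring.
have c1t0 : 0 < c1 * t by exact: mulr_gt0.
have rk0 : 0 < c1 * t / G ^+ k.+1 by exact: divr_gt0.
have vary x g : B x -> 0 <= g -> n.+1%:R * g * enorm (x - p) <= g * W * t.
  move=> Bx g0; apply: (@le_trans _ _ (n.+1%:R * g * (L * (t * G ^+ N)))).
    by apply: ler_wpM2l; [exact: mulr_ge0|exact: pB].
  by rewrite le_eqVlt; apply/orP; left; apply/eqP; rewrite /W; ring.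
have kt0 : 0 <= kappa / t by apply/ltW/divr_gt0.
have gradB x : B x -> forall i, `|layer_grad E Xs x i| <= k.+1%:R * kappa * W.
  move=> Bx i; have var := layer_grad_variation cE C0 upper c1t0 Xsf rk0 kt0
    (fun a a0 a1 => conj (far _ (convB p x a Bp Bx a0 a1))
                         (hess _ (convB p x a Bp Bx a0 a1) i)).
  rewrite -[layer_grad E Xs x i](subrK (layer_grad E Xs p i)).
  apply: le_trans (ler_normD _ _) _.
  have -> : k.+1%:R * kappa * W = kappa / t * W * t + k%:R * kappa * W.
    by rewrite -natr1; field; rewrite gt_eqF.
  by apply: lerD; [exact: le_trans var (vary x _ Bx kt0)|exact: pg].
split; [exact: far|exact: near|exact: gradB|].
have g0 : 0 <= k.+1%:R * kappa * W by apply: mulr_ge0 => //; apply: mulr_ge0 => //; exact: ltW.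
have var := layer_potential_variation n1 cE C0 upper c1t0 Xsf rk0 g0
    (fun a a0 a1 => conj (far _ (convB p q a Bp Bq a0 a1))
                         (gradB _ (convB p q a Bp Bq a0 a1))).
rewrite -[layer_potential E Xs 0 q](subrK (layer_potential E Xs 0 p)).
apply: le_trans (ler_normD _ _) _.
apply: le_trans (lerD (le_trans var (vary q _ Bq g0)) pu) _.
have -> : k.+1%:R * kappa * W * W * t + k%:R ^+ 2 * W ^+ 2 * kappa * t =
    (k.+1%:R + k%:R ^+ 2) * (W ^+ 2 * kappa * t) by ring.
have -> : k.+1%:R ^+ 2 * W ^+ 2 * kappa * t = k.+1%:R ^+ 2 * (W ^+ 2 * kappa * t) by ring.
apply: ler_wpM2r.
  apply: mulr_ge0; last exact: ltW.
  by apply: mulr_ge0; [exact: sqr_ge0|exact: ltW].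
rewrite -natr1; have := ler0n R k; nra.
Qed.

(** Along a Harnack chain the Hessian controls the oscillation of the gradient,
    and the gradient that of the potential; both vanish at the anchor. *)
Lemma harnack_chain_potential Omega X m (c : nat -> V) (s : nat -> R) :
  E = boundary Omega -> (m <= N)%N -> harnack_chain Omega L Xs X m c s ->
  `|layer_potential E Xs 0 X| <= (N%:R * W) ^+ 2 * kappa * t.
Proof.
move=> EO mN [m0 B0 Bm link balls].
pose B k := eball (c k) (s k).
have distB k : (k < m)%N -> forall p q z, B k p -> B k q -> E z ->
    enorm (p - q) <= L * enorm (p - z).
  move=> km p q z Bp Bq Ez; have [_ _ H _] := balls k km.
  by rewrite -EO in H; exact: harnack_ball_dist L0 H Bp Bq Ez.
have all_reached k : (k < m)%N -> forall q, B k q -> reached k.+1 q.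
  elim: k => [|k IH] km q Bq.
    apply: (reached_next (leq_trans km mN) _ (distB 0%N km) B0 Bq).
      by move=> *; exact: eball_segment.
    split => [|||].
    - by rewrite expr0 divr1.
    - by rewrite expr0 mulr1.
    - by move=> i; rewrite layer_grad_anchor normr0 !mul0r.
    - by rewrite layer_potential_anchor normr0 expr0n !mul0r.
  have [p [Bkp Bp]] := link k km.
  apply: (reached_next (leq_trans km mN) _ (distB k.+1 km) Bp Bq).
    by move=> *; exact: eball_segment.
  exact: (IH (ltnW km) p Bkp).
have := all_reached m.-1; rewrite prednK// => /(_ (leqnn _) _ Bm)[_ _ _ u].
apply: le_trans u _.
have -> : (N%:R * W) ^+ 2 * kappa * t = N%:R ^+ 2 * (W ^+ 2 * kappa * t) by ring.
have -> : m%:R ^+ 2 * W ^+ 2 * kappa * t = m%:R ^+ 2 * (W ^+ 2 * kappa * t) by ring.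
apply: ler_wpM2r.
  apply: mulr_ge0; last exact: ltW.
  by apply: mulr_ge0; [exact: sqr_ge0|exact: ltW].
by apply: lerXn2r; rewrite ?nnegrE// ler_nat.
Qed.

End harnack_chains.

(** * The complement of the domain *)

Section exterior_corkscrew.
Context {R : realType} (n : nat).
Local Notation V := 'rV[R]_n.+1.
Implicit Types (Omega : set V) (X Y y z : V).

(** A segment from [X] to a point of [Omega] meets the boundary at the point where
    it first enters [Omega]. *)
Lemma exterior_ball Omega X rho : open Omega -> ~ Omega X ->
  far_from (boundary Omega) rho X -> eball X rho `<=` exterior Omega.
Proof.
move=> oO OX Xf Z XZ ZO.
have [Y [OY XY]] := ZO _ (open_nbhs_nbhs (conj (@open_eball _ _ X rho) XZ)).
pose g (a : R) : V := X + a *: (Y - X).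
have g1 : g 1 = Y by rewrite /g scale1r addrC subrK.
have gd a b : enorm (g b - g a) = `|b - a| * enorm (Y - X).
  by rewrite -enormZ /g opprD addrACA subrr add0r scalerBl.
have D0 : 0 < enorm (Y - X) + 1 by have := enorm_ge0 (Y - X); lra.
have close a b e : `|b - a| < e / (enorm (Y - X) + 1) -> enorm (g b - g a) < e.
  rewrite ltr_pdivlMr// => h; rewrite gd; apply: le_lt_trans h.
  by apply: ler_wpM2l => //; lra.
pose S := [set a : R | 0 <= a /\ Omega (g a)].
have S1 : S 1 by split; [|rewrite g1].
have hS : has_inf S by split; [exists 1|exists 0 => a []].
have a1 : inf S <= 1 by apply: ge_inf => //; case: hS.
have a0 : 0 <= inf S by apply: lb_le_inf; [exists 1|move=> a []].
have near_inf e : 0 < e -> exists2 b, S b & enorm (g b - g (inf S)) < e.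
  move=> e0; have d0 : 0 < e / (enorm (Y - X) + 1) by exact: divr_gt0.
  have [b Sb bS] := inf_adherent d0 hS; exists b => //; apply: close.
  have : inf S <= b by apply: ge_inf => //; case: hS.
  by move=> ?; rewrite ger0_norm ?subr_ge0//; lra.
have bP : boundary Omega (g (inf S)).
  split.
    move=> U /nbhs_eball[e e0 eU]; have [b [_ Ob] be] := near_inf e e0.
    by exists (g b); split => //; apply: eU.
  move=> /interior_subset OP.
  have [e e0 eO] := (nbhs_eball _ _).1 (open_nbhs_nbhs (conj oO OP)).
  have [i0|ine] := eqVneq (inf S) 0.
    by apply: OX; move: OP; rewrite i0 /g scale0r addr0.
  have ip : 0 < inf S by rewrite lt_neqAle eq_sym ine.
  pose d := Num.min (inf S) (e / (enorm (Y - X) + 1) / 2).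
  have ep : 0 < e / (enorm (Y - X) + 1) by exact: divr_gt0.
  have d0 : 0 < d by rewrite lt_min ip divr_gt0.
  have d1 : d <= inf S by rewrite ge_min lexx.
  have d2 : d < e / (enorm (Y - X) + 1).
    by apply: (@le_lt_trans _ _ (e / (enorm (Y - X) + 1) / 2)); [rewrite ge_min lexx orbT|lra].
  have : S (inf S - d).
    split; first by rewrite subr_ge0.
    apply: eO; apply: close; rewrite addrAC subrr sub0r normrN gtr0_norm//.
  by move=> /(ge_inf hS.2); lra.
have := Xf _ bP; apply/negP; rewrite -ltNge.
have -> : X - g (inf S) = g 0 - g (inf S) by rewrite /g scale0r addr0.
rewrite gd sub0r normrN ger0_norm//; apply: le_lt_trans XY.
by rewrite ler_piMl ?enorm_ge0.
Qed.

Lemma inner_ball_far Omega X rho : open Omega -> eball X rho `<=` Omega ->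
  far_from (boundary Omega) rho X.
Proof.
move=> oO XO z [_ zO]; rewrite leNgt; apply/negP => Xz; apply: zO.
apply: open_nbhs_nbhs; split => //; by apply: XO; rewrite /eball/= enorm_distC.
Qed.

End exterior_corkscrew.

Section complement.
Context {R : realType} (n : nat) (Omega : set 'rV[R]_n.+1).
Local Notation V := 'rV[R]_n.+1.
Local Notation E := (boundary Omega).
Local Notation far_from := (far_from E).
Implicit Types (X Y y z e : V).

(** If all points near [y] at which the Hessian is known to be small belonged to
    [Omega], then Harnack chains from a corkscrew point would make the potential
    almost vanish there, hence also on [E], which contradicts its oscillation. *)
Lemma flat_hessian_complement C cL : (1 <= n)%N -> closed E -> 0 < C -> 0 < cL ->
  (forall X r, 0 < r -> (hausdorff n (E `&` eball X r) <= (C * r ^+ n)%:E)%E) ->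
  (forall x r, E x -> 0 < r -> (r%:E < ediam E)%E ->
    ((cL * r ^+ n)%:E <= hausdorff n (E `&` eball x r))%E) ->
  uniform_domain Omega ->
  exists kappa K, [/\ 0 < kappa, 1 <= K &
    forall y t, E y -> 0 < t -> (t%:E < ediam E)%E ->
    (forall X, enorm (X - y) < K * t -> far_from (t / K) X ->
       forall i j, `|layer_hessian E X i j| < kappa / t) ->
    exists X, [/\ enorm (X - y) < K * t, far_from (t / K) X & ~ Omega X]].
Proof.
move=> n1 cE C0 cL0 upper lower [[oO _] [ci ci0 cork] [L L0 [bound chain]]].
pose c1 := Num.min ci 1.
have c10 : 0 < c1 by rewrite lt_min ci0 ltr01.
have c1i : c1 <= ci by rewrite ge_min lexx.
have c11 : c1 <= 1 by rewrite ge_min lexx orbT.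
have site e s : E e -> 0 < s -> (s%:E < ediam E)%E ->
    exists Y, [/\ Omega Y, far_from (c1 * s) Y & enorm (Y - e) < s].
  move=> Ee s0 sd; have [Y HY] := cork e s Ee s0 sd; exists Y.
  have Yc : eball Y (ci * s) Y by apply: eball_center; exact: mulr_gt0.
  have [Ye OY] := HY _ Yc; split => // z Ez.
  apply: le_trans (inner_ball_far oO (fun p hp => (HY p hp).2) Ez).
  by rewrite ler_pM2r.
have [A A0 compare] := layer_potential_compare n1 cE C0 upper c10.
(* The lower bound of [layer_potential_oscillation]; the regularization and the
   Hessian may each use up a quarter of it. *)
pose b := cL * 8 ^- n.+1 / 4.
have b0 : 0 < b by rewrite /b divr_gt0// mulr_gt0// invr_gt0 exprn_gt0.
have [eps [eps0 eps8 Aeps]] : exists eps, [/\ 0 < eps, eps <= 1 / 8 & A * Num.sqrt eps <= b / 4].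
  have q0 : 0 < b / (4 * (A + 1)) by apply: divr_gt0 => //; lra.
  exists (Num.min (1 / 8) ((b / (4 * (A + 1))) ^+ 2)); split.
  - by rewrite lt_min exprn_gt0// andbT; lra.
  - by rewrite ge_min lexx.
  - apply: (@le_trans _ _ (A * (b / (4 * (A + 1))))).
      apply: ler_wpM2l => //; rewrite -[leRHS](gtr0_norm q0) -sqrtr_sqr.
      by apply: ler_wsqrtr; rewrite ge_min lexx orbT.
    rewrite mulrA ler_pdivrMr; last lra.
    have -> : b / 4 * (4 * (A + 1)) = b * (A + 1) by field.
    by rewrite mulrC ler_pM2l//; lra.
pose Lambda := 4 / (c1 * eps).
have ce0 : 0 < c1 * eps by exact: mulr_gt0.
have ce1 : c1 * eps <= eps by apply: ler_piMl => //; exact: ltW.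
have Lambda1 : 1 <= Lambda by rewrite ler_pdivlMr//; lra.
pose N := bound Lambda; pose G := (1 + L) ^+ N.
have G1 : 1 <= G by apply: exprn_ege1; rewrite lerDl ltW.
(* [G] bounds the factor by which the distances change along a chain of [N] balls that
   joins points at distance [c1 * eps * t] from the boundary. *)
pose K := 2 * G / (c1 * eps).
have Kce : K * (c1 * eps) = 2 * G by rewrite divfK ?gt_eqF.
have K0 : 0 < K by rewrite divr_gt0//; lra.
have eK : 1 <= eps * K by nra.
have K1 : 1 <= K by nra.
pose w := (N%:R * (n.+1%:R * (L * G))) ^+ 2.
have w0 : 0 <= w by exact: sqr_ge0.
pose kappa := b / 4 / (w + 1).
have kappa0 : 0 < kappa by rewrite divr_gt0 ?divr_gt0//; lra.
have wkappa : w * kappa <= b / 4.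
  rewrite /kappa mulrA ler_pdivrMr; last lra.
  by nra.
exists kappa, K; split => // y t Ey t0 tE small.
apply: contrapT => none.
have inside X : enorm (X - y) < K * t -> far_from (t / K) X -> Omega X.
  by move=> Xy Xf; apply: contrapT => OX; apply: none; exists X.
have [Xs [OXs Xsf Xsy]] := site y t Ey t0 tE.
have et0 : 0 < eps * t by exact: mulr_gt0.
have etE : ((eps * t)%:E < ediam E)%E.
  by apply: lt_trans tE; rewrite lte_fin; nra.
have flat X : enorm (X - y) <= t -> `|layer_potential E Xs (eps * t) X| <= b / 2 * t.
  move=> Xy.
  (* A point too close to the boundary is replaced by a corkscrew point. *)
  have [X' [OX' X'f X'X]] : exists X', [/\ Omega X', far_from (c1 * (eps * t)) X' &
      enorm (X - X') <= 2 * eps * t].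
    have [Xf|/existsNP[e /not_implyP[Ee /negP]]] := pselect (far_from (eps * t) X).
      exists X; split; first 1 last.
      - by move=> z Ez; apply: le_trans (Xf z Ez); rewrite ler_piMl// ltW.
      - by rewrite subrr enorm0 -mulrA; apply/ltW/mulr_gt0.
      apply: inside; first by nra.
      move=> z Ez; apply: le_trans (Xf z Ez); rewrite ler_pdivrMr//; nra.
    rewrite -ltNge => Xe; have [Y [OY Yf Ye]] := site e _ Ee et0 etE.
    exists Y; split => //; have := ler_enorm_dist X e Y.
    by rewrite [enorm (e - Y)]enorm_distC; lra.
  have X'y : enorm (X' - y) <= 2 * t.
    have := ler_enorm_dist X' X y; rewrite [enorm (X' - X)]enorm_distC; nra.
  have rho0 : 0 < c1 * (eps * t) by exact: mulr_gt0.
  have eps1 : eps <= 1 by lra.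
  have cmp := compare t eps y X X' Xs _ t0 eps0 eps1 Xy X'y (ltW Xsy) Xsf rho0 X'f X'X.
  have Xsf' : far_from (c1 * (eps * t)) Xs.
    by move=> z Ez; apply: le_trans (Xsf z Ez); rewrite ler_pM2l//; nra.
  have dist : enorm (Xs - X') < Lambda * (c1 * (eps * t)).
    have -> : Lambda * (c1 * (eps * t)) = 4 * t.
      by rewrite /Lambda; field; rewrite !gt_eqF.
    by have := ler_enorm_dist Xs y X'; rewrite [enorm (y - X')]enorm_distC; lra.
  have [m [c [s [mN HC]]]] := chain _ Lambda Xs X' rho0 Lambda1 OXs OX'
    (point_dist_far Xsf') (point_dist_far X'f) dist.
  have KN : (1 + L) ^+ N < K by rewrite -/G; nra.
  have KNc : (1 + L) ^+ N <= c1 * K by rewrite -/G; nra.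
  have u := harnack_chain_potential n1 cE C0 upper L0 c10 kappa0 t0 KN KNc Ey Xsf
    (ltW Xsy) small erefl mN HC.
  rewrite -[layer_potential E Xs (eps * t) X](subrK (layer_potential E Xs 0 X')).
  apply: le_trans (ler_normD _ _) _; apply: le_trans (lerD cmp u) _.
  rewrite -/G -/w; nra.
have t8E : ((t / 8)%:E < ediam E)%E by apply: lt_trans tE; rewrite lte_fin; lra.
have t80 : 0 < t / 8 by lra.
have et8 : eps * t <= t / 8 by nra.
have c1t0 : 0 < c1 * t by exact: mulr_gt0.
have := layer_potential_oscillation n1 cE C0 upper cL0 et0 et8 c1t0 Xsf
  (lower _ _ Ey t80 t8E) flat.
rewrite -/b; nra.
Qed.

End complement.

Theorem theorem1p1 (R : realType) (n : nat) (hn : (1 <= n)%N)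
    (Omega : set 'rV[R]_n.+1) :
  uniform_domain Omega -> UR (boundary Omega) -> chord_arc_domain Omega.
Proof.
move=> unif [adr [CU carleson]]; split => //; split => //.
have [cE [C1 C10 reg]] := adr.
have [E0|E0] := leP (ediam (boundary Omega)) 0%E.
  exists 1 => // x r _ r0 rE; have := lt_le_trans rE E0.
  by rewrite lte_fin ltNge (ltW r0).
have [C C0 upper] := ADR_upper adr E0.
have cL0 : 0 < C1^-1 by rewrite invr_gt0.
have lower x r : boundary Omega x -> 0 < r -> (r%:E < ediam (boundary Omega))%E ->
    ((C1^-1 * r ^+ n)%:E <= hausdorff n (boundary Omega `&` eball x r))%E.
  by move=> Ex r0 rE; have [] := reg x r Ex r0 rE.
have [kappa [K [kappa0 K1 compl]]] := flat_hessian_complement hn cE C0 cL0 upper lower unif.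
have [c c0 scale] := good_scale hn cE C0 upper cL0 lower carleson kappa0 K1.
have K0 : 0 < K := lt_le_trans ltr01 K1.
exists (c / K) => [|x r Ex r0 rE]; first exact: divr_gt0.
have [y [t [Ey yx ct tr small]]] := scale x r Ex r0 rE.
have t0 : 0 < t by apply: lt_le_trans ct; exact: mulr_gt0.
have tE : (t%:E < ediam (boundary Omega))%E by apply: le_lt_trans rE; rewrite lee_fin; nra.
have [X [Xy Xf OX]] := compl y t Ey t0 tE small.
have tK : t / K <= t by rewrite ler_pdivrMr//; nra.
have sub : c / K * r <= t / K by rewrite mulrAC ler_pM2r ?invr_gt0.
have [[oO _] _ _] := unif.
exists X => Z XZ; split.
  apply: (@eball_sub _ _ X x (t / K) r); last first.
    by apply: (eball_sub _ XZ); rewrite subrr enorm0 add0r.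
  have := ler_enorm_dist X y x; nra.
apply: (exterior_ball oO OX Xf); apply: (eball_sub _ XZ).
by rewrite subrr enorm0 add0r.
Qed.
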